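(* Let $P_0$ be a probability distribution on $\mathbb{R}$ with finite second moment. For every $\lambda>0$, $$\lim_{n\to\infty}\frac1n I(\mathbf X,\mathbf Y)=\frac{\lambda\,(\mathbb{E}_{P_0}[X^2])^2}{4}-\sup_{q\ge 0}\mathcal F(\lambda,q).$$ This limit is a concave function of $\lambda\in(0,+\infty)$. Let $D\subset(0,+\infty)$ be the set of points where this function of $\lambda$ is differentiable (by concavity, $D$ is $(0,+\infty)$ minus a countable set). Then for all $\lambda\in D$, the maximizer $q^*(\lambda)$ of $q\ge 0\mapsto\mathcal F(\lambda,q)$ is unique and $$\lim_{n\to\infty}\mathrm{MMSE}_n(\lambda)=(\mathbb{E}_{P_0}[X^2])^2-q^*(\lambda)^2 .$$
   Context: For $\lambda>0$ and $n\ge 1$, consider the observations $Y_{i,j}=\sqrt{\lambda/n}\,X_iX_j+Z_{i,j}$ for $1\le i<j\le n$, where $X_i\overset{i.i.d.}{\sim}P_0$ and $Z_{i,j}\overset{i.i.d.}{\sim}\mathcal N(0,1)$ are independent. Write $\mathbf X=(X_1,\dots,X_n)$, $\mathbf Y=(Y_{i,j})_{1\le i<j\le n}$. $I(\mathbf X,\mathbf Y)$ is the mutual information (natural logarithm). $\mathbb{E}_{P_0}$ denotes expectation for $X\sim P_0$. The matrix minimum mean square error is $$\mathrm{MMSE}_n(\lambda)=\min_{\hat\theta}\frac{2}{n(n-1)}\sum_{1\le i<j\le n}\mathbb{E}\big[(X_iX_j-\hat\theta_{i,j}(\mathbf Y))^2\big]=\frac{2}{n(n-1)}\sum_{1\le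 i<j\le n}\mathbb{E}\big[(X_iX_j-\mathbb{E}[X_iX_j|\mathbf Y])^2\big],$$ the minimum being over all estimators (measurable functions of $\mathbf Y$, possibly using independent auxiliary randomness). For $\lambda,q\ge 0$, $$\mathcal F(\lambda,q)=-\frac{\lambda}{4}q^2+\mathbb{E}\log\left(\int dP_0(x)\exp\Big(\sqrt{\lambda q}\,Zx+\lambda q\,xX-\frac{\lambda}{2}q x^2\Big)\right),$$ with $Z\sim\mathcal N(0,1)$ and $X\sim P_0$ independent. *)

(* Defs.v *)
From HB Require Import structures.
From mathcomp Require Import all_boot all_order all_algebra.
From mathcomp Require Import all_classical all_reals all_analysis.
From mathcomp Require Import measurable_realfun.

Set Implicit Arguments.
Unset Strict Implicit.
Unset Printing Implicit Defensive.

Import Order.TTheory GRing.Theory Num.Theory.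
Import numFieldNormedType.Exports.

Local Open Scope classical_set_scope.
Local Open Scope ring_scope.

Section information.
Context {R : realType}.

(* The junk value [ln 0 = 0] is harmless: the density vanishes only on a
   [mu]-null set.  The negative part of the integrand is always integrable. *)
Definition kl_divergence d (T : measurableType d) (mu nu : probability T R)
    : \bar R :=
  if pselect (mu `<< nu) then
    (\int[mu]_x
       (ln (fine (Radon_Nikodym (charge_of_finite_measure mu) nu x)))%:E)%E
  else +oo%E.

Section joint_rv.
Context d d1 d2 {Om : measurableType d} {T1 : measurableType d1}
  {T2 : measurableType d2}.
Variables (U : {mfun Om >-> T1}) (V : {mfun Om >-> T2}).

Definition joint_rv (w : Om) : T1 * T2 := (U w, V w).

Let measurable_joint_rv : measurable_fun [set: Om] joint_rv.
Proof. by apply: measurable_fun_pair; exact: measurable_funPT. Qed.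

HB.instance Definition _ :=
  isMeasurableFun.Build _ _ _ _ joint_rv measurable_joint_rv.

End joint_rv.

Definition mutual_information d d1 d2 {Om : measurableType d}
    {T1 : measurableType d1} {T2 : measurableType d2} (P : probability Om R)
    (U : {RV P >-> T1}) (V : {RV P >-> T2}) : \bar R :=
  kl_divergence (distribution P (joint_rv U V))
    (distribution P U \x distribution P V)%E.

(* For a finite family, subfamilies are covered by taking [B i = setT]. *)
Definition mutually_independent d {Om : measurableType d}
    (P : probability Om R) (I : finType) (W : I -> {RV P >-> R}) : Prop :=
  forall B : I -> set R, (forall i, measurable (B i)) ->
    P (\bigcap_(i in [set: I]) (W i @^-1` B i)) =
    (\prod_(i : I) P (W i @^-1` B i))%E.

End information.
Arguments mutual_information {R d d1 d2 Om T1 T2} P U V.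
Arguments mutually_independent {R d Om} P {I} W.

Definition edge (n : nat) : finType := {e : 'I_n * 'I_n | (e.1 < e.2)%N}.

Section observations.
Context {R : realType} d {Om : measurableType d} (n : nat).
Variables (X : 'I_n -> {mfun Om >-> R}) (Z : edge n -> {mfun Om >-> R}).

Definition spike (e : edge n) (w : Om) : R := X (val e).1 w * X (val e).2 w.

Definition signal (w : Om) : n.-tuple R := [tuple X i w | i < n].

(* The entries [Y_{i,j}], [i < j], are listed in the order of [enum (edge n)]. *)
Definition observation (lambda : R) (w : Om) : #|edge n|.-tuple R :=
  [tuple Num.sqrt (lambda / n%:R) * spike (enum_val k) w + Z (enum_val k) w
    | k < #|edge n|].

Let measurable_signal : measurable_fun [set: Om] signal.
Proof.
apply/measurable_fun_tnthP => i.
rewrite (_ : _ \o _ = X i); first exact: measurable_funPT.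
by apply/funext => w /=; rewrite tnth_mktuple.
Qed.

HB.instance Definition _ :=
  isMeasurableFun.Build _ _ _ _ signal measurable_signal.

Let measurable_observation lambda :
  measurable_fun [set: Om] (observation lambda).
Proof.
apply/measurable_fun_tnthP => k.
rewrite (_ : _ \o _ = (fun w => Num.sqrt (lambda / n%:R) *
    (X (val (enum_val k)).1 w * X (val (enum_val k)).2 w) +
    Z (enum_val k) w)).
  apply: measurable_funD; last exact: measurable_funPT.
  apply: measurable_funM; first exact: measurable_cst.
  by apply: measurable_funM; exact: measurable_funPT.
by apply/funext => w /=; rewrite tnth_mktuple.
Qed.

HB.instance Definition _ lambda :=
  isMeasurableFun.Build _ _ _ _ (observation lambda)
    (measurable_observation lambda).

End observations.

Section model.
Context {R : realType} d {Om : measurableType d} (P : probability Om R).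
Variable n : nat.
Variables (X : 'I_n -> {RV P >-> R}) (Z : edge n -> {RV P >-> R}).

Definition spiked_wigner (P0 : probability R R) : Prop :=
  [/\ (forall i (A : set R), measurable A -> distribution P (X i) A = P0 A),
      (forall e (A : set R), measurable A ->
         distribution P (Z e) A = normal_prob (0 : R) 1 A) &
      mutually_independent P (fun s : 'I_n + edge n =>
        match s with inl i => X i | inr e => Z e end)].

(* A randomized estimator takes, besides the observation, a sample of law [Q]
   independent of everything else; deterministic estimators are those that
   ignore it. *)
Definition mse (lambda : R) dS (S : measurableType dS) (Q : probability S R)
    (theta : edge n -> #|edge n|.-tuple R * S -> R) : \bar R :=
  ((2 / (n%:R * (n%:R - 1)))%:E *
   \sum_(e : edge n)
     \int[P \x Q]_w
       ((spike X e w.1 - theta e (observation X Z lambda w.1, w.2)) ^+ 2)%:E)%E.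

(* The infimum is attained, by the posterior means [E[X_i X_j | Y]]. *)
Definition mmse (lambda : R) : \bar R :=
  ereal_inf [set m | exists dS (S : measurableType dS) (Q : probability S R)
    (theta : edge n -> #|edge n|.-tuple R * S -> R),
      (forall e, measurable_fun [set: _] (theta e)) /\
      m = mse lambda Q theta].

End model.
Arguments spiked_wigner {R d Om} P {n} X Z P0.
Arguments mse {R d Om} P {n} X Z lambda {dS S} Q theta.
Arguments mmse {R d Om} P {n} X Z lambda.

Section replica_formula.
Context {R : realType} (P0 : probability R R).

Definition second_moment : R := \int[P0]_x (x ^+ 2).

(* [w.1] is [X] and [w.2] is [Z], under the law [P0 \x N(0, 1)]. *)
Definition potential (lambda q : R) : R :=
  - (lambda / 4) * q ^+ 2 +
  \int[(P0 \x normal_prob (0 : R) 1)%E]_w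
    ln (\int[P0]_x
      expR (Num.sqrt (lambda * q) * w.2 * x + lambda * q * x * w.1
            - lambda / 2 * q * x ^+ 2)).

Definition is_maximizer (lambda q : R) : Prop :=
  0 <= q /\ forall q', 0 <= q' -> potential lambda q' <= potential lambda q.

(* When [P0] has a finite second moment, the integrals in [potential] converge
   and [potential lambda] is bounded above on [q >= 0] for [lambda > 0], so
   that [sup] is a genuine supremum. *)
Definition limit_information (lambda : R) : R :=
  lambda * second_moment ^+ 2 / 4 -
  sup [set potential lambda q | q in [set q | 0 <= q]].

Definition differentiability_points : set R :=
  [set lambda | 0 < lambda /\
    derivable (limit_information : R^o -> R^o) lambda 1].

End replica_formula.

(* Main.v *)
(* Write [J n lam] for the expectation of the log-likelihood ratio of [Y] against
   pure noise, so that [I(X, Y) = lam (n - 1) rho ^ 2 / 4 - J n lam], where [rho] is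
   the second moment of [P0].  The central tool is a tangent inequality for the
   Gaussian channel [Y = U + Z]: by Gibbs' inequality the law of [Y] is its own best
   reference, and by Jensen's inequality moving the signal from [V] to [U] changes
   the expected log-likelihood ratio by at least [E[<V> . (U - V)]].  Iterated along
   fine subdivisions it replaces differentiation in all interpolation arguments, and
   it also gives Lipschitz dependence on the signal in L2, so that [P0] may be
   replaced by a finitely supported prior.

   Lower bound: Guerra's interpolation between the matrix channel and [n] scalar
   channels, using that a squared replica overlap is nonnegative.  Upper bound: for a
   fixed planted signal [x'], interpolate from scalar channels whose intensity depends
   on the configuration [x] through its overlap with [x'], rounded to a finite grid;
   at time 0 the partition function is bounded by a sum over the grid of products of
   scalar ones, and the law of large numbers concludes.

   Writing [pot lam q = - lam q ^ 2 / 4 + psi (lam q)], [psi] is convex because a noisy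
   observation can be degraded into a noisier one.  Testing [pot lam'] at [q'] with
   [lam' q' = lam q] shows that [phi = sup pot] has the tangent slope
   [(lam q) ^ 2 / 4] in the variable [- 1 / lam] for every maximizer [q]: hence
   [phi' = q ^ 2 / 4] at points of differentiability, [q] is unique there, and the
   exceptional points are jumps of a monotone function.  The limit of the minimum mean
   square error follows by differentiating [J n lam / n] through the tangent
   inequality. *)

Require Import Defs.
From HB Require Import structures.
From mathcomp Require Import all_boot all_order all_algebra.
From mathcomp Require Import all_classical all_reals all_analysis.
From mathcomp Require Import measurable_realfun ring lra.

Set Implicit Arguments.
Unset Strict Implicit.
Unset Printing Implicit Defensive.

Import Order.TTheory GRing.Theory Num.Theory.
Import numFieldNormedType.Exports.

Local Open Scope classical_set_scope.
Local Open Scope ring_scope.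

(** * Gaussian integrals *)

(** Amplitudes are square roots of signal-to-noise ratios, so interpolation paths are singular at
    their ends. The tangent inequality needs no derivative: over a subdivision it leaves a sum of
    squared increments of amplitudes, which vanishes with the mesh.

    The sign of an overlap term shapes the rest. Averaged over the posterior, the overlap with the
    true signal and that of two replicas have the same law, and dropping their common square can
    only give the lower bound. Fixing the planted signal separates the two: the replica square then
    enters the upper bound with a favourable sign, while the planted one is made small by letting
    the amplitude of the scalar channels follow the overlap of each configuration. Overlaps may be
    negative whereas the potential only sees [q >= 0]; an overlap is therefore encoded as a signed
    square [r * |r|], with [q = r ^ 2], and reading data with the wrong sign of [r] is only a worse
    reference in Gibbs' inequality.

    Finite support turns posteriors into Gibbs measures on finite sets and bounds the diagonal terms
    [i = j] independently of [n]. *)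

Section lebesgue_affine.
Context {R : realType}.
Local Notation leb := (@lebesgue_measure R).

Lemma measurable_affine (a c : R) :
  measurable_fun [set: R] (fun x : R => a * x + c).
Proof. by apply: measurable_funD => //; exact: measurable_funM. Qed.

(** [lebesgue_measure] lives on the alias [measurableTypeR R]; the map is typed there so that its
    pushforward is comparable with it. *)
Let aff (a c x : measurableTypeR R) : measurableTypeR R := a * x + c.

Let maff a c : measurable_fun setT (aff a c).
Proof. exact: measurable_affine. Qed.

(** Both sides are measures in [A] that agree on half-open intervals, whose preimages have their
    length divided by [a]. *)
Lemma lebesgue_measure_affine (a c : R) (A : set R) : 0 < a -> measurable A ->
  (a%:E * pushforward leb (aff a c) A)%E = leb A.
Proof.
move=> a0 mA.
pose mm0 := mscale (NngNum (ltW a0)) (pushforward leb (aff a c)).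
pose mm : {measure set (measurableTypeR R) -> \bar R} := mm0 (maff a c).
apply/esym.
rewrite -[RHS]/(mm A).
apply: lebesgue_measure_unique => //= _ [[u v]] _ <-.
rewrite /mscale/= /pushforward/=.
have -> : aff a c @^-1` `]u, v] = `](u - c) / a, (v - c) / a]%classic.
  apply/seteqP; split => x /=; rewrite !in_itv/= /aff => /andP[h1 h2].
    by apply/andP; split; rewrite ?ltr_pdivrMr ?ler_pdivlMr// mulrC; lra.
  move: h1 h2; rewrite ltr_pdivrMr ?ler_pdivlMr// mulrC => h1 h2.
  by apply/andP; split; lra.
rewrite !lebesgue_measure_itv/= !lte_fin ltr_pM2r ?invr_gt0// ltrD2r.
case: ifPn => _; last by rewrite mule0.
rewrite -!EFinB -EFinM; congr EFin.
field.
by rewrite gt_eqF.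
Qed.

Lemma ge0_integral_lebesgue_affine (a c : R) (f : R -> \bar R) : 0 < a ->
  measurable_fun setT f -> (forall x, 0 <= f x)%E ->
  (\int[leb]_x f x = a%:E * \int[leb]_x f (a * x + c)%R)%E.
Proof.
move=> a0 mf f0.
pose mm0 := mscale (NngNum (ltW a0)) (pushforward leb (aff a c)).
pose mm : {measure set (measurableTypeR R) -> \bar R} := mm0 (maff a c).
transitivity (\int[mm]_x f x)%E.
  apply: eq_measure_integral => //= A mA _.
  by rewrite -(@lebesgue_measure_affine a c).
rewrite /mm ge0_integral_mscale//=.
by rewrite ge0_integral_pushforward.
Qed.

End lebesgue_affine.

(** By uniqueness [g] coincides [mu]-almost everywhere with the Radon-Nikodym derivative of [nu],
    for which the change of variables is known. *)
Lemma ge0_integral_density d (T : measurableType d) (R : realType)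
    (mu : {sigma_finite_measure set T -> \bar R})
    (nu : {finite_measure set T -> \bar R}) (g f : T -> \bar R) :
  measurable_fun setT g -> (forall x, 0 <= g x)%E ->
  (forall A, measurable A -> nu A = \int[mu]_(x in A) g x)%E ->
  measurable_fun setT f -> (forall x, 0 <= f x)%E ->
  (\int[nu]_x f x = \int[mu]_x (f x * g x))%E.
Proof.
move=> mg g0 nug mf f0.
have dom : nu `<< mu.
  apply/null_content_dominatesP => A mA muA0; rewrite nug//.
  by apply: null_set_integral => //; exact: measurable_funTS.
have ig : mu.-integrable setT g.
  apply/integrableP; split => //.
  under eq_integral do rewrite gee0_abs//.
  by rewrite -nug// -ge0_fin_numE// fin_num_measure.
rewrite -(Radon_Nikodym_SigmaFinite.change_of_variables dom)//.
apply: ae_eq_integral => //.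
- apply: emeasurable_funM => //.
  exact: measurable_int (Radon_Nikodym_SigmaFinite.f_integrable dom).
- exact: emeasurable_funM.
- have : ae_eq mu setT (Radon_Nikodym_SigmaFinite.f nu mu) g.
    apply: integral_ae_eq => //; first exact: Radon_Nikodym_SigmaFinite.f_integrable.
    by move=> A AE mA; rewrite -nug// -Radon_Nikodym_SigmaFinite.f_integral.
  by apply: filterS => x /= h Dx; rewrite h.
Qed.

Section standard_normal.
Context {R : realType}.
Local Notation leb := (@lebesgue_measure R).
Local Notation phi := (normal_pdf (0 : R) 1).

Lemma normal_pdf01E (x : R) : phi x = normal_peak 1 * expR (- (x ^+ 2 / 2)).
Proof.
rewrite normal_pdfE ?oner_neq0// /normal_fun; congr (_ * expR _).
by rewrite subr0 expr1n -mulr_natl mulr1 mulNr.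
Qed.

Lemma ge0_integral_normal (f : R -> \bar R) :
  measurable_fun setT f -> (forall x, 0 <= f x)%E ->
  (\int[normal_prob (0 : R) 1]_x f x = \int[leb]_x (f x * (phi x)%:E))%E.
Proof.
move=> mf f0; apply: ge0_integral_density => //.
- by apply/measurable_EFinP; exact: measurable_normal_pdf.
- by move=> x; rewrite lee_fin normal_pdf_ge0.
Qed.

(** Translation invariance moves the shift onto the Gaussian density; the exponential is the
    likelihood ratio of N(c, 1) against N(0, 1). *)
Lemma ge0_integral_normal_shift (c : R) (f : R -> \bar R) :
  measurable_fun setT f -> (forall x, 0 <= f x)%E ->
  (\int[normal_prob (0 : R) 1]_x f (x + c)%R =
   \int[normal_prob (0 : R) 1]_x (f x * (expR (c * x - c ^+ 2 / 2))%:E))%E.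
Proof.
move=> mf f0.
have me : measurable_fun setT (fun x : R => expR (c * x - c ^+ 2 / 2)).
  by apply: measurableT_comp => //; exact: measurable_affine.
have ms : measurable_fun setT (fun x : R => f (x + c)).
  by apply: (measurableT_comp mf); exact: measurable_funD.
rewrite !ge0_integral_normal//; last 2 first.
- by apply: emeasurable_funM => //; exact/measurable_EFinP.
- by move=> x; rewrite mule_ge0// lee_fin expR_ge0.
have mp : measurable_fun setT (fun x : R => (phi x)%:E).
  by apply/measurable_EFinP; exact: measurable_normal_pdf.
rewrite [RHS](@ge0_integral_lebesgue_affine _ 1 c)//; last 2 first.
- by apply: emeasurable_funM => //; apply: emeasurable_funM => //; exact/measurable_EFinP.
- by move=> x; rewrite !mule_ge0// lee_fin ?expR_ge0// normal_pdf_ge0.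
rewrite mul1e; apply: eq_integral => x _.
rewrite mul1r -muleA; congr (_ * _)%E; rewrite -EFinM; congr EFin.
rewrite !normal_pdf01E mulrCA -expRD; congr (_ * expR _).
by field.
Qed.

(* Completing the square: [y^2 + (u - b y)^2 / a^2 = u^2 + (y - b u)^2 / a^2]
   when [a^2 + b^2 = 1]. *)
Lemma ge0_integral_normal_rotation (a b : R) (f : R -> \bar R) :
  0 < a -> a ^+ 2 + b ^+ 2 = 1 ->
  measurable_fun setT f -> (forall x, 0 <= f x)%E ->
  (\int[normal_prob (0 : R) 1]_y \int[normal_prob (0 : R) 1]_x f (a * x + b * y)%R =
   \int[normal_prob (0 : R) 1]_x f x)%E.
Proof.
move=> a0 ab1 mf f0.
have mp : measurable_fun setT (fun x : R => (phi x)%:E).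
  by apply/measurable_EFinP; exact: measurable_normal_pdf.
have an0 : a != 0 by rewrite gt_eqF.
pose k (y u : R) := a^-1 * phi ((u - b * y) / a).
have k0 y u : 0 <= k y u by rewrite mulr_ge0 ?normal_pdf_ge0// invr_ge0 ltW.
have mk2 : measurable_fun setT (fun p : R * R => (k p.1 p.2)%:E).
  apply/measurable_EFinP; apply: measurable_funM => //.
  apply: (measurableT_comp (measurable_normal_pdf _ _)).
  apply: measurable_funM => //; apply: measurable_funB => //.
  exact: measurable_funM.
have mk y : measurable_fun setT (fun u : R => (k y u)%:E).
  exact: (measurableT_comp mk2 (pair1_measurable y)).
have mk' u : measurable_fun setT (fun y : R => (k y u)%:E).
  exact: (measurableT_comp mk2 (pair2_measurable u)).
have mfk : measurable_fun setT (fun p : R * R => (f p.2 * (k p.1 p.2)%:E)%E).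
  by apply: emeasurable_funM => //; exact: (measurableT_comp mf measurable_snd).
have inner y : (\int[normal_prob (0 : R) 1]_x f (a * x + b * y)%R =
    \int[leb]_u (f u * (k y u)%:E))%E.
  rewrite ge0_integral_normal//; last first.
    by apply: (measurableT_comp mf); exact: measurable_affine.
  rewrite [RHS](@ge0_integral_lebesgue_affine _ a (b * y))//; last 2 first.
  - exact: emeasurable_funM.
  - by move=> u; rewrite mule_ge0// lee_fin.
  rewrite -ge0_integralZl//; last 3 first.
  - apply: (@measurableT_comp _ _ _ _ _ _ (fun u => f u * (k y u)%:E)%E).
      exact: emeasurable_funM.
    exact: measurable_affine.
  - by move=> u _; rewrite mule_ge0// lee_fin.
  - by rewrite lee_fin ltW.
  apply: eq_integral => x _; rewrite muleCA -EFinM /k; congr (_ * _%:E)%E.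
  rewrite mulrA mulfV// mul1r; congr phi.
  by field.
under eq_integral do rewrite inner.
rewrite [LHS]ge0_integral_normal; last 2 first.
- refine (@measurable_fun_fubini_tonelli_F _ _ _ _ _ leb _ mfk _).
  by move=> p; rewrite mule_ge0// lee_fin.
- by move=> y; apply: integral_ge0 => u _; rewrite mule_ge0// lee_fin.
transitivity (\int[leb]_y \int[leb]_u (f u * (k y u)%:E * (phi y)%:E))%E.
  apply: eq_integral => y _; rewrite -ge0_integralZr//.
  - by apply: emeasurable_funM; [exact: mf|exact: mk].
  - by move=> u _; rewrite mule_ge0// lee_fin.
  - by rewrite lee_fin normal_pdf_ge0.
rewrite (@fubini_tonelli _ _ _ _ _ leb leb
  (fun p : R * R => f p.2 * (k p.1 p.2)%:E * (phi p.1)%:E)%E)//; last 2 first.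
- apply: emeasurable_funM => //; exact: (measurableT_comp mp measurable_fst).
- by move=> p; rewrite !mule_ge0// lee_fin// normal_pdf_ge0.
rewrite ge0_integral_normal//; apply: eq_integral => u _ /=.
pose h y := (a^-1 * phi ((y - b * u) / a))%:E.
have mh : measurable_fun setT h.
  apply/measurable_EFinP; apply: measurable_funM => //.
  apply: (measurableT_comp (measurable_normal_pdf _ _)).
  by apply: measurable_funM => //; exact: measurable_funB.
have h0 y : (0 <= h y)%E.
  by rewrite lee_fin mulr_ge0 ?normal_pdf_ge0// invr_ge0 ltW.
transitivity (\int[leb]_y (f u * (phi u)%:E * h y))%E.
  apply: eq_integral => y _; rewrite -!muleA; congr (_ * _)%E.
  rewrite -!EFinM /k; congr EFin.
  rewrite [RHS]mulrCA -[LHS]mulrA; congr (_ * _).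
  rewrite !normal_pdf01E mulrACA [RHS]mulrACA -!expRD; congr (_ * expR _).
  apply: (@mulfI _ (2 * a ^+ 2)); first by rewrite mulf_neq0// expf_neq0.
  have ab : b ^+ 2 = 1 - a ^+ 2 by rewrite -ab1 addrC addKr.
  rewrite !exprMn !exprVn; field: ab.
  exact: an0.
rewrite ge0_integralZl//; last by rewrite mule_ge0// lee_fin normal_pdf_ge0.
rewrite (@ge0_integral_lebesgue_affine _ a (b * u))//.
rewrite -ge0_integralZl//; last 2 first.
- by apply: (@measurableT_comp _ _ _ _ _ _ h) => //; exact: measurable_affine.
- by rewrite lee_fin ltW.
rewrite -[RHS]mule1 -(integral_normal_pdf (0 : R) 1); congr (_ * _)%E.
apply: eq_integral => y _; rewrite /h -EFinM mulrA mulfV// mul1r.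
by congr (phi _)%:E; field.
Qed.

End standard_normal.

(** * Real-valued expectations, laws and products *)

Notation intg P f := (integrable P [set: _] (EFin \o f)).

Section expectation.
Context d (T : measurableType d) (R : realType) (P : probability T R).
Implicit Types f g : T -> R.

Lemma intg_measurable f : intg P f -> measurable_fun setT f.
Proof. by move=> /measurable_int /measurable_EFinP. Qed.

Lemma intg_cst (c : R) : intg P (fun=> c).
Proof. exact: finite_measure_integrable_cst. Qed.

Lemma intg_dom f g : measurable_fun setT f -> intg P g ->
  (forall x, `|f x| <= g x) -> intg P f.
Proof.
move=> mf ig fg; apply: (le_integrable _ _ _ ig) => //.
  exact/measurable_EFinP.
by move=> x _; rewrite lee_fin (le_trans (fg x))// ler_norm.
Qed.

Lemma intg_bnd f (c : R) : measurable_fun setT f ->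
  (forall x, `|f x| <= c) -> intg P f.
Proof. by move=> mf fc; apply: (intg_dom mf (intg_cst c)). Qed.

Lemma intgD f g : intg P f -> intg P g -> intg P (fun x => f x + g x).
Proof. by move=> iff ig; exact: (integrableD measurableT iff ig). Qed.

Lemma intgB f g : intg P f -> intg P g -> intg P (fun x => f x - g x).
Proof. by move=> iff ig; exact: (integrableB measurableT iff ig). Qed.

Lemma intgZ (c : R) f : intg P f -> intg P (fun x => c * f x).
Proof. by move=> iff; exact: (integrableZl measurableT c iff). Qed.

Lemma intgZr (c : R) f : intg P f -> intg P (fun x => f x * c).
Proof.
move=> /(intgZ c); apply: eq_integrable => // x _ /=; by rewrite mulrC.
Qed.

Lemma intgN f : intg P f -> intg P (fun x => - f x).
Proof.
move=> /(intgZ (-1)); apply: eq_integrable => // x _ /=; by rewrite mulN1r.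
Qed.

Lemma intg_norm f : intg P f -> intg P (fun x => `|f x|).
Proof.
move=> iff; apply: (le_integrable _ _ _ iff) => //.
- apply/measurable_EFinP; apply: measurableT_comp => //.
  exact: intg_measurable.
- by move=> x _ /=; rewrite normr_id.
Qed.

Lemma intg_sum (I : Type) (s : seq I) (Q : pred I) (f : I -> T -> R) :
  (forall i, Q i -> intg P (f i)) -> intg P (fun x => \sum_(i <- s | Q i) f i x).
Proof.
move=> h.
have := @integrable_sum _ _ _ P setT measurableT I s Q (fun i x => (f i x)%:E) h.
by apply: eq_integrable => // x _ /=; rewrite sumEFin.
Qed.

Lemma RintD f g : intg P f -> intg P g ->
  \int[P]_x (f x + g x) = \int[P]_x f x + \int[P]_x g x.
Proof. by move=> *; rewrite RintegralD. Qed.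

Lemma RintB f g : intg P f -> intg P g ->
  \int[P]_x (f x - g x) = \int[P]_x f x - \int[P]_x g x.
Proof. by move=> *; rewrite RintegralB. Qed.

Lemma RintZ (c : R) f : intg P f -> \int[P]_x (c * f x) = c * \int[P]_x f x.
Proof. by move=> *; rewrite RintegralZl. Qed.

Lemma RintZr (c : R) f : intg P f -> \int[P]_x (f x * c) = (\int[P]_x f x) * c.
Proof. by move=> *; rewrite RintegralZr. Qed.

Lemma RintN f : intg P f -> \int[P]_x (- f x) = - \int[P]_x f x.
Proof.
move=> iff; rewrite -mulN1r -RintZ//.
by congr fine; apply: eq_integral => x _; rewrite mulN1r.
Qed.

Lemma Rint_cst (c : R) : \int[P]_x c = c.
Proof.
rewrite Rintegral_cst//; have h : P setT = 1%E by exact: probability_setT.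
by rewrite [X in fine X]h mulr1.
Qed.

Lemma Rint_le f g : intg P f -> intg P g -> (forall x, f x <= g x) ->
  \int[P]_x f x <= \int[P]_x g x.
Proof. by move=> iff ig fg; apply: le_Rintegral. Qed.

Lemma Rint_ge0 f : (forall x, 0 <= f x) -> 0 <= \int[P]_x f x.
Proof. by move=> f0; apply: Rintegral_ge0. Qed.

Lemma Rint_norm f : intg P f -> `|\int[P]_x f x| <= \int[P]_x `|f x|.
Proof. by move=> iff; apply: le_normr_Rintegral. Qed.

Lemma Rint_sum (I : Type) (s : seq I) (Q : pred I) (f : I -> T -> R) :
  (forall i, Q i -> intg P (f i)) ->
  \int[P]_x (\sum_(i <- s | Q i) f i x) = \sum_(i <- s | Q i) \int[P]_x f i x.
Proof.
move=> h; elim: s => [|i s ih].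
  rewrite big_nil -[RHS](Rint_cst 0).
  by congr fine; apply: eq_integral => x _; rewrite big_nil.
rewrite big_cons -ih; case: ifPn => Qi.
  rewrite -RintD//; [|exact: h|exact: intg_sum].
  by congr fine; apply: eq_integral => x _; rewrite big_cons Qi.
by congr fine; apply: eq_integral => x _; rewrite big_cons (negbTE Qi).
Qed.

Lemma eq_Rint f g : f =1 g -> \int[P]_x f x = \int[P]_x g x.
Proof. by move=> fg; congr fine; apply: eq_integral => x _; rewrite fg. Qed.

Lemma eq_intg f g : f =1 g -> intg P f -> intg P g.
Proof. by move=> fg; apply: eq_integrable => // x _ /=; rewrite fg. Qed.

Lemma Rint_EFin f : intg P f -> (\int[P]_x f x)%:E = (\int[P]_x (f x)%:E)%E.
Proof. by move=> iff; rewrite /Rintegral fineK// integrable_fin_num. Qed.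

Lemma ge0_intg f (r : R) : measurable_fun setT f -> (forall x, 0 <= f x) ->
  (\int[P]_x (f x)%:E <= r%:E)%E -> intg P f.
Proof.
move=> mf f0 h; apply/integrableP; split; first exact/measurable_EFinP.
under eq_integral do rewrite /= ger0_norm//.
by rewrite (le_lt_trans h)// ltry.
Qed.

End expectation.

Section law.
Context d d' (T : measurableType d) (T' : measurableType d') (R : realType).
Variables (P : probability T R) (m : probability T' R) (W : T -> T').
Hypotheses (mW : measurable_fun setT W)
  (hW : forall A, measurable A -> P (W @^-1` A) = m A).

Lemma law_ge0_integral (f : T' -> \bar R) :
  measurable_fun setT f -> (forall y, 0 <= f y)%E ->
  (\int[P]_x f (W x) = \int[m]_y f y)%E.
Proof.
move=> mf f0.
transitivity (\int[pushforward P W]_y f y)%E.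
  by rewrite ge0_integral_pushforward.
by apply: eq_measure_integral => A mA _; first [exact: hW|exact/esym/hW].
Qed.

Lemma law_intg (f : T' -> R) : intg m f -> intg P (fun x => f (W x)).
Proof.
move=> /integrableP[mf fi]; apply/integrableP; split.
  exact: (measurableT_comp mf).
rewrite [X in (X < _)%E](law_ge0_integral (f := fun y => `|(f y)%:E|%E))//.
by apply: measurableT_comp.
Qed.

Lemma law_Rint (f : T' -> R) : intg m f ->
  \int[P]_x f (W x) = \int[m]_y f y.
Proof.
move=> iff; congr fine.
transitivity (\int[pushforward P W]_y (f y)%:E)%E.
  rewrite integral_pushforward//; first exact: measurable_int iff.
  by rewrite preimage_setT; exact: law_intg.
by apply: eq_measure_integral => A mA _; first [exact: hW|exact/esym/hW].
Qed.

End law.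

Section product.
Context d d' (T : measurableType d) (T' : measurableType d') (R : realType).
Variables (P : probability T R) (Q : probability T' R).
Implicit Types f : T * T' -> R.

Lemma Rint_prod f : intg (P \x Q)%E f -> (forall x, intg Q (fun y => f (x, y))) ->
  \int[(P \x Q)%E]_w f w = \int[P]_x \int[Q]_y f (x, y).
Proof.
move=> iff ix; rewrite /Rintegral -integral12_prod_meas1//.
congr fine; apply: eq_integral => x _; rewrite fineK//.
exact: (integrable_fin_num measurableT (ix x)).
Qed.

Lemma Rint_prod2 f : intg (P \x Q)%E f -> (forall y, intg P (fun x => f (x, y))) ->
  \int[(P \x Q)%E]_w f w = \int[Q]_y \int[P]_x f (x, y).
Proof.
move=> iff ix; rewrite /Rintegral -integral21_prod_meas1//.
congr fine; apply: eq_integral => x _; rewrite fineK//.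
exact: (integrable_fin_num measurableT (ix x)).
Qed.

Lemma intg_inner f : intg (P \x Q)%E f -> (forall x, intg Q (fun y => f (x, y))) ->
  intg P (fun x => \int[Q]_y f (x, y)).
Proof.
move=> iff ix; apply: eq_integrable (integrable_fubini_F iff) => // x _ /=.
by rewrite /Rintegral fineK//; exact: (integrable_fin_num measurableT (ix x)).
Qed.

Lemma law_fst (A : set T) : measurable A -> (P \x Q)%E (fst @^-1` A) = P A.
Proof.
move=> mA; have -> : fst @^-1` A = A `*` [set: T'].
  by apply/seteqP; split => -[x y] /=; tauto.
have h : Q setT = 1%E by exact: probability_setT.
by rewrite product_measure1E// [X in (_ * X)%E]h mule1.
Qed.

Lemma law_snd (A : set T') : measurable A -> (P \x Q)%E (snd @^-1` A) = Q A.
Proof.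
move=> mA; have -> : snd @^-1` A = [set: T] `*` A.
  by apply/seteqP; split => -[x y] /=; tauto.
have h : P setT = 1%E by exact: probability_setT.
by rewrite product_measure1E// [X in (X * _)%E]h mul1e.
Qed.

Lemma intg_fst (f : T -> R) : intg P f -> intg (P \x Q)%E (fun w => f w.1).
Proof. by apply: law_intg => //; exact: law_fst. Qed.

Lemma intg_snd (f : T' -> R) : intg Q f -> intg (P \x Q)%E (fun w => f w.2).
Proof. by apply: law_intg => //; exact: law_snd. Qed.

Lemma Rint_fst (f : T -> R) : intg P f -> \int[(P \x Q)%E]_w f w.1 = \int[P]_x f x.
Proof. by apply: law_Rint => //; exact: law_fst. Qed.

Lemma intg_mul (f : T -> R) (g : T' -> R) : intg P f -> intg Q g ->
  intg (P \x Q)%E (fun w => f w.1 * g w.2).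
Proof.
move=> iff ig.
have mf := intg_measurable iff; have mg := intg_measurable ig.
have mm : measurable_fun setT (fun w : T * T' => (f w.1 * g w.2)%:E).
  apply/measurable_EFinP; apply: measurable_funM.
    exact: measurableT_comp.
  exact: measurableT_comp.
have mg' : measurable_fun setT (fun y => `|(g y)%:E|%E).
  by apply: measurableT_comp => //; exact/measurable_EFinP.
have mf' : measurable_fun setT (fun y => `|(f y)%:E|%E).
  by apply: measurableT_comp => //; exact/measurable_EFinP.
have G x : (\int[Q]_y `|(f x * g y)%:E| = `|(f x)%:E| * \int[Q]_y `|(g y)%:E|)%E.
  rewrite -ge0_integralZl//.
  by apply: eq_integral => y _; rewrite EFinM abseM.
apply/integrable12ltyP => //=.
under eq_integral do rewrite G.
rewrite ge0_integralZr//; last exact: integral_ge0.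
have [_ h1] := integrableP _ _ _ iff; have [_ h2] := integrableP _ _ _ ig.
apply: lte_mul_pinfty => //; first exact: integral_ge0.
by rewrite ge0_fin_numE//; exact: integral_ge0.
Qed.

Lemma Rint_mul (f : T -> R) (g : T' -> R) : intg P f -> intg Q g ->
  \int[(P \x Q)%E]_w (f w.1 * g w.2) = (\int[P]_x f x) * (\int[Q]_y g y).
Proof.
move=> iff ig; rewrite Rint_prod/=; [|exact: intg_mul|by move=> x; exact: intgZ].
rewrite -RintZr//; apply: eq_Rint => x; exact: RintZ.
Qed.

End product.

(** A name for the image measure along an unbundled measurable function, for use where a
    [{measure ...}] is expected. *)
Definition pushm d d' (T : measurableType d) (T' : measurableType d')
    (R : realType) (P : {measure set T -> \bar R}) (f : T -> T')
    (mf : measurable_fun setT f) : {measure set T' -> \bar R} :=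
  measure_function_pushforward__canonical__measure_function_Measure P mf.

(** * Finite i.i.d. products *)

Section iid_product.
Context {R : realType}.

Definition tcons m (p : R * m.-tuple R) : m.+1.-tuple R := [tuple of p.1 :: p.2].

Lemma measurable_tcons m : measurable_fun setT (@tcons m).
Proof. by apply: measurable_cons. Qed.

HB.instance Definition _ m :=
  isMeasurableFun.Build _ _ _ _ (@tcons m) (@measurable_tcons m).

(** The [m]-fold product measure, built on the first coordinate so that integrals against it reduce
    to iterated ones by induction. *)
Fixpoint iprod (mu : probability R R) (m : nat) : probability (m.-tuple R) R :=
  match m with
  | 0 => \d_([tuple])
  | m'.+1 => distribution (mu \x iprod mu m')%E (@tcons m')
  end.

Lemma ge0_integral_iprodS (mu : probability R R) m (f : m.+1.-tuple R -> \bar R) :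
  measurable_fun setT f -> (forall t, 0 <= f t)%E ->
  (\int[iprod mu m.+1]_t f t = \int[mu]_x \int[iprod mu m]_t f (tcons (x, t)))%E.
Proof.
move=> mf f0.
rewrite [LHS](ge0_integral_distribution (P := (mu \x iprod mu m)%E) (@tcons m))//.
rewrite fubini_tonelli1//.
- by apply: (measurableT_comp mf); exact: measurable_tcons.
- by move=> p /=.
Qed.

Lemma iprod_prod (mu : probability R R) m (f : 'I_m -> R -> \bar R) :
  (forall i, measurable_fun setT (f i)) -> (forall i x, 0 <= f i x)%E ->
  (\int[iprod mu m]_t \prod_(i < m) f i (tnth t i) = \prod_(i < m) \int[mu]_x f i x)%E.
Proof.
elim: m f => [|m ih] f mf f0.
  under eq_integral do rewrite big_ord0.
  rewrite integral_cst// big_ord0 mul1e; exact: probability_setT.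
have mff (n : nat) (g : 'I_n -> R -> \bar R) : (forall i, measurable_fun setT (g i)) ->
    measurable_fun setT (fun t : n.-tuple R => \prod_(i < n) g i (tnth t i))%E.
  move=> mg; elim: (index_enum _) => [|i s IH].
    by under eq_fun do rewrite big_nil; exact: measurable_cst.
  under eq_fun do rewrite big_cons.
  apply: emeasurable_funM => //; apply: (measurableT_comp (mg i)).
  exact: measurable_tnth.
have pf0 (n : nat) (g : 'I_n -> R -> \bar R) (t : n.-tuple R) : (forall i x, 0 <= g i x)%E ->
    (0 <= \prod_(i < n) g i (tnth t i))%E by move=> g0; apply: prode_ge0.
rewrite ge0_integral_iprodS; [|exact: mff|by move=> t; exact: pf0].
rewrite big_ord_recl -ih//.
rewrite -ge0_integralZr//; last by apply: integral_ge0 => t _; apply: (pf0 m (fun i => f (lift ord0 i))) => i y; exact: f0.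
apply: eq_integral => x _.
rewrite -ge0_integralZl//; last 2 first.
- exact: (mff m (fun i => f (lift ord0 i))).
- by move=> t _; apply: (pf0 m (fun i => f (lift ord0 i))) => i y; exact: f0.
apply: eq_integral => t _.
rewrite big_ord_recl tnth0; congr (_ * _)%E.
by apply: eq_bigr => i _; rewrite tnthS.
Qed.

Definition box m (B : 'I_m -> set R) : set (m.-tuple R) :=
  [set t | forall i, B i (tnth t i)].

Lemma measurable_box m (B : 'I_m -> set R) :
  (forall i, measurable (B i)) -> measurable (box B).
Proof.
move=> mB; have -> : box B = \bigcap_(i in [set: 'I_m]) ((@tnth m R)^~ i @^-1` B i).
  by apply/seteqP; split => t /= h i; [move=> _; exact: h|exact: h].
apply: fin_bigcap_measurable => // i _.
by rewrite -[X in measurable X]setTI; exact: measurable_tnth.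
Qed.

Lemma tuple_measurableE m :
  @measurable _ (m.-tuple R) =
  <<s [set A | exists2 B : 'I_m -> set R, (forall i, measurable (B i)) & A = box B] >>.
Proof.
apply/seteqP; split; last first.
  apply: smallest_sub; first exact: sigma_algebra_measurable.
  by move=> _ [B mB ->]; exact: measurable_box.
apply: smallest_sub; first exact: smallest_sigma_algebra.
elim/big_ind : _ => //= [A B hA hB x [|]//|i _]; first exact: hA.
  exact: hB.
move=> _ [B mB <-]; apply: sub_sigma_algebra; rewrite setTI /=.
exists (fun j => if j == i then B else setT); first by move=> j; case: ifP.
apply/seteqP; split => t /=.
  by move=> h j; case: eqP => // ->.
by move=> /(_ i); rewrite eqxx.
Qed.

(** Boxes form a generating class that is stable under intersection and contains the whole space, so
    the uniqueness theorem for finite measures applies. *)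
Lemma box_unique m (m1 m2 : {measure set (m.-tuple R) -> \bar R}) :
  (m1 setT < +oo)%E ->
  (forall B : 'I_m -> set R, (forall i, measurable (B i)) -> m1 (box B) = m2 (box B)) ->
  forall A, measurable A -> m1 A = m2 A.
Proof.
move=> m1oo h A mA.
apply: (measure_unique [set A | exists2 B : 'I_m -> set R,
  (forall i, measurable (B i)) & A = box B] (fun=> setT)) => //.
- exact: tuple_measurableE.
- move=> _ _ [B mB ->] [C mC ->]; exists (fun i => B i `&` C i).
    by move=> i; exact: measurableI.
  apply/seteqP; split => [t [h1 h2] i|t hBC].
    by split; [exact: h1|exact: h2].
  by split => i; case: (hBC i).
- by move=> _; exists (fun=> setT) => //; apply/seteqP; split.
- by apply/seteqP; split => // x _; exists 0%N.
- by move=> _ [B mB ->]; exact: h.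
Qed.

Lemma iprod_box (mu : probability R R) m (B : 'I_m -> set R) :
  (forall i, measurable (B i)) -> (iprod mu m (box B) = \prod_(i < m) mu (B i))%E.
Proof.
move=> mB.
transitivity (\int[iprod mu m]_t (\1_(box B) t)%:E)%E.
  by rewrite integral_indic ?setIT//; exact: measurable_box.
transitivity (\int[iprod mu m]_t \prod_(i < m) (\1_(B i) (tnth t i))%:E)%E.
  apply: eq_integral => t _; rewrite prodEFin indicE; congr EFin.
  have [/set_mem h|h] := boolP (t \in box B).
    by rewrite big1// => i _; rewrite indicE mem_set//; exact: h.
  have [i Bi] : exists i, ~ B i (tnth t i).
    by apply/existsNP => hh; move/negP : h; apply; exact/mem_set.
  by rewrite (bigD1 i)//= indicE memNset// mul0r.
rewrite (@iprod_prod mu m (fun i x => (\1_(B i) x)%:E))//.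
- by apply: eq_bigr => i _; rewrite integral_indic// setIT.
- by move=> i; exact/measurable_EFinP.
Qed.

Lemma law_tnth (mu : probability R R) m (i : 'I_m) (A : set R) : measurable A ->
  iprod mu m ((@tnth m R)^~ i @^-1` A) = mu A.
Proof.
move=> mA.
have -> : (@tnth m R)^~ i @^-1` A = box (fun j => if j == i then A else setT).
  apply/seteqP; split => t /=; first by move=> h j; case: eqP => // ->.
  by move=> /(_ i); rewrite eqxx.
rewrite iprod_box; last by move=> j; case: ifP.
rewrite (bigD1 i)//= eqxx big1 ?mule1// => j /negbTE ->.
exact: probability_setT.
Qed.

Lemma law_tnth2 (mu : probability R R) m (i j : 'I_m) (A : set (R * R)) :
  i != j -> measurable A ->
  iprod mu m ((fun t => (tnth t i, tnth t j)) @^-1` A) = (mu \x mu)%E A.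
Proof.
move=> ij mA.
have mf : measurable_fun setT (fun t : m.-tuple R => (tnth t i, tnth t j)).
  by apply: measurable_fun_pair; exact: measurable_tnth.
apply/esym.
apply: (@product_measure_unique _ _ _ _ _ mu mu
  (pushm (iprod mu m) mf)) => // B C mB mC.
rewrite -[LHS]/(iprod mu m ((fun t => (tnth t i, tnth t j)) @^-1` (B `*` C))).
have -> : (fun t : m.-tuple R => (tnth t i, tnth t j)) @^-1` (B `*` C) =
    box (fun k => if k == i then B else if k == j then C else setT).
  apply/seteqP; split => t /=.
    by move=> [h1 h2] k; case: eqP => [->//|_]; case: eqP => [->//|_].
  move=> h; split; first by have := h i; rewrite eqxx.
  by have := h j; rewrite eqxx eq_sym (negbTE ij).
rewrite iprod_box; last by move=> k; case: ifP => // _; case: ifP.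
rewrite (bigD1 i)//= eqxx (bigD1 j)/=; last by rewrite eq_sym.
rewrite eqxx eq_sym (negbTE ij) big1 ?mule1// => k /andP[/negbTE -> /negbTE ->].
exact: probability_setT.
Qed.

Section independent_law.
Context d (Om : measurableType d) (P : probability Om R).

Lemma law_iprod (mu : probability R R) m (W : Om -> m.-tuple R) :
  measurable_fun setT W ->
  (forall B : 'I_m -> set R, (forall i, measurable (B i)) ->
    P (W @^-1` box B) = \prod_(i < m) mu (B i))%E ->
  forall A, measurable A -> P (W @^-1` A) = iprod mu m A.
Proof.
move=> mW h A mA.
apply: (@box_unique m (pushm P mW) (iprod mu m)) => //.
  by rewrite /pushm/= /pushforward preimage_setT -ge0_fin_numE// fin_num_measure.
move=> B mB; rewrite -[LHS]/(P (W @^-1` box B)) h//.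
exact/esym/iprod_box.
Qed.

(** Measurable rectangles suffice, and their two sides are extended from boxes in turn: with one
    side held fixed, both expressions are finite measures in the other. *)
Lemma law_iprod2 (mu nu : probability R R) n m
    (U : Om -> n.-tuple R) (V : Om -> m.-tuple R) :
  measurable_fun setT U -> measurable_fun setT V ->
  (forall (B : 'I_n -> set R) (C : 'I_m -> set R),
    (forall i, measurable (B i)) -> (forall i, measurable (C i)) ->
    P (U @^-1` box B `&` V @^-1` box C) =
      (\prod_(i < n) mu (B i)) * (\prod_(i < m) nu (C i)))%E ->
  forall A, measurable A ->
    P ((fun w => (U w, V w)) @^-1` A) = (iprod mu n \x iprod nu m)%E A.
Proof.
move=> mU mV h A mA.
have mf : measurable_fun setT (fun w => (U w, V w)) by exact: measurable_fun_pair.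
have mpre k (W : Om -> k.-tuple R) B : measurable_fun setT W -> measurable B ->
    measurable (W @^-1` B).
  by move=> mW mB; rewrite -[X in measurable X]setTI; exact: mW.
have Plt (B : set Om) : measurable B -> (P B < +oo)%E.
  by move=> mB; rewrite -ge0_fin_numE// fin_num_measure.
apply/esym.
apply: (@product_measure_unique _ _ _ _ _ (iprod mu n) (iprod nu m)
  (pushm P mf)) => // B C mB mC.
rewrite /pushm/pushforward/= -[LHS]/(P (U @^-1` B `&` V @^-1` C)).
have step (C' : 'I_m -> set R) : (forall i, measurable (C' i)) ->
    (P (U @^-1` B `&` V @^-1` box C') = iprod mu n B * iprod nu m (box C'))%E.
  move=> mC'.
  have mVC := mpre _ _ _ mV (measurable_box mC').
  have c0 : 0 <= fine (iprod nu m (box C')) by exact: fine_ge0.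
  have E : (fine (iprod nu m (box C')))%:E = iprod nu m (box C').
    by rewrite fineK// fin_num_measure//; exact: measurable_box.
  have E1 := @box_unique n (pushm (mrestr P mVC) mU)
    (mscale (NngNum c0) (iprod mu n)).
  rewrite -[LHS]/(pushm (mrestr P mVC) mU B) E1//.
  - by rewrite -[LHS]/((fine (iprod nu m (box C')))%:E * iprod mu n B)%E E muleC.
  - rewrite -[X in (X < _)%E]/(P (U @^-1` setT `&` V @^-1` box C')).
    by apply: Plt; apply: measurableI => //; exact: mpre.
  - move=> B' mB'.
    rewrite -[LHS]/(P (U @^-1` box B' `&` V @^-1` box C')).
    rewrite -[RHS]/((fine (iprod nu m (box C')))%:E * iprod mu n (box B'))%E.
    by rewrite E h// muleC; congr (_ * _)%E; exact/esym/iprod_box.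
have mUB := mpre _ _ _ mU mB.
have c0 : 0 <= fine (iprod mu n B) by exact: fine_ge0.
have E : (fine (iprod mu n B))%:E = iprod mu n B by rewrite fineK// fin_num_measure.
have E1 := @box_unique m (pushm (mrestr P mUB) mV)
    (mscale (NngNum c0) (iprod nu m)).
rewrite setIC -[LHS]/(pushm (mrestr P mUB) mV C) E1//.
- by rewrite -[LHS]/((fine (iprod mu n B))%:E * iprod nu m C)%E E.
- rewrite -[X in (X < _)%E]/(P (V @^-1` setT `&` U @^-1` B)).
  by apply: Plt; apply: measurableI => //; exact: mpre.
- move=> C' mC'.
  rewrite -[LHS]/(P (V @^-1` box C' `&` U @^-1` B)).
  rewrite -[RHS]/((fine (iprod mu n B))%:E * iprod nu m (box C'))%E.
  by rewrite E setIC step.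
Qed.

End independent_law.

End iid_product.

Section standard_normal_law.
Context {R : realType}.

Definition borel_id (x : measurableTypeR R) : R := x.

Lemma measurable_borel_id : measurable_fun setT borel_id.
Proof. by move=> _ A mA; rewrite setTI. Qed.

HB.instance Definition _ :=
  isMeasurableFun.Build _ _ _ _ borel_id measurable_borel_id.

(* [normal_prob] lives on [measurableTypeR R], whose display differs from that
   of the canonical measurable structure of [R]. *)
Definition stdn : probability R R := distribution (normal_prob (0 : R) 1) borel_id.

Lemma ge0_integral_stdn (f : R -> \bar R) :
  measurable_fun setT f -> (forall x, 0 <= f x)%E ->
  (\int[stdn]_x f x = \int[normal_prob (0 : R) 1]_x f x)%E.
Proof. by move=> mf f0; rewrite ge0_integral_distribution. Qed.

Lemma ge0_integral_stdn_shift (c : R) (f : R -> \bar R) :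
  measurable_fun setT f -> (forall x, 0 <= f x)%E ->
  (\int[stdn]_x f (x + c)%R =
   \int[stdn]_x (f x * (expR (c * x - c ^+ 2 / 2))%:E))%E.
Proof.
move=> mf f0; rewrite !ge0_integral_stdn//.
- exact: ge0_integral_normal_shift.
- apply: emeasurable_funM => //; apply/measurable_EFinP.
  by apply: measurableT_comp => //; exact: measurable_affine.
- by move=> x; rewrite mule_ge0// lee_fin expR_ge0.
- by apply: (measurableT_comp mf); exact: measurable_funD.
Qed.

Lemma ge0_integral_stdn_rotation (a b : R) (f : R -> \bar R) :
  0 < a -> a ^+ 2 + b ^+ 2 = 1 ->
  measurable_fun setT f -> (forall x, 0 <= f x)%E ->
  (\int[stdn]_y \int[stdn]_x f (a * x + b * y)%R = \int[stdn]_x f x)%E.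
Proof.
move=> a0 ab1 mf f0.
have m2 : measurable_fun setT (fun p : R * R => f (a * p.2 + b * p.1)).
  apply: (measurableT_comp mf); apply: measurable_funD; exact: measurable_funM.
rewrite [LHS]ge0_integral_stdn; last 2 first.
- by refine (@measurable_fun_fubini_tonelli_F _ _ _ _ _ stdn _ m2 _) => p.
- by move=> y; exact: integral_ge0.
rewrite [RHS]ge0_integral_stdn// -[RHS](ge0_integral_normal_rotation a0 ab1 mf f0).
apply: eq_integral => y _; rewrite ge0_integral_stdn//.
exact: (measurableT_comp m2 (pair1_measurable y)).
Qed.

End standard_normal_law.
Arguments stdn R : clear implicits.

Section gaussian_tuple.
Context {R : realType}.
Local Notation gam m := (iprod (stdn R) m).

Definition tshift m (c : 'I_m -> R) (y : m.-tuple R) : m.-tuple R :=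
  [tuple tnth y i + c i | i < m].

Lemma measurable_tshift m (c : 'I_m -> R) : measurable_fun setT (tshift c).
Proof.
apply/measurable_fun_tnthP => i.
rewrite (_ : _ \o _ = fun y => tnth y i + c i); last first.
  by apply/funext => y /=; rewrite tnth_mktuple.
by apply: measurable_funD => //; exact: measurable_tnth.
Qed.

Lemma tshift_tcons m (c : 'I_m.+1 -> R) (x : R) (t : m.-tuple R) :
  tshift c (tcons (x, t)) = tcons (x + c ord0, tshift (fun i => c (lift ord0 i)) t).
Proof.
apply: eq_from_tnth => i; rewrite tnth_mktuple.
have [j ->|->] := unliftP ord0 i; first by rewrite !tnthS tnth_mktuple.
by rewrite !tnth0.
Qed.

(** The one-dimensional shift, one coordinate at a time. The weight is the likelihood ratio of noise
    translated by [c] against pure noise, the source of [wt]. *)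
Lemma ge0_integral_gaussian_shift m (c : 'I_m -> R) (f : m.-tuple R -> \bar R) :
  measurable_fun setT f -> (forall t, 0 <= f t)%E ->
  (\int[gam m]_y f (tshift c y) =
   \int[gam m]_y (f y * (expR (\sum_(k < m) (c k * tnth y k - c k ^+ 2 / 2)))%:E))%E.
Proof.
elim: m c f => [|m ih] c f mf f0.
  apply: eq_integral => t _; rewrite big_ord0 expR0 mule1; congr f.
  by rewrite [LHS]tuple0 [RHS]tuple0.
have me k (b : 'I_k -> R) :
    measurable_fun setT (fun t : k.-tuple R =>
      (expR (\sum_(i < k) (b i * tnth t i - b i ^+ 2 / 2)))%:E).
  apply/measurable_EFinP; apply: measurableT_comp => //.
  apply: measurable_sum => i; apply: measurable_funB => //.
  by apply: measurable_funM => //; exact: measurable_tnth.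
have mtc : measurable_fun setT (fun p : R * m.-tuple R => f (tcons p)).
  by apply: (measurableT_comp mf); exact: measurable_tcons.
pose b := fun i => c (lift ord0 i).
have msf : measurable_fun setT (fun t => f (tshift c t)).
  by apply: (measurableT_comp mf); exact: measurable_tshift.
rewrite ge0_integral_iprodS; last 2 first.
- exact: msf.
- by move=> t; exact: f0.
rewrite [RHS]ge0_integral_iprodS; last 2 first.
- by apply: emeasurable_funM => //; exact: me.
- by move=> t; rewrite mule_ge0// lee_fin expR_ge0.
under eq_integral => x _.
  under eq_integral do rewrite tshift_tcons.
  rewrite (ih b (fun t => f (tcons (x + c ord0, t))))//; last first.
    exact: (measurableT_comp mtc (pair1_measurable _)).
  over.
pose G := fun x : R => (\int[gam m]_t (f (tcons (x, t)) *
  (expR (\sum_(i < m) (b i * tnth t i - b i ^+ 2 / 2)))%:E))%E.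
have mfe : measurable_fun setT (fun p : R * m.-tuple R => (f (tcons p) *
    (expR (\sum_(i < m) (b i * tnth p.2 i - b i ^+ 2 / 2)))%:E)%E).
  by apply: emeasurable_funM => //; exact: (measurableT_comp (me m b)).
rewrite [LHS](@ge0_integral_stdn_shift _ (c ord0) G); last 2 first.
- refine (@measurable_fun_fubini_tonelli_F _ _ _ _ _ (gam m) _ mfe _).
  by move=> p; rewrite mule_ge0// lee_fin expR_ge0.
- by move=> x; apply: integral_ge0 => t _; rewrite mule_ge0// lee_fin expR_ge0.
apply: eq_integral => x _; rewrite /G -ge0_integralZr//; last 2 first.
- have := measurableT_comp mfe (pair1_measurable x).
  by apply: eq_measurable_fun => t _.
- by move=> t _; rewrite mule_ge0// lee_fin expR_ge0.
apply: eq_integral => t _; rewrite -muleA -EFinM -expRD; congr (_ * (expR _)%:E)%E.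
rewrite big_ord_recl tnth0 addrC; congr (_ + _).
by apply: eq_bigr => i _; rewrite tnthS.
Qed.

End gaussian_tuple.

(** * The Gaussian channel *)

Section elementary.
Context {R : realType}.

Lemma ln_diff_le (a b : R) : 0 < a -> 0 < b -> ln a - ln b <= a / b - 1.
Proof.
move=> a0 b0; rewrite -ln_div ?posrE//.
have h : -1 < a / b - 1 by rewrite ltrBrDr addrC subrr divr_gt0.
by have := le_ln1Dx h; rewrite addrCA subrr addr0.
Qed.

(** Reduces second moments of the Gaussian to its exponential moments. *)
Lemma sqr_le_expR (x : R) : x ^+ 2 <= 2 * (expR x + expR (- x)).
Proof.
wlog x0 : x / 0 <= x.
  move=> h; have [|/ltW x0] := leP 0 x; first exact: h.
  by have := h (- x); rewrite oppr_ge0 sqrrN opprK [_ + expR x]addrC; apply.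
have := expR_ge1Dxn 1 x0; rewrite (_ : 2`! = 2)%N// => h.
have := expR_gt0 (- x); lra.
Qed.

Lemma mul_le_sqr (a b : R) : `|a * b| <= a ^+ 2 + b ^+ 2.
Proof.
rewrite ler_norml; apply/andP; split; nra.
Qed.

(** The shift formula for the constant function 1 says that the likelihood ratio integrates to 1,
    which is the Laplace transform of the Gaussian. *)
Lemma intg_stdn_expR (c : R) : intg (stdn R) (fun x => expR (c * x)).
Proof.
have me (k : R) : measurable_fun setT (fun x : R => expR (c * x - k)).
  apply: measurableT_comp => //; exact: measurable_affine.
apply: (@ge0_intg _ _ _ _ _ (expR (c ^+ 2 / 2))).
- by apply: eq_measurable_fun (me 0) => x _; rewrite subr0.
- by move=> x; exact: expR_ge0.
have := @ge0_integral_stdn_shift R c (cst 1%E) (measurable_cst _) (fun=> lee01).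
rewrite integral_cst//.
under [X in _ = X -> _]eq_integral do rewrite mul1e.
rewrite mul1e [X in X = _ -> _](_ : _ = 1%E); last exact: probability_setT.
move=> h.
rewrite (_ : (fun x : R => _) =
  (fun x : R => (expR (c ^+ 2 / 2))%:E * (expR (c * x - c ^+ 2 / 2))%:E)%E); last first.
  by apply/funext => x; rewrite -EFinM -expRD; congr (expR _)%:E; lra.
rewrite ge0_integralZl//; first by rewrite -h mule1.
by apply/measurable_EFinP; exact: me.
Qed.

Lemma intg_stdn_expR_norm (c : R) : intg (stdn R) (fun x => expR (c * `|x|)).
Proof.
apply: (@intg_dom _ _ _ _ _ (fun x => expR (c * x) + expR (- c * x))).
- by apply: measurableT_comp => //; apply: measurable_funM => //; exact: measurableT_comp.
- apply: intgD; exact: intg_stdn_expR.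
- move=> x; rewrite ger0_norm ?expR_ge0//.
  have [x0|x0] := ger0P x; first by rewrite lerDl expR_ge0.
  by rewrite mulrN -mulNr lerDr expR_ge0.
Qed.

Lemma intg_stdn_sqr : intg (stdn R) (fun x => x ^+ 2).
Proof.
apply: (@intg_dom _ _ _ _ _ (fun x : R => 2 * (expR (1 * x) + expR (- 1 * x)))).
- exact: measurable_funX.
- by apply: intgZ; apply: intgD; exact: intg_stdn_expR.
- by move=> x; rewrite ger0_norm ?sqr_ge0// mul1r mulN1r sqr_le_expR.
Qed.

End elementary.

Section channel.
Context {R : realType} d (S : measurableType d) (mu : probability S R) (m : nat).
Local Notation gam := (iprod (stdn R) m).
Local Notation Y := (m.-tuple R).
Local Notation Q := (mu \x gam)%E.
Implicit Types (U V : 'I_m -> S -> R) (h : S -> R).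

(** Likelihood ratio at [y] of the channel with signal [U s] against pure noise. Its mean [dens] is
    the density of the law of the observation with respect to [gam], [avg] is the posterior mean by
    Bayes' formula, and [info] is the relative entropy of the law of the observation to pure
    noise. *)
Definition wt U (s : S) (y : Y) : R :=
  expR (\sum_(k < m) (U k s * tnth y k - U k s ^+ 2 / 2)).

Definition dens U (y : Y) : R := \int[mu]_s wt U s y.

Definition avg U h (y : Y) : R := (\int[mu]_s (h s * wt U s y)) / dens U y.

Definition obs U (w : S * Y) : Y := tshift (fun k => U k w.1) w.2.

Definition info U : R := \int[Q]_w ln (dens U (obs U w)).

Definition ybound (y : Y) : R := \sum_(k < m) (tnth y k) ^+ 2.

Definition sqint U := forall k, measurable_fun setT (U k) /\
  intg mu (fun s => U k s ^+ 2).

Lemma measurable_ybound : measurable_fun setT ybound.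
Proof.
by apply: measurable_sum => k; apply: measurable_funX; exact: measurable_tnth.
Qed.

Section one_channel.
Variable U : 'I_m -> S -> R.
Hypothesis mU : forall k, measurable_fun setT (U k).

Lemma measurable_wt : measurable_fun setT (fun w : S * Y => wt U w.1 w.2).
Proof.
apply: measurableT_comp => //; apply: measurable_sum => k.
apply: measurable_funB.
  apply: measurable_funM; first exact: (measurableT_comp (mU k)).
  exact: (measurableT_comp (measurable_tnth k)).
apply: measurable_funM => //; apply: measurable_funX.
exact: (measurableT_comp (mU k)).
Qed.

Lemma measurable_wt1 y : measurable_fun setT (fun s => wt U s y).
Proof. exact: (measurableT_comp measurable_wt (pair2_measurable y)). Qed.

Lemma wt_gt0 s y : 0 < wt U s y. Proof. exact: expR_gt0. Qed.
Lemma wt_ge0 s y : 0 <= wt U s y. Proof. exact: expR_ge0. Qed.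

(** Completing the square gives a bound uniform in the signal, hence integrability of the weight for
    every prior. *)
Lemma wt_le s y : wt U s y <= expR (ybound y / 2).
Proof.
rewrite ler_expR /ybound mulr_suml; apply: ler_sum => k _.
have := sqr_ge0 (U k s - tnth y k); nra.
Qed.

Lemma measurable_obs : measurable_fun setT (obs U).
Proof.
apply/measurable_fun_tnthP => i.
rewrite (_ : _ \o _ = fun w => tnth w.2 i + U i w.1); last first.
  by apply/funext => w /=; rewrite tnth_mktuple.
apply: measurable_funD; last exact: measurableT_comp.
by apply: (measurableT_comp (measurable_tnth i)).
Qed.

Lemma measurable_obs_pair : measurable_fun setT (fun w => (w.1, obs U w)).
Proof. by apply: measurable_fun_pair => //; exact: measurable_obs. Qed.

Lemma intg_wt y : intg mu (fun s => wt U s y).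
Proof.
apply: (@intg_bnd _ _ _ _ _ (expR (ybound y / 2))); first exact: measurable_wt1.
by move=> s; rewrite ger0_norm ?wt_ge0 ?wt_le.
Qed.

Lemma intg_mul_wt h y : intg mu h -> intg mu (fun s => h s * wt U s y).
Proof.
move=> ih; apply: (@intg_dom _ _ _ _ _ (fun s => `|h s| * expR (ybound y / 2))).
- apply: measurable_funM; [exact: (intg_measurable ih)|exact: measurable_wt1].
- exact/intgZr/intg_norm.
- by move=> s; rewrite normrM ler_wpM2l// ger0_norm ?wt_ge0 ?wt_le.
Qed.

(** Jensen's inequality for the probability with density proportional to [p]: the tangent line of
    [expR] at the mean [b] is integrated. *)
Lemma expR_mean_le (p X : S -> R) : (forall s, 0 <= p s) ->
  intg mu p -> intg mu (fun s => X s * p s) -> intg mu (fun s => expR (X s) * p s) ->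
  0 < \int[mu]_s p s ->
  (\int[mu]_s p s) * expR ((\int[mu]_s (X s * p s)) / \int[mu]_s p s)
    <= \int[mu]_s (expR (X s) * p s).
Proof.
move=> p0 ip iX ie; set D := \int[mu]_s p s; set b := _ / D => D0.
rewrite (_ : D * expR b = \int[mu]_s (expR b * (X s * p s) + expR b * (1 - b) * p s)).
  apply: Rint_le => //; first by apply: intgD; exact: intgZ.
  move=> s; rewrite mulrA -mulrDl ler_wpM2r//.
  rewrite -mulrDr -(subrK b (X s)) [in leRHS]expRD mulrC ler_wpM2r ?expR_ge0//.
  by have := expR_ge1Dx (X s - b); lra.
rewrite RintD ?RintZ//; try exact: intgZ.
rewrite -/D [\int[mu]_s (X s * p s)](_ : _ = b * D); last by rewrite /b divfK// gt_eqF.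
ring.
Qed.

Lemma dens_ge0 y : 0 <= dens U y.
Proof. by apply: Rint_ge0 => s; exact: wt_ge0. Qed.

Lemma dens_le y : dens U y <= expR (ybound y / 2).
Proof.
rewrite -(Rint_cst mu (expR (ybound y / 2))); apply: Rint_le.
- exact: intg_wt.
- exact: intg_cst.
- by move=> s; exact: wt_le.
Qed.

Lemma dens_EFin y : (dens U y)%:E = (\int[mu]_s (wt U s y)%:E)%E.
Proof. by rewrite Rint_EFin//; exact: intg_wt. Qed.

Lemma dens_gt0 y : 0 < dens U y.
Proof.
rewrite -lte_fin dens_EFin.
rewrite lt_neqAle integral_ge0 ?andbT; last by move=> s _; rewrite lee_fin wt_ge0.
apply/eqP => h0.
have mw : measurable_fun setT (fun s => (wt U s y)%:E).
  by apply/measurable_EFinP; exact: measurable_wt1.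
have [h1 _] := @ae_eq_integral_abs _ _ _ mu setT measurableT _ mw.
have e0 : (\int[mu]_s `|(wt U s y)%:E| = 0)%E.
  rewrite [RHS]h0; apply: eq_integral => s _.
  by rewrite gee0_abs// lee_fin wt_ge0.
have [N [mN N0 sN]] := h1 e0.
have : mu setT = 0%E.
  apply/eqP; rewrite -measure_le0 -N0; apply: le_measure; rewrite ?inE//.
  move=> s _; apply: sN => /= h; have := h Logic.I.
  by move=> -[] /eqP; rewrite gt_eqF// wt_gt0.
by rewrite (_ : mu setT = 1%E); [move=> /eqP; rewrite onee_eq0|exact: probability_setT].
Qed.

Lemma measurable_Rint2 (f : S * Y -> R) : measurable_fun setT f ->
  (forall w, 0 <= f w) -> measurable_fun setT (fun y => \int[mu]_s f (s, y)).
Proof.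
move=> mf f0; apply: measurableT_comp => //.
apply: (@measurable_fun_fubini_tonelli_G _ _ _ _ _ mu (fun w => (f w)%:E)).
- exact/measurable_EFinP.
- by move=> w; rewrite lee_fin.
Qed.

Lemma measurable_dens : measurable_fun setT (dens U).
Proof.
apply: (measurable_Rint2 (f := fun w => wt U w.1 w.2)).
- exact: measurable_wt.
- by move=> w; exact: wt_ge0.
Qed.

Lemma measurable_ln_dens : measurable_fun setT (fun y => ln (dens U y)).
Proof.
by apply: measurableT_comp; [exact: measurable_ln|exact: measurable_dens].
Qed.

Lemma measurable_avg h : intg mu h -> measurable_fun setT (avg U h).
Proof.
move=> ih; have mh := intg_measurable ih.
(* Tonelli applies to nonnegative integrands, so the positive and negative parts of [h] are treated
   apart. *)
have mpm (b : bool) : measurable_fun setT (fun y => \int[mu]_s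
    ((if b then (Num.max (h s) 0) else Num.max (- h s) 0) * wt U s y)).
  apply: (measurable_Rint2 (f := fun w =>
    (if b then (Num.max (h w.1) 0) else Num.max (- h w.1) 0) * wt U w.1 w.2)).
    apply: measurable_funM; last exact: measurable_wt.
    case: b; apply: measurable_maxr => //; first exact: measurableT_comp.
    by apply: measurableT_comp => //; exact: measurableT_comp.
  by move=> w; case: b; rewrite mulr_ge0 ?wt_ge0// le_max lexx orbT.
apply: measurable_funM; last first.
  rewrite (_ : (fun y => _) = fun y => expR (- ln (dens U y))).
    apply: measurableT_comp => //; apply: measurableT_comp => //.
    exact: measurable_ln_dens.
  by apply/funext => y; rewrite expRN lnK// posrE dens_gt0.
rewrite (_ : (fun y => _) = fun y => \int[mu]_s (Num.max (h s) 0 * wt U s y) -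
    \int[mu]_s (Num.max (- h s) 0 * wt U s y)).
  by apply: measurable_funB; [exact: (mpm true)|exact: (mpm false)].
apply/funext => y; rewrite -RintB; last 2 first.
- apply: intg_mul_wt; apply: (intg_dom _ (intg_norm ih)).
    exact: measurable_maxr.
  by move=> s; rewrite ger0_norm ?le_max ?lexx ?orbT// ge_max ler_norm normr_ge0.
- apply: intg_mul_wt; apply: (intg_dom _ (intg_norm ih)).
    by apply: measurable_maxr => //; exact: measurableT_comp.
  move=> s; rewrite ger0_norm ?le_max ?lexx ?orbT// ge_max normr_ge0 andbT.
  by rewrite -normrN ler_norm.
apply: eq_Rint => s; rewrite -mulrBl; congr (_ * _).
case/orP: (le_total 0 (h s)) => hs.
  by rewrite (max_l hs) max_r ?oppr_le0// subr0.
by rewrite (max_r hs) max_l ?oppr_ge0// sub0r opprK.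
Qed.

End one_channel.
End channel.

Section channel_inequalities.
Context {R : realType} d (S : measurableType d) (mu : probability S R) (m : nat).
Local Notation gam := (iprod (stdn R) m).
Local Notation Y := (m.-tuple R).
Local Notation Q := (mu \x gam)%E.
Implicit Types (U V : 'I_m -> S -> R) (h : S -> R).

Section one_channel.
Variable U : 'I_m -> S -> R.
Hypothesis mU : forall k, measurable_fun setT (U k).

Let mw := measurable_wt mU.

(** Change of measure: for a fixed signal the observation is shifted noise, and the Gaussian shift
    formula trades it for pure noise weighted by [wt]. *)
Lemma ge0_integral_obs_pair (f : S * Y -> \bar R) :
  measurable_fun setT f -> (forall w, 0 <= f w)%E ->
  (\int[Q]_w f (w.1, obs U w) = \int[Q]_w (f w * (wt U w.1 w.2)%:E))%E.
Proof.
move=> mf f0.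
rewrite (@fubini_tonelli1 _ _ _ _ _ mu gam (fun w => f (w.1, obs U w)))//; last first.
  exact: (measurableT_comp mf (measurable_obs_pair mU)).
rewrite [RHS]fubini_tonelli1; last 2 first.
- by apply: emeasurable_funM => //; exact/measurable_EFinP.
- by move=> w; rewrite mule_ge0// lee_fin wt_ge0.
apply: eq_integral => s _.
rewrite /fubini_F/= /obs/=.
rewrite (@ge0_integral_gaussian_shift _ _ _ (fun y => f (s, y)))//.
exact: (measurableT_comp mf (pair1_measurable s)).
Qed.

Lemma integral_obs_pair (f : S * Y -> R) : measurable_fun setT f ->
  (\int[Q]_w (f (w.1, obs U w))%:E = \int[Q]_w (f w * wt U w.1 w.2)%:E)%E.
Proof.
move=> mf; have mfE : measurable_fun setT (EFin \o f) by exact/measurable_EFinP.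
rewrite integralE [RHS]integralE; congr (_ - _)%E.
- transitivity (\int[Q]_w ((EFin \o f)^\+ (w.1, obs U w)))%E.
    by apply: eq_integral => w _; rewrite !funeposE.
  rewrite ge0_integral_obs_pair//; last exact: measurable_funepos.
  apply: eq_integral => w _; rewrite !funeposE/= -!EFin_max -EFinM; congr EFin.
  by rewrite maxr_pMl ?wt_ge0// mul0r.
- transitivity (\int[Q]_w ((EFin \o f)^\- (w.1, obs U w)))%E.
    by apply: eq_integral => w _; rewrite !funenegE.
  rewrite ge0_integral_obs_pair//; last exact: measurable_funeneg.
  apply: eq_integral => w _; rewrite !funenegE/= -!EFin_max -EFinM; congr EFin.
  by rewrite maxr_pMl ?wt_ge0// mul0r mulNr.
Qed.

Lemma intg_obs_pair (f : S * Y -> R) : measurable_fun setT f ->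
  intg Q (fun w => f (w.1, obs U w)) <-> intg Q (fun w => f w * wt U w.1 w.2).
Proof.
move=> mf.
have e : (\int[Q]_w `|(f (w.1, obs U w))%:E| = \int[Q]_w `|(f w * wt U w.1 w.2)%:E|)%E.
  rewrite (@ge0_integral_obs_pair (fun w => `|(f w)%:E|%E))//; last first.
    by apply: measurableT_comp => //; exact/measurable_EFinP.
  apply: eq_integral => w _; rewrite -EFinM /= normrM; congr (_ * _)%:E.
  by rewrite ger0_norm ?wt_ge0.
split=> /integrableP[_ h]; apply/integrableP; split.
- by apply/measurable_EFinP; exact: measurable_funM.
- by rewrite -e.
- apply/measurable_EFinP; exact: (measurableT_comp mf (measurable_obs_pair mU)).
- by rewrite [X in (X < _)%E]e.
Qed.

Lemma Rint_obs_pair (f : S * Y -> R) : measurable_fun setT f ->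
  \int[Q]_w f (w.1, obs U w) = \int[Q]_w (f w * wt U w.1 w.2).
Proof. by move=> mf; rewrite /Rintegral integral_obs_pair. Qed.

Lemma ge0_integral_obs (k : Y -> \bar R) :
  measurable_fun setT k -> (forall y, 0 <= k y)%E ->
  (\int[Q]_w k (obs U w) = \int[gam]_y (k y * (dens mu U y)%:E))%E.
Proof.
move=> mk k0.
rewrite (@ge0_integral_obs_pair (fun w => k w.2))//; last exact: measurableT_comp.
rewrite fubini_tonelli2//; last 2 first.
- apply: emeasurable_funM; first exact: measurableT_comp.
  exact/measurable_EFinP.
- by move=> w; rewrite mule_ge0// lee_fin wt_ge0.
apply: eq_integral => y _; rewrite /fubini_G/= dens_EFin//.
rewrite -ge0_integralZl//.
- by apply/measurable_EFinP; exact: measurable_wt1.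
- by move=> s _; rewrite lee_fin wt_ge0.
Qed.

Lemma avg_dens h y : avg mu U h y * dens mu U y = \int[mu]_s (h s * wt U s y).
Proof. by rewrite /avg divfK// gt_eqF// dens_gt0. Qed.

Lemma avg_ge0 h y : (forall s, 0 <= h s) -> 0 <= avg mu U h y.
Proof.
move=> h0; rewrite /avg divr_ge0 ?dens_ge0//.
by apply: Rint_ge0 => s; rewrite mulr_ge0 ?wt_ge0.
Qed.

(** The tower property of conditional expectation: the density of the observation cancels the
    denominator of [avg]. *)
Lemma ge0_intg_avg_obs h : (forall s, 0 <= h s) -> intg mu h ->
  intg Q (fun w => avg mu U h (obs U w)) /\
  \int[Q]_w avg mu U h (obs U w) = \int[mu]_s h s.
Proof.
move=> h0 ih; have mh := intg_measurable ih.
have mav := measurable_avg mU ih.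
have av0 y := @avg_ge0 h y h0.
have e : (\int[Q]_w (avg mu U h (obs U w))%:E = \int[mu]_s (h s)%:E)%E.
  rewrite (@ge0_integral_obs (fun y => (avg mu U h y)%:E)); last 2 first.
  - exact/measurable_EFinP.
  - by move=> y; rewrite lee_fin.
  transitivity (\int[gam]_y \int[mu]_s (h s * wt U s y)%:E)%E.
    apply: eq_integral => y _; rewrite -EFinM avg_dens// Rint_EFin//.
    exact: intg_mul_wt.
  have mm : measurable_fun setT (fun w : S * Y => (h w.1 * wt U w.1 w.2)%:E).
    apply/measurable_EFinP; apply: measurable_funM => //; exact: measurableT_comp.
  rewrite -(@fubini_tonelli2 _ _ _ _ _ mu gam (fun w => (h w.1 * wt U w.1 w.2)%:E))//; last first.
    by move=> w; rewrite lee_fin mulr_ge0 ?wt_ge0.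
  transitivity (\int[Q]_w ((h w.1)%:E * (wt U w.1 w.2)%:E))%E.
    by apply: eq_integral => w _; rewrite EFinM.
  rewrite -(@ge0_integral_obs_pair (fun w => (h w.1)%:E))/=.
  - apply: (@law_ge0_integral _ _ _ _ _ Q mu fst measurable_fst (law_fst mu gam)
      (fun s => (h s)%:E)); first exact/measurable_EFinP.
    by move=> s; rewrite lee_fin.
  - by apply/measurable_EFinP; exact: measurableT_comp.
  - by move=> w; rewrite lee_fin.
split; last by rewrite /Rintegral e.
apply: (@ge0_intg _ _ _ _ _ (\int[mu]_s h s)).
- exact: (measurableT_comp mav (measurable_obs mU)).
- by move=> w; exact: avg_ge0.
- by rewrite e -Rint_EFin.
Qed.

(** Nonnegativity of the posterior variance of [h]. *)
Lemma avg_sqr_le h y : intg mu h -> intg mu (fun s => h s ^+ 2) ->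
  avg mu U h y ^+ 2 <= avg mu U (fun s => h s ^+ 2) y.
Proof.
move=> ih ih2; set a := avg mu U h y.
have D0 := @dens_gt0 _ _ _ mu _ _ mU y.
rewrite -(ler_pM2r D0) avg_dens.
have : 0 <= \int[mu]_s ((h s - a) ^+ 2 * wt U s y).
  by apply: Rint_ge0 => s; rewrite mulr_ge0 ?sqr_ge0 ?wt_ge0.
have -> : \int[mu]_s ((h s - a) ^+ 2 * wt U s y) =
    \int[mu]_s (h s ^+ 2 * wt U s y + (- 2 * a * (h s * wt U s y) + a ^+ 2 * wt U s y)).
  by apply: eq_Rint => s; ring.
have i1 := intg_mul_wt mU y ih; have i2 := intg_mul_wt mU y ih2.
have i3 := intg_wt mu mU y.
rewrite RintD//; last by apply: intgD; exact: intgZ.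
rewrite RintD; [|exact: intgZ|exact: intgZ].
rewrite !RintZ// -(avg_dens h) -/a -/(dens mu U y) => hh.
rewrite -subr_ge0; move: hh; congr (0 <= _); ring.
Qed.

Lemma intg_sqr_intg h : measurable_fun setT h -> intg mu (fun s => h s ^+ 2) -> intg mu h.
Proof.
move=> mh ih; apply: (@intg_dom _ _ _ _ _ (fun s => 1 + h s ^+ 2)) => //.
  by apply: intgD => //; exact: intg_cst.
by move=> s; rewrite ler_norml; apply/andP; split; nra.
Qed.

Lemma intg_avg_sqr_obs h : measurable_fun setT h -> intg mu (fun s => h s ^+ 2) ->
  intg Q (fun w => avg mu U h (obs U w) ^+ 2).
Proof.
move=> mh ih2; have ih := intg_sqr_intg mh ih2.
have [i _] := ge0_intg_avg_obs (fun s => sqr_ge0 (h s)) ih2.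
apply: (intg_dom _ i).
  apply: measurable_funX.
  exact: (measurableT_comp (measurable_avg mU ih) (measurable_obs mU)).
by move=> w; rewrite ger0_norm ?sqr_ge0// avg_sqr_le.
Qed.

Lemma Rint_avg_sqr_obs_le h : measurable_fun setT h -> intg mu (fun s => h s ^+ 2) ->
  \int[Q]_w avg mu U h (obs U w) ^+ 2 <= \int[mu]_s h s ^+ 2.
Proof.
move=> mh ih2; have ih := intg_sqr_intg mh ih2.
have [i <-] := ge0_intg_avg_obs (fun s => sqr_ge0 (h s)) ih2.
apply: Rint_le => //; first exact: intg_avg_sqr_obs.
by move=> w; exact: avg_sqr_le.
Qed.

Lemma intg_mul_sqr (f g : S * Y -> R) :
  measurable_fun setT f -> measurable_fun setT g ->
  intg Q (fun w => f w ^+ 2) -> intg Q (fun w => g w ^+ 2) ->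
  intg Q (fun w => f w * g w).
Proof.
move=> mf mg i j; apply: (intg_dom _ (intgD i j)); first exact: measurable_funM.
by move=> w; exact: mul_le_sqr.
Qed.

(* Nishimori's identity: conditionally on the observation, the signal and a
   sample of the posterior law have the same distribution. *)
Lemma nishimori (g : Y -> R) h : measurable_fun setT g -> measurable_fun setT h ->
  intg Q (fun w => g (obs U w) ^+ 2) -> intg mu (fun s => h s ^+ 2) ->
  \int[Q]_w (g (obs U w) * h w.1) = \int[Q]_w (g (obs U w) * avg mu U h (obs U w)).
Proof.
move=> mg mh ig ih2; have ih := intg_sqr_intg mh ih2.
have mav := measurable_avg mU ih.
have mgo : measurable_fun setT (fun w => g (obs U w)).
  exact: (measurableT_comp mg (measurable_obs mU)).
have mg2 : measurable_fun setT (fun w : S * Y => g w.2) by exact: measurableT_comp.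
have mh1 : measurable_fun setT (fun w : S * Y => h w.1) by exact: measurableT_comp.
have ma2 : measurable_fun setT (fun w : S * Y => avg mu U h w.2).
  exact: (measurableT_comp mav).
have i1 : intg Q (fun w => g (obs U w) * h w.1).
  by apply: intg_mul_sqr => //; exact: (intg_fst gam ih2).
have i2 : intg Q (fun w => g (obs U w) * avg mu U h (obs U w)).
  exact: (intg_mul_sqr mgo (measurableT_comp mav (measurable_obs mU)) ig
    (intg_avg_sqr_obs mh ih2)).
have m1 := measurable_funM mg2 mh1; have m2 := measurable_funM mg2 ma2.
rewrite (Rint_obs_pair m1) (Rint_obs_pair m2).
have j1 := (intg_obs_pair m1).1 i1; have j2 := (intg_obs_pair m2).1 i2.
rewrite (Rint_prod2 j1) /=; last first.
  move=> y; apply: (eq_intg (f := fun s => g y * (h s * wt U s y))).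
    by move=> s; rewrite mulrA.
  by apply: intgZ; exact: intg_mul_wt.
rewrite (Rint_prod2 j2) /=; last first.
  by move=> y; apply: intgZ; exact: intg_wt.
apply: eq_Rint => y.
rewrite [RHS]RintZ ?intg_wt// -/(dens mu U y) -mulrA avg_dens.
rewrite -RintZ; first by apply: eq_Rint => s; rewrite mulrA.
exact: intg_mul_wt.
Qed.

End one_channel.
End channel_inequalities.

Section gibbs_tangent.
Context {R : realType} d (S : measurableType d) (mu : probability S R) (m : nat).
Local Notation gam := (iprod (stdn R) m).
Local Notation Y := (m.-tuple R).
Local Notation Q := (mu \x gam)%E.
Implicit Types (U V : 'I_m -> S -> R) (h : S -> R).

Lemma sqintW U : sqint mu U -> forall k, measurable_fun setT (U k).
Proof. by move=> h k; case: (h k). Qed.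

Lemma sqint_intg U k : sqint mu U -> intg mu (U k).
Proof. by move=> /(_ k) [mU iU]; exact: intg_sqr_intg. Qed.

Lemma sqintZ (c : 'I_m -> R) U : sqint mu U -> sqint mu (fun k s => c k * U k s).
Proof.
move=> hU k; have [mU iU] := hU k; split; first exact: measurable_funM.
by apply: (eq_intg _ (intgZ (c k ^+ 2) iU)) => s; rewrite exprMn.
Qed.

Lemma intg_tnth_sqr (k : 'I_m) : intg gam (fun y => tnth y k ^+ 2).
Proof.
exact: (law_intg (measurable_tnth k) (fun A mA => law_tnth (stdn R) k mA) intg_stdn_sqr).
Qed.

Lemma intg_ybound_obs U : sqint mu U -> intg Q (fun w => ybound (obs U w)).
Proof.
move=> hU.
apply: (@intg_dom _ _ _ Q _ (fun w : S * Y => \sum_(k < m)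
    (2 * tnth w.2 k ^+ 2 + 2 * U k w.1 ^+ 2))).
- exact: (measurableT_comp (@measurable_ybound _ _) (measurable_obs (sqintW hU))).
- apply: intg_sum => k _; apply: intgD.
    by apply: intgZ; exact: (intg_snd mu (intg_tnth_sqr k)).
  by apply: intgZ; have [_ i] := hU k; exact: (intg_fst gam i).
- move=> w; rewrite ger0_norm; last by apply: sumr_ge0 => k _; exact: sqr_ge0.
  apply: ler_sum => k _; rewrite tnth_mktuple.
  by have := sqr_ge0 (tnth w.2 k - U k w.1); nra.
Qed.

Lemma intg_exponent U y : sqint mu U ->
  intg mu (fun s => \sum_(k < m) (U k s * tnth y k - U k s ^+ 2 / 2)).
Proof.
move=> hU; apply: intg_sum => k _; apply: intgB; apply: intgZr.
  exact: sqint_intg.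
by case: (hU k).
Qed.

(** From above this is the uniform bound on the weight, from below Jensen's inequality for its
    exponent. Being quadratic in [y], the bound makes the log-likelihood of one channel integrable
    at the observation of another. *)
Lemma ln_dens_bound V : sqint mu V -> exists C, forall y,
  `|ln (dens mu V y)| <= ybound y + C.
Proof.
move=> hV; have mV := sqintW hV.
exists (\sum_(k < m) ((\int[mu]_s V k s) ^+ 2 + \int[mu]_s (V k s ^+ 2))) => y.
have D0 := dens_gt0 mu mV y.
have yb0 : 0 <= ybound y by apply: sumr_ge0 => k _; exact: sqr_ge0.
have C0 : 0 <= \sum_(k < m) ((\int[mu]_s V k s) ^+ 2 + \int[mu]_s (V k s ^+ 2)).
  apply: sumr_ge0 => k _; rewrite addr_ge0 ?sqr_ge0//.
  by apply: Rint_ge0 => s; exact: sqr_ge0.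
rewrite ler_norml; apply/andP; split; last first.
  have : ln (dens mu V y) <= ybound y / 2.
    by rewrite -[leRHS]expRK ler_ln ?posrE ?expR_gt0// dens_le.
  lra.
pose X s := \sum_(k < m) (V k s * tnth y k - V k s ^+ 2 / 2).
have iX : intg mu X := intg_exponent y hV.
have := @expR_mean_le _ _ _ mu (fun=> 1) X (fun=> ler01) (intg_cst mu 1).
rewrite Rint_cst !mul1r divr1.
have e1 (f : S -> R) : \int[mu]_s (f s * 1) = \int[mu]_s f s.
  by apply: eq_Rint => s; rewrite mulr1.
rewrite !e1 => hJ.
have : expR (\int[mu]_s X s) <= dens mu V y.
  apply: hJ => //.
    by apply: (eq_intg _ iX) => s; rewrite mulr1.
  by apply: (eq_intg _ (intg_wt mu mV y)) => s; rewrite mulr1.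
rewrite -ler_ln ?posrE ?expR_gt0// expRK; apply: le_trans.
rewrite Rint_sum; last first.
  move=> k _; apply: intgB; apply: intgZr; first exact: sqint_intg.
  by case: (hV k).
rewrite /ybound -big_split/= -sumrN; apply: ler_sum => k _.
rewrite RintB; last 2 first.
- by apply: intgZr; exact: sqint_intg.
- by apply: intgZr; case: (hV k).
rewrite !RintZr; [|by case: (hV k)|exact: sqint_intg].
have h2 : 0 <= \int[mu]_s (V k s ^+ 2) by apply: Rint_ge0 => s; exact: sqr_ge0.
have := sqr_ge0 (tnth y k + \int[mu]_s V k s).
have := sqr_ge0 (tnth y k); have := sqr_ge0 (\int[mu]_s V k s).
nra.
Qed.

Lemma intg_ln_dens_obs V U : sqint mu V -> sqint mu U ->
  intg Q (fun w => ln (dens mu V (obs U w))).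
Proof.
move=> hV hU; have [C hC] := ln_dens_bound hV.
apply: (@intg_dom _ _ _ Q _ (fun w : S * Y => ybound (obs U w) + C)).
- exact: (measurableT_comp (measurable_ln_dens mu (sqintW hV)) (measurable_obs (sqintW hU))).
- by apply: intgD; [exact: intg_ybound_obs|exact: intg_cst].
- by move=> w; exact: hC.
Qed.

Lemma intg_ln_dens_obs1 V U s : sqint mu V -> (forall k, measurable_fun setT (U k)) ->
  intg gam (fun z => ln (dens mu V (obs U (s, z)))).
Proof.
move=> hV mU; have [C hC] := ln_dens_bound hV.
apply: (@intg_dom _ _ _ gam _ (fun z : Y =>
   \sum_(k < m) (2 * tnth z k ^+ 2 + 2 * U k s ^+ 2) + C)).
- have mo := measurableT_comp (measurable_obs mU) (pair1_measurable s).
  exact: (measurableT_comp (measurable_ln_dens mu (sqintW hV)) mo).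
- apply: intgD; last exact: intg_cst.
  apply: intg_sum => k _; apply: intgD; last exact: intg_cst.
  by apply: intgZ; exact: intg_tnth_sqr.
- move=> z; apply: (le_trans (hC _)); rewrite lerD2r; apply: ler_sum => k _.
  by rewrite tnth_mktuple; have := sqr_ge0 (tnth z k - U k s); nra.
Qed.

Lemma integral_dens V : (forall k, measurable_fun setT (V k)) ->
  (\int[gam]_y (dens mu V y)%:E = 1)%E.
Proof.
move=> mV; have := @ge0_integral_obs _ _ _ mu _ _ mV (cst 1%E) (measurable_cst _) (fun=> lee01).
rewrite integral_cst// mul1e [X in X = _ -> _](_ : _ = 1%E); last exact: probability_setT.
by move=> ->; apply: eq_integral => y _; rewrite mul1e.
Qed.

(** The ratio of the two densities has mean 1 under the law of the observation of [U], and the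
    logarithm lies below its tangent at 1. *)
Lemma gibbs_inequality V U : sqint mu V -> sqint mu U ->
  \int[Q]_w ln (dens mu V (obs U w)) <= info mu U.
Proof.
move=> hV hU; have mV := sqintW hV; have mU := sqintW hU.
rewrite -subr_le0 /info -RintB; [|exact: intg_ln_dens_obs|exact: intg_ln_dens_obs].
have mr : measurable_fun setT (fun y => dens mu V y / dens mu U y).
  rewrite (_ : (fun y => _) = fun y => expR (ln (dens mu V y) - ln (dens mu U y))).
    by apply: measurableT_comp => //; apply: measurable_funB; exact: measurable_ln_dens.
  apply/funext => y.
  have p1 : dens mu V y \is Num.pos by rewrite posrE dens_gt0.
  have p2 : dens mu U y \is Num.pos by rewrite posrE dens_gt0.
  by rewrite expRB; congr (_ / _); apply/esym; [exact: lnK p1|exact: lnK p2].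
have e : (\int[Q]_w (dens mu V (obs U w) / dens mu U (obs U w))%:E = 1)%E.
  rewrite (@ge0_integral_obs _ _ _ mu _ _ mU (fun y => (dens mu V y / dens mu U y)%:E)).
  - rewrite -(integral_dens mV); apply: eq_integral => y _.
    by rewrite -EFinM divfK// gt_eqF ?dens_gt0.
  - exact/measurable_EFinP.
  - by move=> y; rewrite lee_fin divr_ge0 ?dens_ge0.
have ir : intg Q (fun w => dens mu V (obs U w) / dens mu U (obs U w)).
  apply: (@ge0_intg _ _ _ _ _ 1).
  - exact: (measurableT_comp mr (measurable_obs mU)).
  - by move=> w; rewrite divr_ge0 ?dens_ge0.
  - by rewrite e.
apply: (@le_trans _ _ (\int[Q]_w (dens mu V (obs U w) / dens mu U (obs U w) - 1))).
  apply: Rint_le.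
  - by apply: intgB; exact: intg_ln_dens_obs.
  - by apply: intgB => //; exact: intg_cst.
  - by move=> w; rewrite ln_diff_le ?dens_gt0.
rewrite RintB//; last exact: intg_cst.
by rewrite Rint_cst {1}/Rintegral e subrr.
Qed.

(** Shifting [y] by [a] multiplies each weight by the exponential of the inner product of [V s] and
    [a], so the ratio of densities is the posterior mean of an exponential, to which Jensen's
    inequality applies. *)
Lemma dens_shift_ge V y (a : 'I_m -> R) : sqint mu V ->
  ln (dens mu V y) + \sum_(k < m) avg mu V (V k) y * a k <= ln (dens mu V (tshift a y)).
Proof.
move=> hV; have mV := sqintW hV; have D0 := dens_gt0 mu mV y.
pose X s := \sum_(k < m) V k s * a k.
have iVk k : intg mu (fun s => V k s * wt V s y).
  by apply: intg_mul_wt => //; exact: sqint_intg.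
have wE s : wt V s (tshift a y) = expR (X s) * wt V s y.
  rewrite /wt -expRD /X -big_split/=; congr expR; apply: eq_bigr => k _.
  by rewrite tnth_mktuple; ring.
have iXk k : intg mu (fun s => V k s * a k * wt V s y).
  by apply: (eq_intg _ (intgZ (a k) (iVk k))) => s; ring.
have iX : intg mu (fun s => X s * wt V s y).
  have := @intg_sum _ _ _ mu _ (index_enum 'I_m) xpredT _ (fun k _ => iXk k).
  by apply: eq_intg => s; rewrite mulr_suml.
have := @expR_mean_le _ _ _ mu (fun s => wt V s y) X (fun s => wt_ge0 V s y)
  (intg_wt mu mV y) iX.
rewrite -/(dens mu V y) => /(_ _ D0) hJ.
have : dens mu V y * expR ((\int[mu]_s (X s * wt V s y)) / dens mu V y) <=
    dens mu V (tshift a y).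
  rewrite [leRHS](eq_Rint mu wE); apply: hJ.
  by apply: (eq_intg _ (intg_wt mu mV (tshift a y))).
rewrite -ler_ln ?posrE ?mulr_gt0 ?expR_gt0 ?dens_gt0//.
rewrite lnM ?posrE ?expR_gt0// expRK.
rewrite (_ : _ / dens mu V y = \sum_(k < m) avg mu V (V k) y * a k)//.
under eq_Rint do rewrite /X mulr_suml.
rewrite Rint_sum// mulr_suml; apply: eq_bigr => k _.
rewrite /avg mulrAC; congr (_ / _); rewrite -RintZr//.
by apply: eq_Rint => s; ring.
Qed.

Lemma intg_tangent V U k : sqint mu V -> sqint mu U ->
  intg Q (fun w => avg mu V (V k) (obs V w) * (U k w.1 - V k w.1)).
Proof.
move=> hV hU; have mV := sqintW hV; have mU := sqintW hU.
have [_ iV] := hV k; have [_ iU] := hU k.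
apply: intg_mul_sqr.
- exact: (measurableT_comp (measurable_avg mV (sqint_intg k hV)) (measurable_obs mV)).
- by apply: measurable_funB; [exact: (measurableT_comp (mU k))|exact: (measurableT_comp (mV k))].
- exact: intg_avg_sqr_obs.
- apply: (@intg_dom _ _ _ Q _ (fun w : S * Y => 2 * U k w.1 ^+ 2 + 2 * V k w.1 ^+ 2)).
  + apply: measurable_funX; apply: measurable_funB.
      exact: (measurableT_comp (mU k)).
    exact: (measurableT_comp (mV k)).
  + by apply: intgD; apply: intgZ; [exact: (intg_fst gam iU)|exact: (intg_fst gam iV)].
  + move=> w; rewrite ger0_norm ?sqr_ge0//.
    by have := sqr_ge0 (U k w.1 + V k w.1); nra.
Qed.

(* The law of the observation of [U] is a worse reference for itself than any
   other; shifting [obs U] back to [obs V] costs a linear term by Jensen. *)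
Lemma info_tangent V U : sqint mu V -> sqint mu U ->
  info mu V + \sum_(k < m) \int[Q]_w (avg mu V (V k) (obs V w) * (U k w.1 - V k w.1))
    <= info mu U.
Proof.
move=> hV hU; apply: le_trans (gibbs_inequality hV hU).
rewrite -Rint_sum; last by move=> k _; exact: intg_tangent.
rewrite /info -RintD; last 2 first.
- exact: intg_ln_dens_obs.
- by apply: intg_sum => k _; exact: intg_tangent.
apply: Rint_le.
- apply: intgD; first exact: intg_ln_dens_obs.
  by apply: intg_sum => k _; exact: intg_tangent.
- exact: intg_ln_dens_obs.
- move=> w; have := dens_shift_ge (obs V w) (fun k => U k w.1 - V k w.1) hV.
  rewrite (_ : tshift _ (obs V w) = obs U w)//.
  by apply: eq_from_tnth => k; rewrite !tnth_mktuple; ring.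
Qed.

(** Young's inequality with parameter [e] splits the linear term of the tangent inequality, and
    second moments of posterior means are at most those of [V]. For signals at L2 distance of order
    [e] the loss is of order [e]. *)
Lemma info_compare V U (e : R) : 0 < e -> sqint mu V -> sqint mu U ->
  info mu V - (e * \sum_(k < m) \int[mu]_s V k s ^+ 2 +
     e^-1 * \sum_(k < m) \int[mu]_s (U k s - V k s) ^+ 2) <= info mu U.
Proof.
move=> e0 hV hU; have mV := sqintW hV; have mU := sqintW hU.
apply: le_trans (info_tangent hV hU); rewrite lerD2l !mulr_sumr -big_split/= -sumrN.
apply: ler_sum => k _.
have [_ iV] := hV k; have [_ iU] := hU k.
have iD : intg mu (fun s => (U k s - V k s) ^+ 2).
  apply: (@intg_dom _ _ _ _ _ (fun s => 2 * U k s ^+ 2 + 2 * V k s ^+ 2)).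
  - by apply: measurable_funX; apply: measurable_funB.
  - by apply: intgD; apply: intgZ.
  - move=> s; rewrite ger0_norm ?sqr_ge0//.
    by have := sqr_ge0 (U k s + V k s); nra.
have ia := intg_avg_sqr_obs mV (mV k) iV.
apply: (@le_trans _ _ (- (e * \int[Q]_w avg mu V (V k) (obs V w) ^+ 2 +
    e^-1 * \int[mu]_s (U k s - V k s) ^+ 2))).
  rewrite lerN2 lerD2r; apply: ler_wpM2l; first exact: ltW.
  exact: Rint_avg_sqr_obs_le.
have iD' := intg_fst gam iD.
rewrite -(Rint_fst gam iD) -!RintZ// -RintD; [|exact: intgZ|exact: intgZ].
rewrite -RintN; last by apply: intgD; exact: intgZ.
apply: Rint_le.
- by apply: intgN; apply: intgD; exact: intgZ.
- exact: intg_tangent.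
- move=> w; set a := avg _ _ _ _; set b := U k w.1 - V k w.1.
  have ei : 0 < e^-1 by rewrite invr_gt0.
  have ee : e * e^-1 = 1 by rewrite mulfV// gt_eqF.
  (* The square behind [- e * a ^ 2 - b ^ 2 / e <= a * b]. *)
  have : 0 <= e * (a + e^-1 * b / 2) ^+ 2 by rewrite mulr_ge0 ?sqr_ge0// ltW.
  have -> : e * (a + e^-1 * b / 2) ^+ 2 =
    e * a ^+ 2 + (e * e^-1) * (a * b) + (e * e^-1) * (e^-1 * b ^+ 2) / 4 by field; rewrite gt_eqF.
  rewrite ee !mul1r.
  have : 0 <= e^-1 * b ^+ 2 by rewrite mulr_ge0 ?sqr_ge0// ltW.
  lra.
Qed.

(* [c k] are the amplitudes (square roots of signal-to-noise ratios) at which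
   the signals [u k] are observed. *)
Lemma info_tangent_coef (u : 'I_m -> S -> R) (c c' : 'I_m -> R) :
  let V := fun k s => c k * u k s in
  sqint mu u ->
  info mu V + \sum_(k < m) c k * (c' k - c k) *
      \int[Q]_w avg mu V (u k) (obs V w) ^+ 2
    <= info mu (fun k s => c' k * u k s).
Proof.
move=> V hu; have hV : sqint mu V by exact: sqintZ.
have mV := sqintW hV; have mu_ := sqintW hu.
apply: le_trans (info_tangent hV (sqintZ c' hu)).
rewrite lerD2l; apply: ler_sum => k _.
have [_ iu] := hu k; have ik := sqint_intg k hu.
have mav := measurable_avg mV ik.
have ia := intg_avg_sqr_obs mV (mu_ k) iu.
have avE y : avg mu V (V k) y = c k * avg mu V (u k) y.
  rewrite /avg mulrA; congr (_ / _); rewrite -RintZ; last exact: intg_mul_wt.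
  by apply: eq_Rint => s; rewrite mulrA.
have -> : \int[Q]_w (avg mu V (V k) (obs V w) * (c' k * u k w.1 - V k w.1)) =
    c k * (c' k - c k) * \int[Q]_w (avg mu V (u k) (obs V w) * u k w.1).
  rewrite -RintZ.
    by apply: eq_Rint => w; rewrite avE /V; ring.
  exact: (intg_mul_sqr (measurableT_comp mav (measurable_obs mV))
    (measurableT_comp (mu_ k) measurable_fst) ia (intg_fst gam iu)).
rewrite (nishimori mV mav (mu_ k) ia iu).
by rewrite le_eqVlt; apply/orP; left; apply/eqP; congr (_ * _); apply: eq_Rint => w; rewrite expr2.
Qed.

(** Orthogonality of the posterior mean: the error exceeds the left side by the mean of
    [(theta - avg) ^ 2]. An infinite error leaves nothing to prove; a finite one makes [theta]
    square integrable at the observation, so that Nishimori's identity applies. *)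
Lemma ge0_integral_mse_ge U h (theta : Y -> R) : sqint mu U ->
  measurable_fun setT h -> intg mu (fun s => h s ^+ 2) -> measurable_fun setT theta ->
  ((\int[mu]_s h s ^+ 2 - \int[Q]_w avg mu U h (obs U w) ^+ 2)%:E <=
   \int[Q]_w ((h w.1 - theta (obs U w)) ^+ 2)%:E)%E.
Proof.
move=> hU mh ih2 mt; have mU := sqintW hU; have ih := intg_sqr_intg mh ih2.
have mo := measurable_obs mU.
have mto := measurableT_comp mt mo.
have mh1 : measurable_fun setT (fun w : S * Y => h w.1) by exact: measurableT_comp.
have [fin|] := boolP (\int[Q]_w ((h w.1 - theta (obs U w)) ^+ 2)%:E < +oo)%E; last first.
  by rewrite -leNgt leye_eq => /eqP ->; rewrite leey.
have i2 : intg Q (fun w => (h w.1 - theta (obs U w)) ^+ 2).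
  apply/integrableP; split.
    by apply/measurable_EFinP; apply: measurable_funX; exact: measurable_funB.
  by under eq_integral do rewrite /= ger0_norm ?sqr_ge0//.
have ih1 := intg_fst gam ih2.
have it : intg Q (fun w => theta (obs U w) ^+ 2).
  apply: (@intg_dom _ _ _ Q _ (fun w : S * Y => 2 * h w.1 ^+ 2 + 2 * (h w.1 - theta (obs U w)) ^+ 2)).
  - exact: measurable_funX.
  - by apply: intgD; exact: intgZ.
  - move=> w; rewrite ger0_norm ?sqr_ge0//.
    by have := sqr_ge0 (h w.1 + (h w.1 - theta (obs U w))); nra.
rewrite -Rint_EFin// lee_fin.
have mav := measurable_avg mU ih.
have ia := intg_avg_sqr_obs mU mh ih2.
have iht : intg Q (fun w => theta (obs U w) * h w.1) by exact: intg_mul_sqr.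
have iat : intg Q (fun w => theta (obs U w) * avg mu U h (obs U w)).
  exact: (intg_mul_sqr mto (measurableT_comp mav mo) it ia).
have E : \int[Q]_w (h w.1 - theta (obs U w)) ^+ 2 =
    \int[mu]_s h s ^+ 2 - 2 * \int[Q]_w (theta (obs U w) * avg mu U h (obs U w)) +
    \int[Q]_w theta (obs U w) ^+ 2.
  rewrite -(nishimori mU mt mh it ih2) -(Rint_fst gam ih2) -RintZ// -RintB//; last exact: intgZ.
  rewrite -RintD//; last by apply: intgB => //; exact: intgZ.
  by apply: eq_Rint => w; ring.
rewrite E -subr_ge0 -RintZ//.
have -> : \int[mu]_s h s ^+ 2 - \int[Q]_w (2 * (theta (obs U w) * avg mu U h (obs U w))) +
    \int[Q]_w theta (obs U w) ^+ 2 -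
    (\int[mu]_s h s ^+ 2 - \int[Q]_w avg mu U h (obs U w) ^+ 2) =
  \int[Q]_w ((theta (obs U w) - avg mu U h (obs U w)) ^+ 2).
  transitivity (\int[Q]_w (theta (obs U w) ^+ 2 + avg mu U h (obs U w) ^+ 2) -
     \int[Q]_w (2 * (theta (obs U w) * avg mu U h (obs U w)))).
    by rewrite RintD//; ring.
  rewrite -RintB//; [|exact: intgD|exact: intgZ].
  by apply: eq_Rint => w; ring.
by apply: Rint_ge0 => w; exact: sqr_ge0.
Qed.

Lemma integral_mse_avg U h : sqint mu U ->
  measurable_fun setT h -> intg mu (fun s => h s ^+ 2) ->
  (\int[Q]_w ((h w.1 - avg mu U h (obs U w)) ^+ 2)%:E =
   (\int[mu]_s h s ^+ 2 - \int[Q]_w avg mu U h (obs U w) ^+ 2)%:E)%E.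
Proof.
move=> hU mh ih2; have mU := sqintW hU; have ih := intg_sqr_intg mh ih2.
have mav := measurable_avg mU ih.
have ia := intg_avg_sqr_obs mU mh ih2.
have ih1 := intg_fst gam ih2.
have mao := measurableT_comp mav (measurable_obs mU).
have mh1 : measurable_fun setT (fun w : S * Y => h w.1) by exact: measurableT_comp.
have iah : intg Q (fun w => avg mu U h (obs U w) * h w.1) by exact: intg_mul_sqr.
have iE : intg Q (fun w => (h w.1 - avg mu U h (obs U w)) ^+ 2).
  apply: (eq_intg (f := fun w => h w.1 ^+ 2 -
      2 * (avg mu U h (obs U w) * h w.1) + avg mu U h (obs U w) ^+ 2)).
    by move=> w; ring.
  by apply: intgD => //; apply: intgB => //; exact: intgZ.
rewrite -Rint_EFin//; congr EFin.
transitivity (\int[Q]_w (h w.1 ^+ 2 - 2 * (avg mu U h (obs U w) * h w.1) +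
   avg mu U h (obs U w) ^+ 2)).
  by apply: eq_Rint => w; ring.
rewrite RintD//; last by apply: intgB => //; exact: intgZ.
rewrite RintB//; last exact: intgZ.
rewrite RintZ// (nishimori mU mav mh ia ih2) (Rint_fst gam ih2).
have -> : \int[Q]_w (avg mu U h (obs U w) * avg mu U h (obs U w)) =
  \int[Q]_w avg mu U h (obs U w) ^+ 2 by apply: eq_Rint => w; rewrite expr2.
ring.
Qed.

End gibbs_tangent.

(** * Finite Gibbs measures and interpolation *)

Section finite_gibbs.
Context {R : realType} (G : finType) (a : G -> R) (m : nat).
Hypotheses (a0 : forall x, 0 <= a x) (a1 : \sum_x a x = 1).
Local Notation gam := (iprod (stdn R) m).
Local Notation Y := (m.-tuple R).
Implicit Types (v : 'I_m -> G -> R) (b f : G -> R).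

Lemma expR_le_taylor1 (t : R) : `|expR t - 1 - t| <= t ^+ 2 * expR `|t|.
Proof.
have h1 := expR_ge1Dx t; have h2 := expR_ge1Dx (- t).
have E : expR t * expR (- t) = 1 by rewrite expRxMexpNx_1.
have e0 := expR_gt0 t.
rewrite ger0_norm; last by lra.
have h5 : expR t * (1 - t) <= expR t * expR (- t) by rewrite ler_wpM2l// ltW.
rewrite E in h5.
have h3 : expR t - 1 - t <= t * (expR t - 1) by lra.
apply: (le_trans h3).
have [t0|t0] := ger0P t.
  by rewrite expr2 -mulrA ler_wpM2l//; lra.
have h4 : 1 <= expR (- t) by rewrite -expR0 ler_expR oppr_ge0 ltW.
apply: (@le_trans _ _ (t ^+ 2)); first by nra.
by rewrite ler_peMr ?sqr_ge0.
Qed.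

(** Gibbs measures on a finite set with reference weights [a]: [v k] couples to the Gaussian
    coordinate [k] and [b] is a deterministic field. [part] is the partition function, [pgb] the
    Gibbs weights and [gav] the Gibbs average. *)
Definition ham v b (y : Y) x := \sum_(k < m) v k x * tnth y k + b x.
Definition part v b (y : Y) := \sum_x a x * expR (ham v b y x).
Definition pgb v b (y : Y) x := a x * expR (ham v b y x) / part v b y.
Definition gav v b f (y : Y) := \sum_x f x * pgb v b y x.

Lemma part_gt0 v b y : 0 < part v b y.
Proof.
have [x ax] : exists x, 0 < a x.
  apply/not_existsP => h.
  have : \sum_x a x <= 0.
    by apply: sumr_le0 => x _; rewrite leNgt; apply/negP; exact: h.
  by rewrite a1 ler10.
rewrite /part (bigD1 x)//=; apply: ltr_pwDl.
  by rewrite mulr_gt0 ?expR_gt0.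
by apply: sumr_ge0 => z _; rewrite mulr_ge0 ?expR_ge0.
Qed.

Lemma pgb_ge0 v b y x : 0 <= pgb v b y x.
Proof. by rewrite divr_ge0 ?mulr_ge0 ?expR_ge0// ltW// part_gt0. Qed.

Lemma pgb_sum v b y : \sum_x pgb v b y x = 1.
Proof. by rewrite -mulr_suml divff// gt_eqF// part_gt0. Qed.

Lemma gavD v b f g y : gav v b (fun x => f x + g x) y = gav v b f y + gav v b g y.
Proof. by rewrite -big_split; apply: eq_bigr => x _; rewrite mulrDl. Qed.

Lemma gavZ v b c f y : gav v b (fun x => c * f x) y = c * gav v b f y.
Proof. by rewrite mulr_sumr; apply: eq_bigr => x _; rewrite mulrA. Qed.

Lemma gavB v b f g y : gav v b (fun x => f x - g x) y = gav v b f y - gav v b g y.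
Proof.
rewrite -[X in _ = _ + X]mulN1r -gavZ -gavD; apply: eq_bigr => x _.
by rewrite mulN1r.
Qed.

Lemma gav_cst v b c y : gav v b (fun=> c) y = c.
Proof. by rewrite /gav -mulr_sumr pgb_sum mulr1. Qed.

Lemma gav_sum (I : Type) (s : seq I) (P : pred I) v b (f : I -> G -> R) y :
  gav v b (fun x => \sum_(i <- s | P i) f i x) y = \sum_(i <- s | P i) gav v b (f i) y.
Proof.
rewrite /gav exchange_big/=; apply: eq_bigr => x _.
by rewrite mulr_suml.
Qed.

Lemma eq_gav v b f g y : f =1 g -> gav v b f y = gav v b g y.
Proof. by move=> fg; apply: eq_bigr => x _; rewrite fg. Qed.

Lemma gav_le v b f g y : (forall x, f x <= g x) -> gav v b f y <= gav v b g y.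
Proof. by move=> fg; apply: ler_sum => x _; rewrite ler_wpM2r ?pgb_ge0. Qed.

(** A convenient bound of the supremum norm on a finite set. *)
Definition fbnd f := \sum_x `|f x|.

Lemma fbnd_ge f x : `|f x| <= fbnd f.
Proof. by rewrite /fbnd (bigD1 x)//= lerDl sumr_ge0. Qed.

Lemma fbnd_ge0 f : 0 <= fbnd f. Proof. exact: sumr_ge0. Qed.

Lemma gav_bnd v b f B y : (forall x, `|f x| <= B) -> `|gav v b f y| <= B.
Proof.
move=> fB; rewrite ler_norml; apply/andP; split.
  rewrite -(gav_cst v b (- B) y); apply: gav_le => x.
  by have := fB x; rewrite ler_norml => /andP[].
rewrite -[leRHS](gav_cst v b B y); apply: gav_le => x.
by have := fB x; rewrite ler_norml => /andP[].
Qed.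

Lemma gav_jensen v b f y : expR (gav v b f y) <= gav v b (fun x => expR (f x)) y.
Proof.
set c := gav v b f y.
have <- : gav v b (fun x => expR c * (f x + (1 - c))) y = expR c.
  by rewrite gavZ gavD gav_cst -/c; ring.
apply: gav_le => x; rewrite -[X in _ <= expR X](subrK c (f x)) [in leRHS]expRD.
rewrite mulrC ler_wpM2r ?expR_ge0//.
by have := expR_ge1Dx (f x - c); lra.
Qed.

Lemma measurable_ham v b x : measurable_fun setT (fun y => ham v b y x).
Proof.
apply: measurable_funD => //; apply: measurable_sum => k.
by apply: measurable_funM => //; exact: measurable_tnth.
Qed.

Lemma measurable_part v b : measurable_fun setT (part v b).
Proof.
apply: measurable_sum => x; apply: measurable_funM => //.
by apply: measurableT_comp => //; exact: measurable_ham.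
Qed.

Lemma measurable_ln_part v b : measurable_fun setT (fun y => ln (part v b y)).
Proof.
by apply: measurableT_comp; [exact: measurable_ln|exact: measurable_part].
Qed.

Lemma measurable_gav v b f : measurable_fun setT (gav v b f).
Proof.
apply: measurable_sum => x; apply: measurable_funM => //.
rewrite (_ : (fun y => _) = fun y => a x * (expR (ham v b y x) * expR (- ln (part v b y)))).
  apply: measurable_funM => //; apply: measurable_funM.
    by apply: measurableT_comp => //; exact: measurable_ham.
  do 2 apply: measurableT_comp => //; exact: measurable_ln_part.
by apply/funext => y; rewrite expRN lnK ?posrE ?part_gt0// mulrA.
Qed.

Lemma intg_gav v b f : intg gam (gav v b f).
Proof.
apply: (@intg_bnd _ _ _ _ _ (fbnd f)); first exact: measurable_gav.
by move=> y; apply: gav_bnd => x; exact: fbnd_ge.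
Qed.

Lemma intg_tnth (k : 'I_m) (g : R -> R) : intg (stdn R) g -> intg gam (fun y => g (tnth y k)).
Proof.
by move=> ig; exact: (law_intg (measurable_tnth k) (fun A mA => law_tnth (stdn R) k mA) ig).
Qed.

Lemma intg_norm_stdn : intg (stdn R) (fun x => `|x|).
Proof.
apply: (@intg_dom _ _ _ _ _ (fun x : R => expR (1 * `|x|))).
- exact: measurableT_comp.
- exact: intg_stdn_expR_norm.
- by move=> x; rewrite normr_id mul1r; have := expR_ge1Dx `|x|; lra.
Qed.

Lemma intg_ln_part v b : intg gam (fun y => ln (part v b y)).
Proof.
apply: (@intg_dom _ _ _ gam _ (fun y : Y => \sum_(k < m) fbnd (v k) * `|tnth y k| + fbnd b)).
- exact: measurable_ln_part.
- apply: intgD; last exact: intg_cst.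
  apply: intg_sum => k _; apply: intgZ.
  exact: (@intg_tnth k (fun x => `|x|) intg_norm_stdn).
- move=> y; set B := (X in _ <= X).
  have hB x : `|ham v b y x| <= B.
    rewrite (le_trans (ler_normD _ _))// lerD ?fbnd_ge//.
    rewrite (le_trans (ler_norm_sum _ _ _))//; apply: ler_sum => k _.
    by rewrite normrM ler_wpM2r ?fbnd_ge.
  rewrite ler_norml; apply/andP; split.
    rewrite -[leLHS]expRK ler_ln ?posrE ?expR_gt0 ?part_gt0//.
    rewrite -[leLHS]mul1r -a1 mulr_suml; apply: ler_sum => x _.
    by rewrite ler_wpM2l// ler_expR; have := hB x; rewrite ler_norml => /andP[].
  rewrite -[leRHS]expRK ler_ln ?posrE ?expR_gt0 ?part_gt0//.
  rewrite -[leRHS]mul1r -a1 mulr_suml; apply: ler_sum => x _.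
  by rewrite ler_wpM2l// ler_expR; have := hB x; rewrite ler_norml => /andP[].
Qed.

Lemma intg_tnth_gav k v b f : intg gam (fun y => tnth y k * gav v b f y).
Proof.
apply: (@intg_dom _ _ _ gam _ (fun y : Y => `|tnth y k| * fbnd f)).
- by apply: measurable_funM; [exact: measurable_tnth|exact: measurable_gav].
- apply: intgZr; exact: (@intg_tnth k (fun x => `|x|) intg_norm_stdn).
- move=> y; rewrite normrM ler_wpM2l//; apply: gav_bnd => x; exact: fbnd_ge.
Qed.

Section integration_by_parts.
Variables (v : 'I_m -> G -> R) (b f : G -> R) (k : 'I_m).

Let dk (e : R) : 'I_m -> R := fun j => if j == k then e else 0.

Lemma pgb_shift e y x : pgb v b (tshift (dk e) y) x =
  pgb v b y x * expR (e * v k x) / gav v b (fun x => expR (e * v k x)) y.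
Proof.
have hE z : expR (ham v b (tshift (dk e) y) z) = expR (ham v b y z) * expR (e * v k z).
  rewrite -expRD; congr expR; rewrite /ham addrAC; congr (_ + _).
  rewrite (bigD1 k)//= [in RHS](bigD1 k)//= tnth_mktuple /dk eqxx.
  rewrite (eq_bigr (fun j => v j z * tnth y j)); first by ring.
  by move=> j /negbTE jk; rewrite tnth_mktuple jk addr0.
have Z0 : part v b y != 0 by rewrite gt_eqF// part_gt0.
rewrite /pgb hE; set Z' := part _ _ (tshift _ _).
have -> : gav v b (fun x => expR (e * v k x)) y = Z' / part v b y.
  rewrite /gav /Z' /part mulr_suml; apply: eq_bigr => z _.
  by rewrite /pgb hE; ring.
have Z'0 : Z' != 0 by rewrite gt_eqF// part_gt0.
by field; rewrite Z0 Z'0.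
Qed.

Lemma gav_shift e y : gav v b f (tshift (dk e) y) =
  gav v b (fun x => f x * expR (e * v k x)) y / gav v b (fun x => expR (e * v k x)) y.
Proof.
rewrite /gav mulr_suml; apply: eq_bigr => x _.
by rewrite pgb_shift; rewrite /gav; ring.
Qed.

Let cov y := gav v b (fun x => f x * v k x) y - gav v b f y * gav v b (v k) y.

(** The derivative of a Gibbs average along coordinate [k] is the covariance with [v k]; the error
    is uniform in [y] because functions on a finite set are bounded. *)
Lemma gav_shift_taylor : exists C, forall e y, 0 <= e <= 1 ->
  `|gav v b f (tshift (dk e) y) - gav v b f y - e * cov y| <= C * e ^+ 2.
Proof.
set A := fbnd f; set B := fbnd (v k).
have A0 : 0 <= A := fbnd_ge0 f; have B0 : 0 <= B := fbnd_ge0 (v k).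
pose K := B ^+ 2 * expR B.
have K0 : 0 <= K by rewrite mulr_ge0 ?sqr_ge0 ?expR_ge0.
exists ((A * K + B * (2 * A * B) + K * (A + 2 * A * B)) * expR B) => e y /andP[e0 e1].
pose r x := expR (e * v k x) - 1 - e * v k x.
have vB x : `|v k x| <= B by exact: fbnd_ge.
have hr x : `|r x| <= e ^+ 2 * K.
  apply: (le_trans (expR_le_taylor1 _)); rewrite exprMn -mulrA ler_wpM2l ?sqr_ge0//.
  apply: ler_pM; rewrite ?sqr_ge0 ?expR_ge0//.
    by rewrite -[leLHS]ger0_norm ?sqr_ge0// normrX lerXn2r ?nnegrE.
  rewrite ler_expR normrM ger0_norm//; apply: le_trans (vB x).
  by rewrite ler_piMl.
have fA x : `|f x| <= A by exact: fbnd_ge.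
pose p := gav v b (fun x => expR (e * v k x)) y.
pose n := gav v b (fun x => f x * expR (e * v k x)) y.
have pE : p = 1 + e * gav v b (v k) y + gav v b r y.
  rewrite -gavZ -[X in X + _ + _](gav_cst v b 1 y) -!gavD; apply: eq_gav => x.
  by rewrite /r; ring.
have nE : n = gav v b f y + e * gav v b (fun x => f x * v k x) y +
    gav v b (fun x => f x * r x) y.
  rewrite -gavZ -!gavD; apply: eq_gav => x; by rewrite /r; ring.
(* The normalisation stays away from 0 uniformly in [y], which controls the quotient. *)
have p0 : expR (- B) <= p.
  rewrite -(gav_cst v b (expR (- B)) y); apply: gav_le => x; rewrite ler_expR.
  have := vB x; rewrite ler_norml => /andP[h1 h2].
  have : - B <= e * - B by nra.
  by move=> h; apply: (le_trans h); rewrite ler_wpM2l.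
have pp : 0 < p := lt_le_trans (expR_gt0 _) p0.
have ip : p^-1 <= expR B.
  by rewrite -[expR B]invrK -expRN lef_pV2 ?posrE ?expR_gt0.
rewrite gav_shift -/p -/n.
have -> : n / p - gav v b f y - e * cov y =
    (gav v b (fun x => f x * r x) y - e ^+ 2 * (gav v b (v k) y * cov y) -
     gav v b r y * (gav v b f y + e * cov y)) / p.
  apply: (mulIf (lt0r_neq0 pp)); rewrite divfK ?gt_eqF// !mulrBl divfK ?gt_eqF//.
  by rewrite nE pE /cov; ring.
rewrite normrM [`|p^-1|]ger0_norm ?invr_ge0 ?(ltW pp)// [leRHS]mulrAC.
apply: ler_pM => //; first by rewrite invr_ge0 ltW.
have g1 : `|gav v b f y| <= A by exact: gav_bnd.
have g2 : `|gav v b (v k) y| <= B by exact: gav_bnd.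
have g3 : `|gav v b r y| <= e ^+ 2 * K by exact: gav_bnd.
have g4 : `|gav v b (fun x => f x * r x) y| <= A * (e ^+ 2 * K).
  by apply: gav_bnd => x; rewrite normrM ler_pM.
have g5 : `|gav v b (fun x => f x * v k x) y| <= A * B.
  by apply: gav_bnd => x; rewrite normrM ler_pM.
have g6 : `|cov y| <= 2 * A * B.
  rewrite (le_trans (ler_normB _ _))// normrM -mulrA mulr2n mulrDl mul1r.
  by rewrite lerD// ler_pM.
apply: (le_trans (ler_normB _ _)).
apply: (@le_trans _ _ ((A * (e ^+ 2 * K) + e ^+ 2 * (B * (2 * A * B))) +
   e ^+ 2 * K * (A + 2 * A * B))); last first.
  by rewrite le_eqVlt; apply/orP; left; apply/eqP; ring.
apply: lerD.
  apply: (le_trans (ler_normB _ _)); apply: lerD => //.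
  by rewrite normrM ger0_norm ?sqr_ge0// ler_wpM2l ?sqr_ge0// normrM ler_pM.
rewrite normrM ler_pM//; apply: (le_trans (ler_normD _ _)); apply: lerD => //.
rewrite normrM ger0_norm//; apply: le_trans g6.
by rewrite ler_piMl.
Qed.

Lemma Rint_gav_shift e : \int[gam]_y gav v b f (tshift (dk e) y) =
  \int[gam]_y (gav v b f y * expR (e * tnth y k - e ^+ 2 / 2)).
Proof.
set B := fbnd f.
have gB y : `|gav v b f y| <= B by apply: gav_bnd => x; exact: fbnd_ge.
have E (y : Y) : \sum_(j < m) (dk e j * tnth y j - dk e j ^+ 2 / 2) = e * tnth y k - e ^+ 2 / 2.
  rewrite (bigD1 k)//= {1 2}/dk eqxx big1 ?addr0// => j /negbTE jk.
  by rewrite /dk jk; ring.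
have me : measurable_fun setT (fun y : Y => expR (e * tnth y k - e ^+ 2 / 2)).
  apply: measurableT_comp => //; apply: measurable_funB => //.
  by apply: measurable_funM => //; exact: measurable_tnth.
have ie : intg gam (fun y : Y => expR (e * tnth y k - e ^+ 2 / 2)).
  apply: (@intg_tnth k (fun x => expR (e * x - e ^+ 2 / 2))).
  apply: (eq_intg (f := fun x => expR (e * x) * expR (- (e ^+ 2 / 2)))).
    by move=> x; rewrite -expRD.
  exact/intgZr/intg_stdn_expR.
have ms : measurable_fun setT (fun y => gav v b f (tshift (dk e) y)).
  exact: (measurableT_comp (measurable_gav v b f) (measurable_tshift (dk e))).
have is1 : intg gam (fun y => gav v b f (tshift (dk e) y)).
  by apply: (@intg_bnd _ _ _ _ _ B).
have ige : intg gam (fun y => gav v b f y * expR (e * tnth y k - e ^+ 2 / 2)).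
  apply: (@intg_dom _ _ _ _ _ (fun y => B * expR (e * tnth y k - e ^+ 2 / 2))).
  - by apply: measurable_funM => //; exact: measurable_gav.
  - exact: intgZ.
  - by move=> y; rewrite normrM ler_pM// ger0_norm ?expR_ge0.
have key (g : Y -> R) : measurable_fun setT g -> (forall y, 0 <= g y) ->
    \int[gam]_y g (tshift (dk e) y) = \int[gam]_y (g y * expR (e * tnth y k - e ^+ 2 / 2)).
  move=> mg g0; rewrite /Rintegral; congr fine.
  rewrite (@ge0_integral_gaussian_shift _ _ (dk e) (fun y => (g y)%:E)).
  - by apply: eq_integral => y _; rewrite E EFinM.
  - exact/measurable_EFinP.
  - by move=> y; rewrite lee_fin.
(* The shift formula concerns nonnegative functions, so the bound [B] is added to the Gibbs average
   and its contribution cancelled. *)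
have k1 := key (fun=> B) (measurable_cst _) (fun=> fbnd_ge0 f).
have := key (fun y => gav v b f y + B).
rewrite RintD//; last exact: intg_cst.
rewrite k1.
rewrite [X in _ -> _ -> _ = X](_ : _ = \int[gam]_y (gav v b f y * expR (e * tnth y k - e ^+ 2 / 2) +
    B * expR (e * tnth y k - e ^+ 2 / 2))); last first.
  by apply: eq_Rint => y; rewrite mulrDl.
rewrite RintD//; last exact: intgZ.
move=> h; apply: (addIr (\int[gam]_y (B * expR (e * tnth y k - e ^+ 2 / 2)))).
apply: h.
  by apply: measurable_funD => //; exact: measurable_gav.
by move=> y; have := gB y; rewrite ler_norml => /andP[]; lra.
Qed.

Lemma expR_gaussian_taylor (e x : R) : 0 <= e <= 1 ->
  `|expR (e * x - e ^+ 2 / 2) - 1 - e * x| <=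
    e ^+ 2 * (1 + 4 * expR 2 * expR (2 * `|x|)).
Proof.
move=> /andP[e0 e1]; set t := e * x - e ^+ 2 / 2.
(* With this [z] one has [|t| <= e * z]; the constants come from [z ^ 2 <= 4 * expR z] and [expR z *
   expR z = expR 2 * expR (2 * |x|)]. *)
pose z := `|x| + 1.
have z0 : 0 <= z by rewrite addr_ge0.
have tz : `|t| <= e * z.
  rewrite (le_trans (ler_normB _ _))// normrM (ger0_norm e0) mulrDr mulr1 lerD2l.
  rewrite ger0_norm; last by rewrite divr_ge0 ?sqr_ge0.
  nra.
have tz2 : t ^+ 2 <= e ^+ 2 * z ^+ 2.
  rewrite -exprMn -[t ^+ 2]ger0_norm ?sqr_ge0// normrX lerXn2r ?nnegrE//.
  exact: mulr_ge0.
have h1 := expR_le_taylor1 t.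
have h2 : expR `|t| <= expR z.
  by rewrite ler_expR (le_trans tz)// ler_piMl.
have h3 : z ^+ 2 <= 4 * expR z.
  have := sqr_le_expR z; have : expR (- z) <= expR z by rewrite ler_expR; lra.
  lra.
have h4 : expR z * expR z = expR 2 * expR (2 * `|x|).
  by rewrite -!expRD; congr expR; rewrite /z; ring.
have -> : expR t - 1 - e * x = (expR t - 1 - t) - e ^+ 2 / 2 by rewrite /t; ring.
apply: (le_trans (ler_normB _ _)).
rewrite [`|e ^+ 2 / 2|]ger0_norm; last by rewrite divr_ge0 ?sqr_ge0.
rewrite mulrDr mulr1 addrC; apply: lerD.
  by have := sqr_ge0 e; lra.
apply: (le_trans h1).
apply: (@le_trans _ _ (e ^+ 2 * z ^+ 2 * expR z)).
  by apply: ler_pM; rewrite ?sqr_ge0 ?expR_ge0.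
rewrite -mulrA ler_wpM2l ?sqr_ge0// -mulrA -h4 mulrA.
by rewrite ler_wpM2r ?expR_ge0.
Qed.

(** A shift of coordinate [k] by [e] is expanded once inside the Gibbs average and once in the
    Gaussian weight, each time up to [O(e ^ 2)]; dividing by [e] and letting it tend to 0 equates
    the first-order terms. *)
Lemma gaussian_integration_by_parts :
  \int[gam]_y (tnth y k * gav v b f y) =
  \int[gam]_y (gav v b (fun x => f x * v k x) y - gav v b f y * gav v b (v k) y).
Proof.
have [C hC] := gav_shift_taylor.
pose h x := 1 + 4 * expR 2 * expR (2 * `|x : R|).
have ih : intg gam (fun y => h (tnth y k)).
  apply: (@intg_tnth k h); apply: intgD; first exact: intg_cst.
  by apply: intgZ; exact: intg_stdn_expR_norm.
have icov : intg gam cov.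
  apply: (@intg_bnd _ _ _ _ _ (fbnd (fun x => f x * v k x) + fbnd f * fbnd (v k))).
    apply: measurable_funB; first exact: measurable_gav.
    by apply: measurable_funM; exact: measurable_gav.
  move=> y; rewrite (le_trans (ler_normB _ _))// normrM lerD ?ler_pM//;
    apply: gav_bnd => x; exact: fbnd_ge.
have itg := intg_tnth_gav k v b f.
pose B := fbnd f; have B0 : 0 <= B := fbnd_ge0 f.
pose D := C + B * \int[gam]_y h (tnth y k).
have ms e : measurable_fun setT (fun y => gav v b f (tshift (dk e) y)).
  exact: (measurableT_comp (measurable_gav v b f) (measurable_tshift (dk e))).
have is1 e : intg gam (fun y => gav v b f (tshift (dk e) y)).
  by apply: (@intg_bnd _ _ _ _ _ B) => // y; apply: gav_bnd => x; exact: fbnd_ge.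
have ig := intg_gav v b f.
have key e : 0 < e -> e <= 1 ->
    `|\int[gam]_y cov y - \int[gam]_y (tnth y k * gav v b f y)| <= D * e.
  move=> e0 e1; have e01 : 0 <= e <= 1 by rewrite ltW.
  rewrite -(ler_pM2l e0) -{1}(gtr0_norm e0) -normrM.
  have -> : e * (D * e) = D * e ^+ 2 by ring.
  have ie1 : intg gam (fun y => gav v b f y * expR (e * tnth y k - e ^+ 2 / 2)).
    apply: (@intg_dom _ _ _ gam _ (fun y : Y => B * expR (e * tnth y k - e ^+ 2 / 2))).
    - apply: measurable_funM; first exact: measurable_gav.
      apply: measurableT_comp => //; apply: measurable_funB => //.
      by apply: measurable_funM => //; exact: measurable_tnth.
    - apply: intgZ; apply: (@intg_tnth k (fun x => expR (e * x - e ^+ 2 / 2))).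
      apply: (eq_intg (f := fun x => expR (e * x) * expR (- (e ^+ 2 / 2)))).
        by move=> x; rewrite -expRD.
      exact/intgZr/intg_stdn_expR.
    - move=> y; rewrite normrM [`|expR _|]ger0_norm ?expR_ge0// ler_wpM2r ?expR_ge0//.
      by apply: gav_bnd => x; exact: fbnd_ge.
  pose F1 y := gav v b f (tshift (dk e) y) - gav v b f y - e * cov y.
  pose F2 y := gav v b f y * expR (e * tnth y k - e ^+ 2 / 2) - gav v b f y -
     e * (tnth y k * gav v b f y).
  have iF1 : intg gam F1 by apply: intgB; [exact: intgB|exact: intgZ].
  have iF2 : intg gam F2 by apply: intgB; [exact: intgB|exact: intgZ].
  have -> : e * (\int[gam]_y cov y - \int[gam]_y (tnth y k * gav v b f y)) =
     \int[gam]_y F2 y - \int[gam]_y F1 y.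
    have E1 : \int[gam]_y F1 y = \int[gam]_y gav v b f (tshift (dk e) y) -
        \int[gam]_y gav v b f y - e * \int[gam]_y cov y.
      by rewrite /F1 RintB; [rewrite RintB// RintZ|exact: intgB|exact: intgZ].
    have E2 : \int[gam]_y F2 y =
        \int[gam]_y (gav v b f y * expR (e * tnth y k - e ^+ 2 / 2)) -
        \int[gam]_y gav v b f y - e * \int[gam]_y (tnth y k * gav v b f y).
      by rewrite /F2 RintB; [rewrite RintB// RintZ|exact: intgB|exact: intgZ].
    by rewrite E1 E2 Rint_gav_shift; ring.
  apply: (le_trans (ler_normB _ _)); rewrite /D mulrDl addrC; apply: lerD.
    apply: (le_trans (Rint_norm iF1)); rewrite -(Rint_cst gam (C * e ^+ 2)).
    apply: Rint_le; [exact: intg_norm|exact: intg_cst|].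
    by move=> y; exact: hC.
  apply: (le_trans (Rint_norm iF2)); rewrite mulrAC -RintZ//.
  apply: Rint_le; [exact: intg_norm|exact: intgZ|].
  move=> y; rewrite /F2.
  have -> : gav v b f y * expR (e * tnth y k - e ^+ 2 / 2) - gav v b f y -
     e * (tnth y k * gav v b f y) =
     gav v b f y * (expR (e * tnth y k - e ^+ 2 / 2) - 1 - e * tnth y k) by ring.
  rewrite normrM -[leRHS]mulrA; apply: ler_pM => //.
    by apply: gav_bnd => x; exact: fbnd_ge.
  exact: expR_gaussian_taylor.
apply/esym/eqP; rewrite -subr_eq0 -normr_eq0 eq_le normr_ge0 andbT.
apply/ler_addgt0Pr => eta eta0; rewrite add0r.
have D1 : 0 < `|D| + 1 by rewrite ltr_pwDr.
pose e := Num.min 1 (eta / (`|D| + 1)).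
have e0 : 0 < e by rewrite lt_min ltr01 divr_gt0.
have e1 : e <= 1 by rewrite ge_min lexx.
apply: (le_trans (key e e0 e1)).
apply: (@le_trans _ _ ((`|D| + 1) * e)).
  by rewrite ler_wpM2r ?(ltW e0)// (le_trans (ler_norm _))// lerDl.
by rewrite mulrC -ler_pdivlMr// ge_min lexx orbT.
Qed.

End integration_by_parts.

Definition free v b := \int[gam]_y ln (part v b y).

(** Convexity of the log-partition function: Jensen's inequality under the Gibbs measure at the
    endpoint bounds the increment by the average increment of [ham], whose Gaussian part is
    integrated by parts. *)
Lemma free_step v b v' b' :
  free v' b' - free v b <= \int[gam]_y (\sum_(k < m)
    (gav v' b' (fun x => (v' k x - v k x) * v' k x) y -
     gav v' b' (fun x => v' k x - v k x) y * gav v' b' (v' k) y) +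
    gav v' b' (fun x => b' x - b x) y).
Proof.
pose D k x := v' k x - v k x.
pose T k y := gav v' b' (fun x => D k x * v' k x) y - gav v' b' (D k) y * gav v' b' (v' k) y.
have iT k : intg gam (T k).
  apply: intgB; first exact: intg_gav.
  apply: (@intg_bnd _ _ _ _ _ (fbnd (D k) * fbnd (v' k))).
    by apply: measurable_funM; exact: measurable_gav.
  by move=> y; rewrite normrM ler_pM//; apply: gav_bnd => x; exact: fbnd_ge.
have iS : intg gam (fun y => \sum_(k < m) tnth y k * gav v' b' (D k) y).
  by apply: intg_sum => k _; exact: intg_tnth_gav.
rewrite [leRHS](_ : _ = \int[gam]_y (\sum_(k < m) tnth y k * gav v' b' (D k) y +
    gav v' b' (fun x => b' x - b x) y)); last first.
  rewrite [LHS]RintD; [|by apply: intg_sum => k _; exact: iT|exact: intg_gav].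
  rewrite [RHS]RintD//; last exact: intg_gav.
  congr (_ + _); rewrite [LHS]Rint_sum; last by move=> k _; exact: iT.
  rewrite [RHS]Rint_sum; last by move=> k _; exact: intg_tnth_gav.
  by apply: eq_bigr => k _; rewrite gaussian_integration_by_parts.
rewrite /free -RintB; [|exact: intg_ln_part|exact: intg_ln_part].
apply: Rint_le.
- by apply: intgB; exact: intg_ln_part.
- by apply: intgD => //; exact: intg_gav.
- move=> y; set E := (X in _ <= X).
  have -> : E = gav v' b' (fun x => ham v' b' y x - ham v b y x) y.
    rewrite /E (eq_bigr (fun k => gav v' b' (fun x => tnth y k * D k x) y)); last first.
      by move=> k _; rewrite gavZ.
    rewrite -gav_sum -gavD; apply: eq_gav => x.
    rewrite /ham /D opprD addrACA; congr (_ + _).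
    by rewrite -sumrB; apply: eq_bigr => k _; ring.
  have := gav_jensen v' b' (fun x => ham v b y x - ham v' b' y x) y.
  have -> : gav v' b' (fun x => expR (ham v b y x - ham v' b' y x)) y =
      part v b y / part v' b' y.
    rewrite /part mulr_suml; apply: eq_bigr => x _.
    rewrite /pgb expRB; have := expR_gt0 (ham v' b' y x); set e' := expR _ => e0.
    have Z0 : part v' b' y != 0 by rewrite gt_eqF// part_gt0.
    rewrite -/(part v' b' y); field.
    by rewrite Z0 gt_eqF.
  rewrite -ler_ln ?posrE ?expR_gt0 ?divr_gt0 ?part_gt0//.
  rewrite expRK ln_div ?posrE ?part_gt0//.
  rewrite !gavB; lra.
Qed.

End finite_gibbs.

(** * Interpolation along square-root paths and replica overlaps *)

Section interpolation.
Context {R : realType}.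

(* The sum of the squared increments of [sqrt] over a regular subdivision is
   bounded by the largest increment, hence negligible. *)
Lemma sqrt_path_le (phi : R -> R) (c K : R) : 0 <= K ->
  (forall t t', 0 <= t -> t <= t' -> t' <= 1 ->
    phi t' - phi t <= (t' - t) * c + K * ((Num.sqrt t' - Num.sqrt t) ^+ 2 +
      (Num.sqrt (1 - t') - Num.sqrt (1 - t)) ^+ 2)) ->
  phi 1 - phi 0 <= c.
Proof.
move=> K0 h.
have sq (x y : R) : 0 <= x -> x <= y -> Num.sqrt y - Num.sqrt x <= Num.sqrt (y - x).
  move=> x0 xy; rewrite lerBlDr -(@ler_pXn2r _ 2)// ?nnegrE ?addr_ge0 ?sqrtr_ge0//.
  rewrite sqrrD !sqr_sqrtr ?subr_ge0//; last exact: le_trans xy.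
  have := mulr_ge0 (sqrtr_ge0 (y - x)) (sqrtr_ge0 x); rewrite mulr2n; lra.
have main N : (0 < N)%N -> phi 1 - phi 0 <= c + 2 * K * Num.sqrt (N%:R^-1).
  move=> N0; set d := Num.sqrt _.
  have Np : 0 < N%:R :> R by rewrite ltr0n.
  have d0 : 0 <= d by exact: sqrtr_ge0.
  (* The last factor is the variation of [sqrt t] and [sqrt (1 - t)] accumulated so far; it reaches
     2 at time 1. *)
  have step i : (i <= N)%N -> phi (i%:R / N%:R) - phi 0 <= i%:R / N%:R * c +
      K * d * (Num.sqrt (i%:R / N%:R) + (1 - Num.sqrt (1 - i%:R / N%:R))).
    elim: i => [_|i ih iN].
      by rewrite mul0r subr0 subrr sqrtr0 sqrtr1 mul0r subrr addr0 mulr0 addr0.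
    have {}ih := ih (ltnW iN).
    set t := i%:R / N%:R in ih *; set t' := i.+1%:R / N%:R.
    have t0 : 0 <= t by rewrite divr_ge0.
    have tt : t' - t = N%:R^-1 by rewrite /t' /t -mulrBl -natrB// subSnn mul1r.
    have tt' : t <= t' by rewrite -subr_ge0 tt invr_ge0 ltW.
    have t'1 : t' <= 1 by rewrite ler_pdivrMr// mul1r ler_nat.
    have hs := h t t' t0 tt' t'1.
    have a1 : 0 <= Num.sqrt t' - Num.sqrt t by rewrite subr_ge0 ler_wsqrtr.
    have a2 : Num.sqrt t' - Num.sqrt t <= d by rewrite /d -tt sq.
    have b1 : 0 <= Num.sqrt (1 - t) - Num.sqrt (1 - t').
      by rewrite subr_ge0 ler_wsqrtr// lerD2l lerN2.
    have b2 : Num.sqrt (1 - t) - Num.sqrt (1 - t') <= d.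
      rewrite /d -tt (_ : t' - t = (1 - t) - (1 - t')); last by ring.
      by apply: sq; [rewrite subr_ge0|rewrite lerD2l lerN2].
    have c1 : (Num.sqrt t' - Num.sqrt t) ^+ 2 + (Num.sqrt (1 - t') - Num.sqrt (1 - t)) ^+ 2 <=
       d * ((Num.sqrt t' - Num.sqrt t) + (Num.sqrt (1 - t) - Num.sqrt (1 - t'))) by nra.
    have := ler_wpM2l K0 c1; rewrite mulrA; nra.
  have := step N (leqnn N); rewrite divff ?gt_eqF// subrr sqrtr0 sqrtr1 mul1r; lra.
apply/ler_addgt0Pr => e e0.
have K1 : 0 < 2 * K + 1 by lra.
have [N hN] : exists N, (0 < N)%N /\ Num.sqrt (N%:R^-1) <= e / (2 * K + 1).
  pose x := e / (2 * K + 1); have x0 : 0 < x by rewrite divr_gt0.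
  exists (Num.truncn (x ^- 2)).+1; split=> //.
  rewrite -[leRHS](ger0_norm (ltW x0)) -sqrtr_sqr ler_wsqrtr//.
  rewrite -[leRHS]invrK lef_pV2 ?posrE ?invr_gt0 ?exprn_gt0//.
  by rewrite ltW// truncnS_gt.
have [N0 hd] := hN; apply: (le_trans (main N N0)); rewrite lerD2l.
have := sqrtr_ge0 (N%:R^-1 : R); move: hd; rewrite ler_pdivlMr//; nra.
Qed.

Section free_interpolation.
Variables (G : finType) (a : G -> R) (m : nat).
Hypotheses (a0 : forall x, 0 <= a x) (a1 : \sum_x a x = 1).
Variables (E : pred 'I_m) (w : 'I_m -> G -> R) (A B : G -> R).

Definition wav (p : G -> R) (f : G -> R) := \sum_x f x * p x.

(** At time [t] the intensities are scaled by [t] for the coordinates in [E] and by [1 - t] for the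
    others, hence the square roots on amplitudes; the fields [A] and [B] are interpolated
    linearly. *)
Definition vint (t : R) (k : 'I_m) (x : G) : R :=
  (if E k then Num.sqrt t else Num.sqrt (1 - t)) * w k x.
Definition bint (t : R) (x : G) : R := t * A x + (1 - t) * B x.

Definition wvar (p : G -> R) (f : G -> R) := wav p (fun x => f x ^+ 2) - wav p f ^+ 2.

(** The bracket bounded by [c] is twice the time derivative of the free energy: integration by parts
    yields half the Gibbs variance of each coordinate, with the sign of the derivative of its
    intensity. *)
Lemma free_interpolation (c : R) :
  (forall p, (forall x, 0 <= p x) -> \sum_x p x = 1 ->
    \sum_(k | E k) wvar p (w k) - \sum_(k | ~~ E k) wvar p (w k) +
    2 * wav p (fun x => A x - B x) <= c) ->
  free a (vint 1) (bint 1) <= free a (vint 0) (bint 0) + c / 2.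
Proof.
move=> hc; rewrite -lerBlDl.
pose K := \sum_k fbnd (fun x => w k x ^+ 2).
have K0 : 0 <= K by apply: sumr_ge0 => k _; exact: fbnd_ge0.
apply: (@sqrt_path_le (fun t => free a (vint t) (bint t)) _ K K0) => t t' t0 tt' t'1.
have t'0 : 0 <= t' := le_trans t0 tt'.
have t1 : t <= 1 := le_trans tt' t'1.
apply: (le_trans (free_step a0 a1 _ _ _ _)).
set v' := vint t'; set b' := bint t'.
pose c1 k (u : R) := if E k then Num.sqrt u else Num.sqrt (1 - u).
have gz (C : R) f y : gav a v' b' (fun x => C * f x) y = C * gav a v' b' f y.
  exact: gavZ.
set S := (X in K * X).
rewrite -(Rint_cst (iprod (stdn R) m) (_ + _)); apply: Rint_le.
- apply: intgD; last exact: intg_gav.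
  apply: intg_sum => k _; apply: intgB; first exact: intg_gav.
  apply: (@intg_bnd _ _ _ _ _ (fbnd (fun x => v' k x - vint t k x) * fbnd (v' k))).
    by apply: measurable_funM; exact: measurable_gav.
  by move=> y; rewrite normrM ler_pM//; apply: gav_bnd => // x; exact: fbnd_ge.
- exact: intg_cst.
- move=> y; pose p := pgb a v' b' y.
  have p0 x : 0 <= p x by exact: pgb_ge0.
  have p1 : \sum_x p x = 1 by exact: pgb_sum.
  have wvar0 f : 0 <= wvar p f.
    have : 0 <= \sum_x (f x - wav p f) ^+ 2 * p x.
      by apply: sumr_ge0 => x _; rewrite mulr_ge0 ?sqr_ge0.
    rewrite (_ : \sum_x _ = wvar p f)// /wvar.
    transitivity (\sum_x (f x ^+ 2 * p x - 2 * wav p f * (f x * p x) + wav p f ^+ 2 * p x)).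
      by apply: eq_bigr => x _; ring.
    by rewrite big_split sumrB/= -!mulr_sumr p1 -/(wav p f) -/(wav p _); ring.
  have wvarK k : wvar p (w k) <= fbnd (fun x => w k x ^+ 2).
    rewrite /wvar lerBlDr; apply: (@le_trans _ _ (fbnd (fun x => w k x ^+ 2))).
      rewrite -[leRHS]mulr1 -p1 mulr_sumr; apply: ler_sum => x _.
      by rewrite ler_wpM2r// (le_trans (ler_norm _))// (fbnd_ge (fun x => w k x ^+ 2)).
    by rewrite lerDl sqr_ge0.
  have e1 k : gav a v' b' (fun x => (v' k x - vint t k x) * v' k x) y -
     gav a v' b' (fun x => v' k x - vint t k x) y * gav a v' b' (v' k) y =
     (c1 k t' - c1 k t) * c1 k t' * wvar p (w k).
    rewrite (eq_gav _ _ _ _ (g := fun x => (c1 k t' - c1 k t) * c1 k t' * (w k x ^+ 2))); last first.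
      by move=> x; rewrite /v' /vint -/(c1 k t) -/(c1 k t'); ring.
    rewrite (eq_gav _ _ _ _ (f := fun x => v' k x - vint t k x)
      (g := fun x => (c1 k t' - c1 k t) * w k x)); last first.
      by move=> x; rewrite /v' /vint -/(c1 k t) -/(c1 k t'); ring.
    rewrite (eq_gav _ _ _ _ (f := v' k) (g := fun x => c1 k t' * w k x))//.
    by rewrite !gz /wvar /wav /p -!/(gav _ _ _ _ _); ring.
  under eq_bigr do rewrite e1.
  have e2 : gav a v' b' (fun x => b' x - bint t x) y = (t' - t) * wav p (fun x => A x - B x).
    rewrite -/(gav a v' b' (fun x => A x - B x) y) -gz; apply: eq_gav => x.
    by rewrite /b' /bint; ring.
  rewrite e2.
  pose dl k := (c1 k t' - c1 k t) ^+ 2.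
  (* For old and new amplitudes [a] and [a'], [(a' - a) * a' = (a' ^ 2 - a ^ 2) / 2 + (a' - a) ^ 2 /
     2]: a term linear in time, and the error that [sqrt_path_le] makes vanish. *)
  have e3 k : (c1 k t' - c1 k t) * c1 k t' * wvar p (w k) =
     (t' - t) / 2 * ((if E k then 1 else -1) * wvar p (w k)) + dl k / 2 * wvar p (w k).
    rewrite /dl /c1; case: (E k).
      have h1 := sqr_sqrtr t0; have h2 := sqr_sqrtr t'0.
      have -> : t' - t = Num.sqrt t' ^+ 2 - Num.sqrt t ^+ 2 by rewrite h1 h2.
      by field.
    have h1 : Num.sqrt (1 - t) ^+ 2 = 1 - t by rewrite sqr_sqrtr ?subr_ge0.
    have h2 : Num.sqrt (1 - t') ^+ 2 = 1 - t' by rewrite sqr_sqrtr ?subr_ge0.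
    have -> : t' - t = Num.sqrt (1 - t) ^+ 2 - Num.sqrt (1 - t') ^+ 2.
      by rewrite h1 h2; ring.
    by field.
  under eq_bigr do rewrite e3.
  rewrite big_split/= -mulr_sumr addrAC.
  have e4 : \sum_k (if E k then 1 else -1) * wvar p (w k) =
     \sum_(k | E k) wvar p (w k) - \sum_(k | ~~ E k) wvar p (w k).
    rewrite (bigID E)/=; congr (_ + _).
      by apply: eq_bigr => k ->; rewrite mul1r.
    by rewrite -sumrN; apply: eq_bigr => k /negbTE ->; rewrite mulN1r.
  rewrite e4; apply: lerD.
    have := hc p p0 p1; set X := _ - _; set Z := wav _ _ => hh.
    have : 0 <= t' - t by rewrite subr_ge0.
    by nra.
  rewrite /K mulr_suml; apply: ler_sum => k _.
  rewrite mulrC; apply: ler_pM => //.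
    by rewrite divr_ge0// sqr_ge0.
  rewrite /S /dl /c1; have := sqr_ge0 (Num.sqrt t' - Num.sqrt t).
  have := sqr_ge0 (Num.sqrt (1 - t') - Num.sqrt (1 - t)).
  by case: (E k) => h1 h2; lra.
Qed.

End free_interpolation.

Section replicas.
Variables (G : finType) (p : G -> R) (n : nat).
Hypotheses (p0 : forall x, 0 <= p x) (p1 : \sum_x p x = 1).
Variables (s : 'I_n -> G -> R).

Lemma wavZ c f : wav p (fun x => c * f x) = c * wav p f.
Proof. by rewrite /wav mulr_sumr; apply: eq_bigr => x _; rewrite mulrA. Qed.

Lemma wavD f g : wav p (fun x => f x + g x) = wav p f + wav p g.
Proof. by rewrite /wav -big_split; apply: eq_bigr => x _; rewrite mulrDl. Qed.

Lemma wav_sum (I : finType) (P : pred I) (f : I -> G -> R) :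
  wav p (fun x => \sum_(i | P i) f i x) = \sum_(i | P i) wav p (f i).
Proof.
by rewrite /wav exchange_big; apply: eq_bigr => x _; rewrite mulr_suml.
Qed.

Lemma wav_cst c : wav p (fun=> c) = c.
Proof. by rewrite /wav -mulr_sumr p1 mulr1. Qed.

Lemma eq_wav f g : f =1 g -> wav p f = wav p g.
Proof. by move=> fg; apply: eq_bigr => x _; rewrite fg. Qed.

Lemma wav_le f g : (forall x, f x <= g x) -> wav p f <= wav p g.
Proof. by move=> fg; apply: ler_sum => x _; rewrite ler_wpM2r. Qed.

Lemma wav_sqr_le f : wav p f ^+ 2 <= wav p (fun x => f x ^+ 2).
Proof.
have : 0 <= wav p (fun x => (f x - wav p f) ^+ 2).
  by apply: sumr_ge0 => x _; rewrite mulr_ge0 ?sqr_ge0.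
rewrite (eq_wav (g := fun x => f x ^+ 2 + (- 2 * wav p f * f x + wav p f ^+ 2))); last first.
  by move=> x; ring.
rewrite wavD wavD wavZ wav_cst; lra.
Qed.

(* Two replicas [x, x'] drawn from [p]: this is the mean of
   [(\sum_i s i x * s i x' - n * r x * r x') ^+ 2]. *)
Lemma replica_ge0 (r : G -> R) :
  0 <= \sum_i \sum_j wav p (fun x => s i x * s j x) ^+ 2 -
       2 * n%:R * \sum_i wav p (fun x => r x * s i x) ^+ 2 +
       n%:R ^+ 2 * wav p (fun x => r x ^+ 2) ^+ 2.
Proof.
have sqE f : wav p f ^+ 2 = \sum_x \sum_x' f x * f x' * (p x * p x').
  rewrite expr2 {1}/wav mulr_suml; apply: eq_bigr => x _.
  by rewrite /wav mulr_sumr; apply: eq_bigr => x' _; ring.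
have -> : \sum_i \sum_j wav p (fun x => s i x * s j x) ^+ 2 =
    \sum_x \sum_x' (\sum_i s i x * s i x') ^+ 2 * (p x * p x').
  under eq_bigr => i _ do (under eq_bigr => j _ do rewrite sqE).
  transitivity (\sum_x \sum_x' \sum_i \sum_j
      (s i x * s j x * (s i x' * s j x') * (p x * p x'))).
    under eq_bigr => i _ do rewrite exchange_big/=.
    rewrite exchange_big/=; apply: eq_bigr => x _.
    under eq_bigr => i _ do rewrite exchange_big/=.
    by rewrite exchange_big.
  apply: eq_bigr => x _; apply: eq_bigr => x' _.
  rewrite expr2 !mulr_suml; apply: eq_bigr => i _.
  rewrite mulr_sumr mulr_suml; apply: eq_bigr => j _; ring.
have -> : \sum_i wav p (fun x => r x * s i x) ^+ 2 =
    \sum_x \sum_x' (r x * r x') * (\sum_i s i x * s i x') * (p x * p x').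
  under eq_bigr => i _ do rewrite sqE.
  rewrite exchange_big/=; apply: eq_bigr => x _.
  rewrite exchange_big/=; apply: eq_bigr => x' _.
  by rewrite mulr_sumr mulr_suml; apply: eq_bigr => i _; ring.
rewrite sqE !mulr_sumr -sumrB -big_split/=; apply: sumr_ge0 => x _.
rewrite !mulr_sumr -sumrB -big_split/=; apply: sumr_ge0 => x' _.
set z := \sum_i _.
have -> : z ^+ 2 * (p x * p x') - 2 * n%:R * (r x * r x' * z * (p x * p x')) +
   n%:R ^+ 2 * (r x ^+ 2 * r x' ^+ 2 * (p x * p x')) =
   (z - n%:R * r x * r x') ^+ 2 * (p x * p x') by ring.
by rewrite mulr_ge0 ?sqr_ge0// mulr_ge0.
Qed.

End replicas.

Lemma sum_edge n (F : 'I_n -> 'I_n -> R) : (forall i j, F i j = F j i) ->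
  \sum_(k < #|edge n|) F (val (enum_val k)).1 (val (enum_val k)).2 =
  (\sum_i \sum_j F i j - \sum_i F i i) / 2.
Proof.
move=> Fs.
rewrite -(big_enum_val (fun e : edge n => F (val e).1 (val e).2))/=.
have -> : \sum_(e in {: edge n}) F (val e).1 (val e).2 =
    \sum_(q : 'I_n * 'I_n | (q.1 < q.2)%N) F q.1 q.2.
  rewrite [RHS](reindex_omap (val : edge n -> _) insub); last first.
    by move=> q hq; rewrite insubT.
  apply: eq_bigl => e; rewrite valK eqxx andbT; apply/esym; exact: (valP e).
rewrite -(pair_big_dep xpredT (fun i j : 'I_n => (i < j)%N) F)/=.
have e1 : \sum_(i < n) \sum_(j < n | (j < i)%N) F i j = \sum_(i < n) \sum_(j < n | (i < j)%N) F i j.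
  rewrite (exchange_big_dep xpredT)//=; apply: eq_bigr => i _.
  by apply: eq_bigr => j _.
have e2 : \sum_i \sum_j F i j = \sum_(i < n) \sum_(j < n | (i < j)%N) F i j +
    (\sum_i F i i + \sum_(i < n) \sum_(j < n | (j < i)%N) F i j).
  rewrite -!big_split/=; apply: eq_bigr => i _.
  rewrite (bigID (fun j : 'I_n => (i < j)%N))/=; congr (_ + _).
  rewrite (bigD1 i)/= ?ltnn//; congr (_ + _); apply: eq_bigl => j.
  by rewrite -leqNgt ltn_neqAle andbC.
by rewrite e2 e1; field.
Qed.

End interpolation.

(** * Upper bound: interpolation for a fixed planted signal *)

Section planted.
Context {R : realType} (n : nat) (T : finType) (p : T -> R) (sv : T -> R).
Hypotheses (n0 : (0 < n)%N) (p0 : forall t, 0 <= p t) (p1 : \sum_t p t = 1).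
Variables (lam B delta : R).
Hypotheses (lam0 : 0 <= lam) (svB : forall t, `|sv t| <= B).

Local Notation G := {ffun 'I_n -> T}.
Local Notation ne := #|edge n|.

Definition pn (x : G) : R := \prod_i p (x i).
Definition sg (x : G) (i : 'I_n) : R := sv (x i).
Definition eu (k : 'I_ne) (x : 'I_n -> R) : R :=
  x (val (enum_val k)).1 * x (val (enum_val k)).2.

Lemma pn_ge0 x : 0 <= pn x.
Proof. by apply: prodr_ge0 => i _. Qed.

Lemma pn_sum : \sum_x pn x = 1.
Proof.
rewrite -(bigA_distr_bigA (fun (_ : 'I_n) t => p t)).
by rewrite big1.
Qed.

Let np : 0 < n%:R :> R. Proof. by rewrite ltr0n. Qed.
Let nn0 : n%:R != 0 :> R. Proof. by rewrite gt_eqF. Qed.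

(* Both overlap terms of the derivative are handled at once: only the squares
   of the overlap of two replicas with [r x * r x'] remain. *)
Lemma edge_vertex_le (pi : G -> R) (r : G -> R) :
  (forall x, 0 <= pi x) -> \sum_x pi x = 1 ->
  lam * \sum_i wav pi (fun x => r x * sg x i) ^+ 2
    - lam / n%:R * \sum_(k < ne) wav pi (fun x => eu k (sg x)) ^+ 2
  <= lam * n%:R / 2 * wav pi (fun x => r x ^+ 2) ^+ 2 + lam * B ^+ 4 / 2.
Proof.
move=> pi0 pi1.
pose F i j := wav pi (fun x => sg x i * sg x j) ^+ 2.
have FC i j : F i j = F j i.
  by rewrite /F; congr (_ ^+ 2); apply: eq_wav => x; rewrite mulrC.
have -> : \sum_(k < ne) wav pi (fun x => eu k (sg x)) ^+ 2 =
    (\sum_i \sum_j F i j - \sum_i F i i) / 2 by rewrite -(sum_edge FC).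
have hr := replica_ge0 pi0 (fun i x => sg x i) r.
rewrite -/(F _ _) in hr.
have hd : \sum_i F i i <= n%:R * B ^+ 4.
  rewrite -[n in leRHS]card_ord mulr_natl -sumr_const; apply: ler_sum => i _.
  have h1 : wav pi (fun x => sg x i * sg x i) <= B ^+ 2.
    rewrite -[leRHS](wav_cst pi1); apply: wav_le => // x.
    by rewrite -expr2 -[leLHS]ger0_norm ?sqr_ge0// normrX lerXn2r ?nnegrE ?(le_trans _ (svB (x i))).
  have h2 : 0 <= wav pi (fun x => sg x i * sg x i).
    by apply: sumr_ge0 => x _; rewrite mulr_ge0// -expr2 sqr_ge0.
  by rewrite /F (_ : B ^+ 4 = (B ^+ 2) ^+ 2) ?lerXn2r ?nnegrE ?sqr_ge0// -exprM.
set X := \sum_i \sum_j _ in hr *; set Y := \sum_i wav _ _ ^+ 2 in hr *.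
set D := \sum_i F i i in hd *; set W := wav _ _ ^+ 2 in hr *.
have ln : 0 <= lam / n%:R by rewrite divr_ge0// ltW.
have h1 := mulr_ge0 ln hr; have h2 := ler_wpM2l ln hd.
have e1 : lam / n%:R * (X - 2 * n%:R * Y + n%:R ^+ 2 * W) =
  lam / n%:R * X - 2 * lam * Y + lam * n%:R * W by field.
have e2 : lam / n%:R * (n%:R * B ^+ 4) = lam * B ^+ 4 by field.
rewrite e1 in h1; rewrite e2 in h2.
have -> : lam / n%:R * ((X - D) / 2) = (lam / n%:R * X - lam / n%:R * D) / 2 by ring.
lra.
Qed.

Variables (xs : 'I_n -> R) (r : G -> R).
Hypothesis xsB : forall i, `|xs i| <= B.
(** The scalar channels have amplitude [r x], of intensity [r x ^ 2], while their drift towards [xs]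
    has to match an overlap of either sign. *)
Let mm x := r x * `|r x|.
Hypothesis mmE : forall x, `|mm x - (\sum_i sg x i * xs i) / n%:R| <= delta.

Definition isedge (k : 'I_(ne + n)) : bool := if fintype.split k is inl _ then true else false.
Definition pcoef (k : 'I_(ne + n)) (x : G) : R :=
  match fintype.split k with
  | inl e => Num.sqrt (lam / n%:R) * eu e (sg x)
  | inr i => Num.sqrt lam * (r x * sg x i)
  end.
(** The fields at the two ends when the data come from [xs]: the quadratic terms are those of the
    likelihood ratios, the products with [xs] are the planted drift. The last term of [pB] is [n]
    times the quadratic term of the potential at [q = r x ^ 2]. *)
Definition pA (x : G) : R :=
  \sum_(k < ne) (lam / n%:R * (eu k (sg x) * eu k xs - eu k (sg x) ^+ 2 / 2)).
Definition pB (x : G) : R :=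
  \sum_i lam * (r x * `|r x| * sg x i * xs i - r x ^+ 2 * sg x i ^+ 2 / 2) -
  n%:R * lam * (r x * `|r x|) ^+ 2 / 4.

Lemma split_lshiftE (k : 'I_ne) : fintype.split (lshift n k) = inl k.
Proof. exact: (unsplitK (inl k)). Qed.
Lemma split_rshiftE (k : 'I_n) : fintype.split (rshift ne k) = inr k :> 'I_ne + 'I_n.
Proof. exact: (unsplitK (inr k)). Qed.

(** The second moments in the variances cancel the quadratic terms of the fields. Besides the
    difference bounded by [edge_vertex_le], there remains [lam * n] times the mean squared gap
    between overlap and [r * |r|], and minus [lam * n / 2] times the mean of [r ^ 4], which by
    Cauchy-Schwarz absorbs the main term of that bound. *)
Lemma planted_bracket (pi : G -> R) :
  (forall x, 0 <= pi x) -> \sum_x pi x = 1 ->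
  \sum_(k | isedge k) wvar pi (pcoef k) - \sum_(k | ~~ isedge k) wvar pi (pcoef k) +
    2 * wav pi (fun x => pA x - pB x) <= lam * n%:R * delta ^+ 2 + lam * B ^+ 4 / 2.
Proof.
move=> pi0 pi1.
have wN f : wav pi (fun x => - f x) = - wav pi f.
  by rewrite -mulN1r -wavZ; apply: eq_wav => x; rewrite mulN1r.
have e1 : \sum_(k | isedge k) wvar pi (pcoef k) = lam / n%:R *
    \sum_(k < ne) (wav pi (fun x => eu k (sg x) ^+ 2) - wav pi (fun x => eu k (sg x)) ^+ 2).
  rewrite big_split_ord/= [X in _ + X]big_pred0 ?addr0; last first.
    by move=> i; rewrite /isedge split_rshiftE.
  rewrite mulr_sumr; apply: eq_big => [k|k _]; first by rewrite /isedge split_lshiftE.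
  rewrite /wvar /pcoef split_lshiftE wavZ exprMn sqr_sqrtr ?divr_ge0// ?ltW//.
  rewrite mulrBr -wavZ; congr (_ - _); apply: eq_wav => x.
  by rewrite exprMn sqr_sqrtr ?divr_ge0// ?ltW.
have e2 : \sum_(k | ~~ isedge k) wvar pi (pcoef k) = lam *
    \sum_i (wav pi (fun x => r x ^+ 2 * sg x i ^+ 2) - wav pi (fun x => r x * sg x i) ^+ 2).
  rewrite big_split_ord/= [X in X + _]big_pred0 ?add0r; last first.
    by move=> i; rewrite /isedge split_lshiftE.
  rewrite mulr_sumr; apply: eq_big => [k|k _]; first by rewrite /isedge split_rshiftE.
  rewrite /wvar /pcoef split_rshiftE wavZ exprMn sqr_sqrtr//.
  rewrite mulrBr -wavZ; congr (_ - _); apply: eq_wav => x.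
  by rewrite !exprMn sqr_sqrtr.
have e3 : wav pi (fun x => pA x - pB x) = lam / n%:R *
    \sum_(k < ne) (eu k xs * wav pi (fun x => eu k (sg x)) - wav pi (fun x => eu k (sg x) ^+ 2) / 2) -
    (lam * \sum_i (xs i * wav pi (fun x => mm x * sg x i) -
       wav pi (fun x => r x ^+ 2 * sg x i ^+ 2) / 2) - n%:R * lam / 4 * wav pi (fun x => mm x ^+ 2)).
  rewrite wavD wN; congr (_ - _).
    rewrite wav_sum mulr_sumr; apply: eq_bigr => k _.
    rewrite wavZ; congr (_ * _); rewrite wavD wN -wavZ; congr (_ - _).
      by apply: eq_wav => x; rewrite mulrC.
    by rewrite [RHS]mulrC -wavZ; apply: eq_wav => x; rewrite mulrC.
  rewrite wavD wN; congr (_ - _); last first.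
    by rewrite -wavZ; apply: eq_wav => x; rewrite /mm; field.
  rewrite wav_sum mulr_sumr; apply: eq_bigr => k _.
  rewrite wavZ; congr (_ * _); rewrite wavD wN -wavZ; congr (_ - _).
    by apply: eq_wav => x; rewrite /mm; ring.
  by rewrite [RHS]mulrC -wavZ; apply: eq_wav => x; rewrite mulrC.
pose ov x := (\sum_i sg x i * xs i) / n%:R.
pose H i j := xs i * xs j * wav pi (fun x => sg x i * sg x j).
have HC i j : H i j = H j i.
  by rewrite /H (mulrC (xs i)); congr (_ * _); apply: eq_wav => x; rewrite mulrC.
have e4 : \sum_(k < ne) eu k xs * wav pi (fun x => eu k (sg x)) =
    (n%:R ^+ 2 * wav pi (fun x => ov x ^+ 2) - \sum_i H i i) / 2.
  rewrite (sum_edge HC); congr ((_ - _) / 2).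
  transitivity (wav pi (fun x => (\sum_i sg x i * xs i) ^+ 2)).
    under eq_bigr => i _ do (under eq_bigr => j _ do rewrite /H -wavZ).
    under eq_bigr => i _ do rewrite -wav_sum.
    rewrite -wav_sum; apply: eq_wav => x.
    rewrite expr2 mulr_suml; apply: eq_bigr => i _.
    by rewrite mulr_sumr; apply: eq_bigr => j _; ring.
  by rewrite -wavZ; apply: eq_wav => x; rewrite /ov; field.
(* The diagonal of the planted overlap enters with a favourable sign and is dropped. *)
have H0 : 0 <= \sum_i H i i.
  apply: sumr_ge0 => i _; rewrite mulr_ge0 -?expr2 ?sqr_ge0//.
  by apply: sumr_ge0 => x _; rewrite mulr_ge0// -expr2 sqr_ge0.
have e5 : \sum_i xs i * wav pi (fun x => mm x * sg x i) = n%:R * wav pi (fun x => mm x * ov x).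
  rewrite -wavZ; under eq_bigr => i _ do rewrite -wavZ.
  rewrite -wav_sum; apply: eq_wav => x; rewrite /ov.
  transitivity (mm x * \sum_i sg x i * xs i); last by field.
  by rewrite mulr_sumr; apply: eq_bigr => i _; ring.
have e6 : wav pi (fun x => ov x ^+ 2) - 2 * wav pi (fun x => mm x * ov x) +
    wav pi (fun x => mm x ^+ 2) <= delta ^+ 2.
  rewrite -wavZ -wN -!wavD -[leRHS](wav_cst pi1); apply: wav_le => // x.
  have := mmE x; rewrite -/(ov x) => h.
  have -> : ov x ^+ 2 - 2 * (mm x * ov x) + mm x ^+ 2 = `|mm x - ov x| ^+ 2.
    by rewrite -normrX ger0_norm ?sqr_ge0//; ring.
  by rewrite lerXn2r ?nnegrE// (le_trans _ h).
have e7 := edge_vertex_le r pi0 pi1.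
have e8 : wav pi (fun x => r x ^+ 2) ^+ 2 <= wav pi (fun x => mm x ^+ 2).
  apply: (le_trans (wav_sqr_le pi0 pi1 _)); apply: wav_le => // x.
  have -> : mm x ^+ 2 = r x ^+ 2 * `|r x| ^+ 2 by rewrite /mm exprMn.
  by rewrite -normrX ger0_norm ?sqr_ge0// -expr2.
rewrite e1 e2 e3 !sumrB e4 e5 -!mulr_suml.
set X1 := \sum_(k < ne) wav _ _; set X2 := \sum_(k < ne) _ ^+ 2 in e7 *.
set Y1 := \sum_i wav _ _; set Y2 := \sum_i _ ^+ 2 in e7 *.
set O2 := wav _ _ in e6 *; set MO := wav _ _ in e6 *.
set M2 := wav _ _ in e6 e8 *; set R2 := wav _ _ ^+ 2 in e7 e8 *.
set HH := \sum_i H i i in H0 *.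
have k1 : 0 <= lam / n%:R * HH by rewrite mulr_ge0// divr_ge0// ltW.
have k2 : lam * n%:R * (O2 - 2 * MO + M2) <= lam * n%:R * delta ^+ 2.
  by rewrite ler_wpM2l// mulr_ge0// ltW.
have k3 : lam * n%:R / 2 * R2 <= lam * n%:R / 2 * M2.
  by rewrite ler_wpM2l// divr_ge0// mulr_ge0// ltW.
have e9 : lam / n%:R * ((n%:R ^+ 2 * O2 - HH) / 2 - X1 / 2) =
  (lam * n%:R * O2 - lam / n%:R * HH - lam / n%:R * X1) / 2 by field.
have -> : lam / n%:R * (X1 - X2) - lam * (Y1 - Y2) +
  2 * (lam / n%:R * ((n%:R ^+ 2 * O2 - HH) / 2 - X1 / 2) -
   (lam * (n%:R * MO - Y1 / 2) - n%:R * lam / 4 * M2)) =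
  lam * n%:R * (O2 - 2 * MO + M2) - lam / n%:R * HH +
  (lam * Y2 - lam / n%:R * X2) - lam * n%:R / 2 * M2.
  by rewrite e9; field.
lra.
Qed.

Lemma planted_free_le :
  free pn (fun k => vint isedge pcoef 1 k) (bint pA pB 1) <=
  free pn (fun k => vint isedge pcoef 0 k) (bint pA pB 0) +
    (lam * n%:R * delta ^+ 2 + lam * B ^+ 4 / 2) / 2.
Proof.
apply: free_interpolation; [exact: pn_ge0|exact: pn_sum|exact: planted_bracket].
Qed.

End planted.

(** * Finitely supported priors *)

Section finite_valued.
Context {R : realType} d (S : measurableType d) (mu : probability S R).
Variables (G : finType) (X : S -> G).
Hypothesis mX : forall g, measurable (X @^-1` [set g]).

Let fE (phi : G -> R) s : phi (X s) = \sum_g phi g * \1_(X @^-1` [set g]) s.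
Proof.
rewrite (bigD1 (X s))//= indicE mem_set// mulr1 big1 ?addr0// => g gX.
by rewrite indicE memNset ?mulr0//= => /esym/eqP; rewrite (negbTE gX).
Qed.

Lemma measurable_fin (phi : G -> R) : measurable_fun setT (fun s => phi (X s)).
Proof.
rewrite (_ : (fun s => _) = fun s => \sum_g phi g * \1_(X @^-1` [set g]) s).
  by apply: measurable_sum => g; apply: measurable_funM => //; exact: measurable_indic.
by apply/funext => s; exact: fE.
Qed.

Lemma intg_fin (phi : G -> R) : intg mu (fun s => phi (X s)).
Proof.
apply: (@intg_bnd _ _ _ _ _ (fbnd phi)); first exact: measurable_fin.
by move=> s; exact: fbnd_ge.
Qed.

Lemma Rint_fin (phi : G -> R) :
  \int[mu]_s phi (X s) = \sum_g fine (mu (X @^-1` [set g])) * phi g.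
Proof.
rewrite (eq_Rint _ (fE phi)) Rint_sum; last first.
  move=> g _; apply: intgZ; apply: (@intg_bnd _ _ _ _ _ 1); first exact: measurable_indic.
  by move=> s; rewrite indicE; case: (_ \in _); rewrite ?normr1 ?normr0.
apply: eq_bigr => g _; rewrite RintZ; last first.
  apply: (@intg_bnd _ _ _ _ _ 1); first exact: measurable_indic.
  by move=> s; rewrite indicE; case: (_ \in _); rewrite ?normr1 ?normr0.
by rewrite mulrC /Rintegral integral_indic// setIT.
Qed.

End finite_valued.

Section finite_prior.
Context {R : realType} (P0 : probability R R) (T : finType) (kap : R -> T) (sv : T -> R).
Hypothesis mkap : forall t, measurable (kap @^-1` [set t]).

(** [kap] labels the cells of a finite partition and [sv] gives a value to each. The discretised
    signal [fT] is thus a function of the original one, and the two can be compared in L2; [pT] is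
    the law of the label. *)
Definition pT (t : T) : R := fine (P0 (kap @^-1` [set t])).
Definition fT (x : R) : R := sv (kap x).

Lemma pT_ge0 t : 0 <= pT t. Proof. exact: fine_ge0. Qed.

Lemma pT_sum : \sum_t pT t = 1.
Proof.
have := Rint_fin P0 mkap (fun=> 1); rewrite Rint_cst => ->.
by apply: eq_bigr => t _; rewrite mulr1.
Qed.

Lemma measurable_fT : measurable_fun setT fT.
Proof. exact: (measurable_fin mkap). Qed.

Variable n : nat.
Local Notation G := {ffun 'I_n -> T}.
Definition conf (s : n.-tuple R) : G := [ffun i => kap (tnth s i)].

Lemma conf_pre (x : G) : conf @^-1` [set x] = box (fun i => kap @^-1` [set x i]).
Proof.
apply/seteqP; split => s /=.
  by move=> <- i /=; rewrite ffunE.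
by move=> h; apply/ffunP => i; rewrite ffunE; exact: h.
Qed.

Lemma measurable_conf x : measurable (conf @^-1` [set x]).
Proof. by rewrite conf_pre; apply: measurable_box. Qed.

Lemma iprod_conf x : fine (iprod P0 n (conf @^-1` [set x])) = pn pT x.
Proof.
rewrite conf_pre iprod_box// /pn -[RHS]/(fine (\prod_i pT (x i))%:E) -prodEFin.
by congr fine; apply: eq_bigr => i _; rewrite /pT fineK// fin_num_measure.
Qed.

Lemma Rint_conf (phi : G -> R) :
  \int[iprod P0 n]_s phi (conf s) = \sum_x pn pT x * phi x.
Proof.
rewrite (Rint_fin _ measurable_conf); apply: eq_bigr => x _.
by rewrite iprod_conf.
Qed.

Lemma sg_conf s : sg sv (conf s) = fun i => fT (tnth s i).
Proof. by apply/funext => i; rewrite /sg ffunE. Qed.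

End finite_prior.

Section edge_channel.
Context {R : realType} (n : nat).
Local Notation ne := #|edge n|.

Definition uedge (f : R -> R) (k : 'I_ne) (s : n.-tuple R) : R :=
  eu k (fun i => f (tnth s i)).

Definition Uedge (lam : R) (f : R -> R) (k : 'I_ne) (s : n.-tuple R) : R :=
  Num.sqrt (lam / n%:R) * uedge f k s.

Lemma measurable_uedge (f : R -> R) k : measurable_fun setT f -> measurable_fun setT (uedge f k).
Proof.
move=> mf; apply: measurable_funM; apply: (measurableT_comp mf); exact: measurable_tnth.
Qed.

Lemma edge_neq (k : 'I_ne) : (val (enum_val k)).1 != (val (enum_val k)).2.
Proof. by have := valP (enum_val k); rewrite neq_ltn => ->. Qed.

Lemma Rint_uedge_mul (P0 : probability R R) (g h : R -> R) (k : 'I_ne) :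
  intg P0 g -> intg P0 h ->
  intg (iprod P0 n) (fun s => g (tnth s (val (enum_val k)).1) * h (tnth s (val (enum_val k)).2)) /\
  \int[iprod P0 n]_s (g (tnth s (val (enum_val k)).1) * h (tnth s (val (enum_val k)).2)) =
  (\int[P0]_x g x) * (\int[P0]_x h x).
Proof.
move=> ig ih.
set i := (val _).1; set j := (val _).2.
have ij : i != j := edge_neq k.
have mW : measurable_fun setT (fun s : n.-tuple R => (tnth s i, tnth s j)).
  by apply: measurable_fun_pair; exact: measurable_tnth.
have hW A mA := @law_tnth2 _ P0 _ _ _ A ij mA.
have ii := intg_mul ig ih.
split; first exact: (law_intg mW hW ii).
by rewrite (law_Rint mW hW ii) Rint_mul.
Qed.

Lemma sqint_uedge (P0 : probability R R) (f : R -> R) : measurable_fun setT f ->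
  intg P0 (fun x => f x ^+ 2) -> sqint (iprod P0 n) (uedge f).
Proof.
move=> mf i2 k; split; first exact: measurable_uedge.
have [h _] := Rint_uedge_mul k i2 i2.
by apply: (eq_intg _ h) => s; rewrite /uedge /eu exprMn.
Qed.

Lemma sqint_Uedge (P0 : probability R R) (lam : R) (f : R -> R) : measurable_fun setT f ->
  intg P0 (fun x => f x ^+ 2) -> sqint (iprod P0 n) (Uedge lam f).
Proof. by move=> mf i2; exact: (sqintZ (fun=> _) (sqint_uedge mf i2)). Qed.

End edge_channel.

Section restriction.
Context {R : realType} (a m : nat) (io : 'I_a -> 'I_m).

Definition trestr (y : m.-tuple R) : a.-tuple R := [tuple tnth y (io i) | i < a].

Lemma measurable_trestr : measurable_fun setT trestr.
Proof.
apply/measurable_fun_tnthP => i.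
rewrite (_ : _ \o _ = fun y => tnth y (io i)); first exact: measurable_tnth.
by apply/funext => y /=; rewrite tnth_mktuple.
Qed.

Lemma law_trestr (P : probability R R) A : injective io -> measurable A ->
  iprod P m (trestr @^-1` A) = iprod P a A.
Proof.
move=> io_inj; apply: law_iprod; first exact: measurable_trestr.
move=> B mB.
pose C k := if [pick i | io i == k] is Some i then B i else setT.
have CE i : C (io i) = B i.
  rewrite /C; case: pickP => [j /eqP/io_inj -> //|/(_ i)].
  by rewrite eqxx.
have mC k : measurable (C k) by rewrite /C; case: pickP.
have -> : trestr @^-1` box B = box C.
  apply/seteqP; split => y /= h i.
    rewrite /C; case: pickP => // j /eqP <-; have := h j.
    by rewrite tnth_mktuple.
  by rewrite tnth_mktuple -CE; exact: h.
rewrite iprod_box// (bigID (mem (io @: finset.setT)))/= [X in (_ * X)%E]big1 ?mule1.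
  rewrite big_imset/=; last by move=> i j _ _; exact: io_inj.
  by apply: eq_big => [i|i _]; rewrite ?inE ?CE.
move=> k kio; rewrite /C; case: pickP => [i /eqP ik|_].
  by move: kio; rewrite -ik imset_f.
exact: probability_setT.
Qed.

End restriction.

Section planted_info.
Context {R : realType} (P0 : probability R R) (T : finType) (kap : R -> T) (sv : T -> R).
Hypothesis mkap : forall t, measurable (kap @^-1` [set t]).
Variables (n : nat) (lam : R).
Hypotheses (n0 : (0 < n)%N) (lam0 : 0 <= lam).
Local Notation ne := #|edge n|.
Local Notation f := (fT kap sv).
Local Notation p := (pT P0 kap).
Local Notation gam m := (iprod (stdn R) m).

Let mf := measurable_fT sv mkap.

Lemma intg_fT_sqr : intg P0 (fun x => f x ^+ 2).
Proof. exact: (intg_fin P0 mkap (fun t => sv t ^+ 2)). Qed.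

Lemma dens_edge (y : ne.-tuple R) : dens (iprod P0 n) (Uedge lam f) y =
  \sum_x pn p x * expR (\sum_(k < ne) (Num.sqrt (lam / n%:R) * eu k (sg sv x) * tnth y k -
     (Num.sqrt (lam / n%:R) * eu k (sg sv x)) ^+ 2 / 2)).
Proof.
rewrite -(Rint_conf P0 mkap); apply: eq_Rint => s; congr expR.
by apply: eq_bigr => k _; rewrite /Uedge /uedge sg_conf.
Qed.

(** Conditionally on the signal, the mean log-likelihood ratio of the edge channel is the planted
    free energy at time 1. The scalar coordinates have amplitude 0 there, so [r] can be chosen
    afterwards in terms of [s]. *)
Lemma info_edge_free (r : {ffun 'I_n -> T} -> R) (s : n.-tuple R) :
  let xs := fun i => f (tnth s i) in
  \int[gam ne]_z ln (dens (iprod P0 n) (Uedge lam f) (obs (Uedge lam f) (s, z))) =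
  free (pn p) (fun k => vint (@isedge n) (pcoef sv lam r) 1 k)
    (bint (pA sv lam xs) (pB sv lam xs r) 1).
Proof.
move=> xs.
pose F z := ln (dens (iprod P0 n) (Uedge lam f) (obs (Uedge lam f) (s, z))).
have hU := sqint_Uedge (n := n) lam mf intg_fT_sqr.
have iF : intg (gam ne) F by exact: (intg_ln_dens_obs1 s hU (sqintW hU)).
rewrite -/(Rintegral _ _ F) -(law_Rint (measurable_trestr (lshift n))
  (fun A => law_trestr (stdn R) (@lshift_inj ne n)) iF).
apply: eq_Rint => y; rewrite /F; congr ln; rewrite dens_edge.
apply: eq_bigr => x _; congr (_ * expR _).
have ln0 : 0 <= lam / n%:R by rewrite divr_ge0.
rewrite /ham big_split_ord/= [X in _ = _ + X + _]big1 ?addr0; last first.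
  by move=> i _; rewrite /vint /isedge split_rshiftE subrr sqrtr0 !mul0r.
rewrite /bint subrr mul0r addr0 mul1r /pA -big_split/=; apply: eq_bigr => k _.
rewrite /vint /isedge /pcoef split_lshiftE sqrtr1 mul1r tnth_mktuple /= tnth_mktuple.
rewrite /Uedge /uedge -/xs.
have := sqr_sqrtr ln0; set q := Num.sqrt _ => h; rewrite -h.
by field.
Qed.

End planted_info.

Section product_law.
Context {R : realType} d1 d2 e1 e2 (S1 : measurableType d1) (S2 : measurableType d2)
  (T1 : measurableType e1) (T2 : measurableType e2).
Variables (mu1 : probability S1 R) (mu2 : probability S2 R)
  (nu1 : probability T1 R) (nu2 : probability T2 R) (W1 : S1 -> T1) (W2 : S2 -> T2).
Hypotheses (mW1 : measurable_fun setT W1) (mW2 : measurable_fun setT W2).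
Hypothesis hW1 : forall A, measurable A -> mu1 (W1 @^-1` A) = nu1 A.
Hypothesis hW2 : forall A, measurable A -> mu2 (W2 @^-1` A) = nu2 A.

Lemma measurable_prod_map : measurable_fun setT (fun w => (W1 w.1, W2 w.2)).
Proof.
by apply: measurable_fun_pair; [exact: (measurableT_comp mW1)|exact: (measurableT_comp mW2)].
Qed.

Lemma law_prod_map A : measurable A ->
  (mu1 \x mu2)%E ((fun w => (W1 w.1, W2 w.2)) @^-1` A) = (nu1 \x nu2)%E A.
Proof.
move=> mA; apply/esym.
apply: (@product_measure_unique _ _ _ _ _ nu1 nu2
  (pushm (mu1 \x mu2)%E measurable_prod_map)) => // B C mB mC.
rewrite -[LHS]/((mu1 \x mu2)%E ((fun w => (W1 w.1, W2 w.2)) @^-1` (B `*` C))).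
have -> : (fun w => (W1 w.1, W2 w.2)) @^-1` (B `*` C) = (W1 @^-1` B) `*` (W2 @^-1` C) by [].
have m1 : measurable (W1 @^-1` B) by rewrite -[X in measurable X]setTI; exact: mW1.
have m2 : measurable (W2 @^-1` C) by rewrite -[X in measurable X]setTI; exact: mW2.
by rewrite product_measure1E//; congr (_ * _)%E; [exact: hW1|exact: hW2].
Qed.

End product_law.

Section second_moment_bound.
Context {R : realType} (P0 P1 : probability R R) (n m : nat) (io : 'I_n -> 'I_m).
Hypotheses (n0 : (0 < n)%N) (io_inj : injective io).
Variable g : R * R -> R.
Hypotheses (mg : measurable_fun setT g) (ig2 : intg (P0 \x P1)%E (fun w => g w ^+ 2))
  (ig1 : forall x, intg P1 (fun y => g (x, y))) (Eg0 : \int[(P0 \x P1)%E]_w g w = 0).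
Local Notation Q := (iprod P0 n \x iprod P1 m)%E.
Local Notation xi i := (fun w : n.-tuple R * m.-tuple R => g (tnth w.1 i, tnth w.2 (io i))).

Let mcoord i : measurable_fun setT (fun w : n.-tuple R * m.-tuple R =>
  (tnth w.1 i, tnth w.2 (io i))).
Proof. exact: (measurable_prod_map (measurable_tnth i) (measurable_tnth (io i))). Qed.

Let hcoord i A : measurable A ->
  Q ((fun w => (tnth w.1 i, tnth w.2 (io i))) @^-1` A) = (P0 \x P1)%E A.
Proof.
move=> mA; apply: (law_prod_map (measurable_tnth i) (measurable_tnth (io i)) _ _ mA).
- by move=> B mB; exact: law_tnth.
- by move=> B mB; exact: law_tnth.
Qed.

Let mxi i : measurable_fun setT (xi i).
Proof. exact: (measurableT_comp mg (mcoord i)). Qed.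

Let ig : intg (P0 \x P1)%E g.
Proof.
apply: (@intg_dom _ _ _ _ _ (fun w => 1 + g w ^+ 2)) => //.
  by apply: intgD => //; exact: intg_cst.
by move=> w; rewrite ler_norml; apply/andP; split; nra.
Qed.

Let ixi2 i : intg Q (fun w => xi i w ^+ 2).
Proof. exact: (law_intg (mcoord i) (@hcoord i) ig2). Qed.

Let ixx i j : intg Q (fun w => xi i w * xi j w).
Proof.
apply: (intg_dom _ (intgD (ixi2 i) (ixi2 j))); first exact: measurable_funM.
by move=> w; exact: mul_le_sqr.
Qed.

Let uncorrelated i j : i != j -> \int[Q]_w (xi i w * xi j w) = 0.
Proof.
move=> ij.
pose gb x := \int[P1]_y g (x, y).
have igb : intg P0 gb by exact: intg_inner.
have ioij : io i != io j by apply: contra ij => /eqP /io_inj ->.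
have inner (s : n.-tuple R) : intg (iprod P1 m)
      (fun y => g (tnth s i, tnth y (io i)) * g (tnth s j, tnth y (io j))) /\
    \int[iprod P1 m]_y (g (tnth s i, tnth y (io i)) * g (tnth s j, tnth y (io j))) =
    gb (tnth s i) * gb (tnth s j).
  have mW : measurable_fun setT (fun y : m.-tuple R => (tnth y (io i), tnth y (io j))).
    by apply: measurable_fun_pair; exact: measurable_tnth.
  have hW A mA := @law_tnth2 _ P1 _ _ _ A ioij mA.
  have ii := intg_mul (ig1 (tnth s i)) (ig1 (tnth s j)).
  split; first exact: (law_intg mW hW ii).
  by rewrite (law_Rint mW hW ii); exact: (Rint_mul (ig1 (tnth s i)) (ig1 (tnth s j))).
rewrite Rint_prod//=; last by move=> s; case: (inner s).
under eq_Rint => s do rewrite (inner s).2.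
have mW : measurable_fun setT (fun y : n.-tuple R => (tnth y i, tnth y j)).
  by apply: measurable_fun_pair; exact: measurable_tnth.
have hW A mA := @law_tnth2 _ P0 _ _ _ A ij mA.
rewrite (law_Rint mW hW (intg_mul igb igb)) Rint_mul//.
by rewrite -Rint_prod// Eg0 mul0r.
Qed.

Lemma intg_sum_coord : intg Q (fun w => \sum_i xi i w).
Proof. by apply: intg_sum => i _; exact: (law_intg (mcoord i) (@hcoord i) ig). Qed.

(** The terms are centred and pairwise uncorrelated, so the second moment of the sum is of order
    [n]; the first moment follows from [a <= a ^ 2 / (2 * q) + q / 2] with [q = sqrt n]. *)
Lemma sum_coord_norm_le : \int[Q]_w `|\sum_i xi i w| <=
  Num.sqrt n%:R * ((\int[(P0 \x P1)%E]_w g w ^+ 2 + 1) / 2).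
Proof.
set V := \int[(P0 \x P1)%E]_w _; set q := Num.sqrt _.
have q0 : 0 < q by rewrite sqrtr_gt0 ltr0n.
have iSS : intg Q (fun w => \sum_i \sum_j xi i w * xi j w).
  by apply: intg_sum => i _; apply: intg_sum => j _; exact: ixx.
have ES : \int[Q]_w (\sum_i \sum_j xi i w * xi j w) = n%:R * V.
  rewrite Rint_sum; last by move=> i _; apply: intg_sum => j _; exact: ixx.
  rewrite -[n in RHS]card_ord mulr_natl -sumr_const; apply: eq_bigr => i _.
  rewrite Rint_sum//; rewrite (bigD1 i)//= big1 ?addr0; last first.
    by move=> j ji; rewrite uncorrelated// eq_sym.
  rewrite /V -(law_Rint (mcoord i) (@hcoord i) ig2).
  by apply: eq_Rint => w; rewrite expr2.
apply: (@le_trans _ _ (\int[Q]_w (q^-1 / 2 * (\sum_i \sum_j xi i w * xi j w) + q / 2))).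
  apply: Rint_le.
  - exact/intg_norm/intg_sum_coord.
  - by apply: intgD; [exact: intgZ|exact: intg_cst].
  - move=> w; have -> : \sum_i \sum_j xi i w * xi j w = `|\sum_i xi i w| ^+ 2.
      rewrite -normrX ger0_norm ?sqr_ge0// expr2 mulr_suml; apply: eq_bigr => i _.
      by rewrite mulr_sumr.
    set a := `|_|.
    have : 0 <= q^-1 / 2 * (a - q) ^+ 2.
      by rewrite mulr_ge0 ?sqr_ge0// divr_ge0// invr_ge0 ltW.
    have -> : q^-1 / 2 * (a - q) ^+ 2 = q^-1 / 2 * a ^+ 2 - a + q / 2.
      by field; rewrite gt_eqF.
    lra.
rewrite RintD; [|exact: intgZ|exact: intg_cst].
rewrite RintZ// Rint_cst ES.
have -> : n%:R = q ^+ 2 :> R by rewrite sqr_sqrtr.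
rewrite le_eqVlt; apply/orP; left; apply/eqP; field.
by rewrite gt_eqF.
Qed.

End second_moment_bound.

Section finite_upper_bound.
Context {R : realType} (P0 : probability R R) (T : finType) (kap : R -> T) (sv : T -> R).
Hypothesis mkap : forall t, measurable (kap @^-1` [set t]).
Variable lam : R.
Hypothesis lam0 : 0 <= lam.
Local Notation f := (fT kap sv).
Local Notation p := (pT P0 kap).
Local Notation gam m := (iprod (stdn R) m).

Let mf := measurable_fT sv mkap.
Let p0 := pT_ge0 P0 kap.
Let p1 := pT_sum P0 mkap.

(** Log-partition function of a single site at amplitude [rr], with noise [z] and planted value
    [xi]. *)
Definition zeta (rr z xi : R) : R :=
  ln (\sum_t p t * expR (Num.sqrt lam * rr * sv t * z +
    lam * (rr * `|rr|) * sv t * xi - lam / 2 * rr ^+ 2 * sv t ^+ 2)).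

Lemma wsum_gt0 (h : T -> R) : 0 < \sum_t p t * expR (h t).
Proof.
have := @part_gt0 R T p 0 p0 p1 (fun _ _ => 0) h [tuple].
rewrite /part (eq_bigr (fun t => p t * expR (h t)))// => t _.
by rewrite /ham big_ord0 add0r.
Qed.

Lemma ln_wsum_bnd (h : T -> R) (b : R) : (forall t, `|h t| <= b) ->
  `|ln (\sum_t p t * expR (h t))| <= b.
Proof.
move=> hb; have Z0 := wsum_gt0 h.
rewrite ler_norml; apply/andP; split.
  rewrite -[leLHS]expRK ler_ln ?posrE ?expR_gt0//.
  rewrite -[leLHS]mul1r -p1 mulr_suml; apply: ler_sum => t _.
  by rewrite ler_wpM2l// ler_expR; have := hb t; rewrite ler_norml => /andP[].
rewrite -[leRHS]expRK ler_ln ?posrE ?expR_gt0//.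
rewrite -[leRHS]mul1r -p1 mulr_suml; apply: ler_sum => t _.
by rewrite ler_wpM2l// ler_expR; have := hb t; rewrite ler_norml => /andP[].
Qed.

Definition szeta rr (w : R * R) : R := zeta rr w.2 (f w.1).

Lemma measurable_szeta rr : measurable_fun setT (szeta rr).
Proof.
apply: measurableT_comp; first exact: measurable_ln.
apply: measurable_sum => t; apply: measurable_funM => //.
apply: measurableT_comp => //; apply: measurable_funB => //.
apply: measurable_funD; apply: measurable_funM => //.
exact: (measurableT_comp mf measurable_fst).
Qed.

Lemma szeta_bnd rr : exists C, 0 <= C /\ forall w, `|szeta rr w| <= C * (1 + `|w.2|).
Proof.
pose b := fbnd sv; have b0 : 0 <= b := fbnd_ge0 sv.
pose C1 := `|Num.sqrt lam * rr| * b; pose C2 := `|lam * (rr * `|rr|)| * b * b +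
  `|lam / 2 * rr ^+ 2| * b ^+ 2.
have C10 : 0 <= C1 by rewrite mulr_ge0.
have C20 : 0 <= C2 by rewrite addr_ge0// !mulr_ge0// sqr_ge0.
exists (C1 + C2); split; first exact: addr_ge0.
move=> w; apply: ln_wsum_bnd => t.
apply: (@le_trans _ _ (C1 * `|w.2| + C2)); last first.
  by have := mulr_ge0 C20 (normr_ge0 w.2); lra.
rewrite (le_trans (ler_normB _ _))// /C2 addrA.
apply: lerD; last first.
  rewrite normrM ler_wpM2l// normrX lerXn2r ?nnegrE//; exact: fbnd_ge.
rewrite (le_trans (ler_normD _ _))//; apply: lerD.
  by rewrite normrM ler_wpM2r// normrM ler_wpM2l//; exact: fbnd_ge.
rewrite normrM ler_pM//; last exact: fbnd_ge.
by rewrite normrM ler_wpM2l//; exact: fbnd_ge.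
Qed.

Let lin_sqr (C c z : R) : (C * (1 + `|z|) + c) ^+ 2 <= 3 * (C ^+ 2 + C ^+ 2 * z ^+ 2 + c ^+ 2).
Proof.
have -> : z ^+ 2 = `|z| ^+ 2 by rewrite -normrX ger0_norm ?sqr_ge0.
set u := `|z|.
have := sqr_ge0 (C - C * u); have := sqr_ge0 (C - c); have := sqr_ge0 (C * u - c).
nra.
Qed.

Lemma intg_szeta_sqr rr c : intg (P0 \x stdn R)%E (fun w => (szeta rr w - c) ^+ 2).
Proof.
have [C [C0 hC]] := szeta_bnd rr.
apply: (@intg_dom _ _ _ _ _ (fun w : R * R => 3 * (C ^+ 2 + C ^+ 2 * w.2 ^+ 2 + `|c| ^+ 2))).
- apply: measurable_funX; apply: measurable_funB => //; exact: measurable_szeta.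
- apply: intgZ; apply: intgD; last exact: intg_cst.
  apply: intgD; first exact: intg_cst.
  apply: intgZ; exact: (intg_snd P0 intg_stdn_sqr).
- move=> w; rewrite ger0_norm ?sqr_ge0//; apply: le_trans (lin_sqr C `|c| w.2).
  rewrite -[leLHS]ger0_norm ?sqr_ge0// normrX lerXn2r ?nnegrE//.
    by rewrite addr_ge0// mulr_ge0// addr_ge0.
  by rewrite (le_trans (ler_normB _ _))// lerD2r.
Qed.

Lemma intg_szeta rr : intg (P0 \x stdn R)%E (szeta rr).
Proof.
apply: (@intg_dom _ _ _ _ _ (fun w => 1 + (szeta rr w - 0) ^+ 2)).
- exact: measurable_szeta.
- by apply: intgD; [exact: intg_cst|exact: intg_szeta_sqr].
- by move=> w; rewrite subr0 ler_norml; apply/andP; split; nra.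
Qed.

Lemma intg_szeta1 rr c x : intg (stdn R) (fun z => szeta rr (x, z) - c).
Proof.
have [C [C0 hC]] := szeta_bnd rr.
apply: intgB; last exact: intg_cst.
apply: (@intg_dom _ _ _ _ _ (fun z : R => C * (1 + `|z|))).
- exact: (measurableT_comp (measurable_szeta rr) (pair1_measurable x)).
- by apply: intgZ; apply: intgD; [exact: intg_cst|exact: intg_norm_stdn].
- by move=> z; exact: hC.
Qed.

Definition info1 (h : R -> R) : R := info P0 (fun _ : 'I_1 => h).

(** For negative [rr], data of amplitude [|rr|] are read with the reference of amplitude [rr], and
    by Gibbs' inequality this can only lower the mean. Negative overlaps are thus controlled by the
    potential at [q = rr ^ 2]. *)
Lemma szeta_mean_le rr :
  \int[(P0 \x stdn R)%E]_w szeta rr w <= info1 (fun x => Num.sqrt lam * `|rr| * f x).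
Proof.
pose V := fun (_ : 'I_1) x => Num.sqrt lam * rr * f x.
pose U := fun (_ : 'I_1) x => Num.sqrt lam * `|rr| * f x.
have sq1 : sqint P0 (fun (_ : 'I_1) => f).
  by split => //; exact: intg_fT_sqr.
have hV : sqint P0 V by exact: (sqintZ (fun=> _) sq1).
have hU : sqint P0 U by exact: (sqintZ (fun=> _) sq1).
apply: le_trans (gibbs_inequality hV hU).
have mid : measurable_fun setT (fun x : R => x) by exact: measurable_id.
have hid (A : set R) : measurable A -> P0 ((fun x : R => x) @^-1` A) = P0 A by [].
have ht (A : set R) (mA : measurable A) := law_tnth (stdn R) (ord0 : 'I_1) mA.
have mW := measurable_prod_map mid (@measurable_tnth _ R 1 ord0).
have hW A mA := @law_prod_map _ _ _ _ _ _ _ _ _ _ _ _ _ _ _ mid (@measurable_tnth _ R 1 ord0) hid ht A mA.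
rewrite -(law_Rint mW hW (intg_szeta rr)).
rewrite le_eqVlt; apply/orP; left; apply/eqP; apply: eq_Rint => w.
rewrite /szeta /zeta /=; congr ln.
pose phi t := expR (Num.sqrt lam * rr * sv t * tnth w.2 ord0 +
   lam * (rr * `|rr|) * sv t * f w.1 - lam / 2 * rr ^+ 2 * sv t ^+ 2).
rewrite -[LHS]/(\sum_t p t * phi t) -(Rint_fin P0 mkap phi).
apply: eq_Rint => x; rewrite /wt big_ord1 /V /obs tnth_mktuple /U /phi; congr expR.
rewrite -/(f x) /fT; have := sqr_sqrtr lam0; set q := Num.sqrt lam => h.
by rewrite -h; field.
Qed.

Section fixed_size.
Variables (n L : nat) (rr : 'I_L -> R) (Phi : R).
Hypotheses (n0 : (0 < n)%N) (L0 : (0 < L)%N).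
Hypothesis hPhi : forall j, - (lam / 4) * rr j ^+ 4 +
  info1 (fun x => Num.sqrt lam * `|rr j| * f x) <= Phi.
Local Notation ne := #|edge n|.
Local Notation G := {ffun 'I_n -> T}.

Let sq_rr j : (rr j * `|rr j|) ^+ 2 = rr j ^+ 4.
Proof. by rewrite exprMn -normrX ger0_norm ?sqr_ge0// -exprD. Qed.

(** Bounding the term of index [l x] by the sum over all grid indices decouples the amplitude from
    the configuration; at a fixed index the sum over configurations factorises over sites. *)
Lemma part0_le (l : G -> 'I_L) (xs : 'I_n -> R) y :
  part (pn p) (fun k => vint (@isedge n) (pcoef sv lam (fun x => rr (l x))) 0 k)
    (bint (pA sv lam xs) (pB sv lam xs (fun x => rr (l x))) 0) y <=
  \sum_j expR (- (n%:R * (lam / 4) * rr j ^+ 4) +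
    \sum_i zeta (rr j) (tnth y (rshift ne i)) (xs i)).
Proof.
pose r x := rr (l x); rewrite -/r.
pose g j i t := Num.sqrt lam * rr j * sv t * tnth y (rshift ne i) +
    lam * (rr j * `|rr j|) * sv t * xs i - lam / 2 * rr j ^+ 2 * sv t ^+ 2.
pose c j := - (n%:R * (lam / 4) * rr j ^+ 4).
have -> : \sum_j expR (c j + \sum_i zeta (rr j) (tnth y (rshift ne i)) (xs i)) =
    \sum_j \sum_(x : G) pn p x * expR (c j + \sum_i g j i (x i)).
  apply: eq_bigr => j _.
  rewrite expRD expR_sum.
  under eq_bigr do rewrite lnK ?posrE ?wsum_gt0//.
  rewrite bigA_distr_bigA mulr_sumr; apply: eq_bigr => x _.
  by rewrite big_split/= expRD expR_sum /pn mulrCA.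
rewrite exchange_big/=; apply: ler_sum => x _; rewrite -mulr_sumr.
rewrite ler_wpM2l ?pn_ge0//.
rewrite (bigD1 (l x))//=; set rest := (X in _ <= _ + X).
apply: (@le_trans _ _ (expR (c (l x) + \sum_i g (l x) i (x i)))); last first.
  by rewrite lerDl; apply: sumr_ge0 => j _; exact: expR_ge0.
rewrite le_eqVlt; apply/orP; left; apply/eqP; congr expR.
rewrite /ham big_split_ord/= [X in X + _ + _]big1 ?add0r; last first.
  by move=> i _; rewrite /vint /isedge split_lshiftE sqrtr0 !mul0r.
rewrite /bint mul0r add0r subr0 mul1r /pB -/(r x) addrA [RHS]addrC; congr (_ + _); last first.
  by rewrite /c -sq_rr -/(r x); field.
rewrite -big_split/=; apply: eq_bigr => i _.
rewrite /vint /isedge /pcoef split_rshiftE subr0 sqrtr1 mul1r /g -/(r x) /sg.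
by field.
Qed.

Definition dev j (w : n.-tuple R * (ne + n).-tuple R) : R :=
  \sum_i (szeta (rr j) (tnth w.1 i, tnth w.2 (rshift ne i)) -
    \int[(P0 \x stdn R)%E]_u szeta (rr j) u).

(** The sum over the grid costs [ln L]; each product of site sums is within [dev] of its mean in the
    exponent, and [hPhi] bounds that mean. *)
Lemma ln_part0_le (l : G -> 'I_L) (s : n.-tuple R) y :
  ln (part (pn p) (fun k => vint (@isedge n) (pcoef sv lam (fun x => rr (l x))) 0 k)
    (bint (pA sv lam (fun i => f (tnth s i)))
      (pB sv lam (fun i => f (tnth s i)) (fun x => rr (l x))) 0) y) <=
  ln L%:R + n%:R * Phi + \sum_j `|dev j (s, y)|.
Proof.
pose r x := rr (l x); pose xs i := f (tnth s i); rewrite -/r -/xs.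
have Lp : 0 < L%:R :> R by rewrite ltr0n.
have Z0 := part_gt0 (@pn_ge0 _ n _ _ p0) (pn_sum n p1)
  (fun k => vint (@isedge n) (pcoef sv lam r) 0 k) (bint (pA sv lam xs) (pB sv lam xs r) 0) y.
set D := n%:R * Phi + \sum_j `|dev j (s, y)|.
rewrite -addrA -/D -[X in _ <= _ + X]expRK -lnM ?posrE ?expR_gt0//.
rewrite ler_ln ?posrE ?mulr_gt0 ?expR_gt0//.
apply: (le_trans (part0_le l xs y)).
have -> : L%:R * expR D = \sum_(j < L) expR D by rewrite sumr_const card_ord mulr_natl.
apply: ler_sum => j _.
rewrite ler_expR.
have -> : \sum_i zeta (rr j) (tnth y (rshift ne i)) (xs i) =
    dev j (s, y) + n%:R * \int[(P0 \x stdn R)%E]_u szeta (rr j) u.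
  by rewrite /dev sumrB sumr_const card_ord -[_ *+ n]mulr_natl addrNK.
have h1 : dev j (s, y) <= \sum_j `|dev j (s, y)|.
  by rewrite (bigD1 j)//= (le_trans (ler_norm _))// lerDl sumr_ge0.
have h2 := le_trans (lerD (lexx _) (szeta_mean_le (rr j))) (hPhi j).
have h3 : n%:R * (- (lam / 4) * rr j ^+ 4 + \int[(P0 \x stdn R)%E]_u szeta (rr j) u) <= n%:R * Phi.
  by rewrite ler_wpM2l.
rewrite /D; lra.
Qed.

Lemma info_edge_le (B delta : R) : (forall t, `|sv t| <= B) ->
  (forall z, `|z| <= B ^+ 2 -> exists j, `|rr j * `|rr j| - z| <= delta) ->
  info (iprod P0 n) (Uedge lam f) <=
    ln L%:R + n%:R * Phi + (lam * n%:R * delta ^+ 2 + lam * B ^+ 4 / 2) / 2 +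
    Num.sqrt n%:R * \sum_j ((\int[(P0 \x stdn R)%E]_w (szeta (rr j) w -
       \int[(P0 \x stdn R)%E]_u szeta (rr j) u) ^+ 2 + 1) / 2).
Proof.
move=> svB hgrid.
have np : 0 < n%:R :> R by rewrite ltr0n.
pose Qx := (iprod P0 n \x gam (ne + n))%E.
have hU := sqint_Uedge (n := n) lam mf (intg_fT_sqr P0 sv mkap).
pose c0 := (lam * n%:R * delta ^+ 2 + lam * B ^+ 4 / 2) / 2.
pose gj j w := szeta (rr j) w - \int[(P0 \x stdn R)%E]_u szeta (rr j) u.
have mgj j : measurable_fun setT (gj j).
  by apply: measurable_funB => //; exact: measurable_szeta.
have Egj j : \int[(P0 \x stdn R)%E]_w gj j w = 0.
  by rewrite RintB ?Rint_cst ?subrr//; [exact: intg_szeta|exact: intg_cst].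
have ro_inj : injective (@rshift ne n) by exact: rshift_inj.
have idev j : intg Qx (dev j).
  exact: (intg_sum_coord (@rshift ne n) (mgj j) (intg_szeta_sqr _ _)).
have idev1 j s : intg (gam (ne + n)) (fun y => dev j (s, y)).
  apply: intg_sum => i _.
  exact: (@intg_tnth _ (ne + n) (rshift ne i) (fun z => gj j (tnth s i, z)) (intg_szeta1 _ _ _)).
pose bd w := ln L%:R + n%:R * Phi + c0 + \sum_j `|dev j w|.
have ibd : intg Qx bd.
  by apply: intgD; [exact: intg_cst|apply: intg_sum => j _; exact: intg_norm].
have ibd1 s : intg (gam (ne + n)) (fun y => bd (s, y)).
  by apply: intgD; [exact: intg_cst|apply: intg_sum => j _; exact: intg_norm].
have E1 : info (iprod P0 n) (Uedge lam f) <= \int[Qx]_w bd w.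
  rewrite /info Rint_prod; last 2 first.
  - exact: intg_ln_dens_obs.
  - by move=> s; exact: (intg_ln_dens_obs1 s hU (sqintW hU)).
  rewrite /Qx Rint_prod//; apply: Rint_le.
  - exact: (intg_inner (intg_ln_dens_obs hU hU)
      (fun s => intg_ln_dens_obs1 s hU (sqintW hU))).
  - exact: (intg_inner ibd ibd1).
  move=> s; pose xs i := f (tnth s i).
  have xsB i : `|xs i| <= B by exact: svB.
  have B0 : 0 <= B := le_trans (normr_ge0 _) (xsB (Ordinal n0)).
  pose ov (x : G) := (\sum_i sg sv x i * xs i) / n%:R.
  have ovB x : `|ov x| <= B ^+ 2.
    rewrite normrM [`|n%:R^-1|]ger0_norm ?invr_ge0// ?ler_pdivrMr//.
    rewrite (le_trans (ler_norm_sum _ _ _))//.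
    rewrite mulrC -[X in X%:R * _]card_ord mulr_natl -sumr_const; apply: ler_sum => i _.
    by rewrite normrM expr2 ler_pM//; exact: svB.
  (* For this fixed signal, each configuration receives a grid point whose signed square is within
     [delta] of its overlap with [xs]. *)
  have [l hl] := choice (fun x => hgrid (ov x) (ovB x)).
  rewrite (info_edge_free P0 sv mkap lam0 (fun x => rr (l x)) s).
  have := @planted_free_le R n T p sv n0 p0 p1 lam B delta lam0 svB xs
    (fun x => rr (l x)) hl.
  move=> h; apply: (le_trans h); rewrite -/c0.
  have -> : \int[gam (ne + n)]_y bd (s, y) =
      \int[gam (ne + n)]_y (ln L%:R + n%:R * Phi + \sum_j `|dev j (s, y)|) + c0.
    rewrite -[X in _ = _ + X](Rint_cst (gam (ne + n))) -RintD; last 2 first.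
    - by apply: intgD; [exact: intg_cst|apply: intg_sum => j _; exact: intg_norm].
    - exact: intg_cst.
    by apply: eq_Rint => y; rewrite /bd addrAC.
  rewrite lerD2r; apply: Rint_le.
  - by apply: intg_ln_part; [exact: pn_ge0|exact: pn_sum].
  - by apply: intgD; [exact: intg_cst|apply: intg_sum => j _; exact: intg_norm].
  - by move=> y; exact: ln_part0_le.
apply: (le_trans E1); rewrite RintD; last 2 first.
- exact: intg_cst.
- by apply: intg_sum => j _; exact: intg_norm.
rewrite Rint_cst -/c0 lerD2l Rint_sum; last by move=> j _; exact: intg_norm.
rewrite mulr_sumr; apply: ler_sum => j _.
exact: (sum_coord_norm_le n0 ro_inj (mgj j) (intg_szeta_sqr _ _) (fun x => intg_szeta1 _ _ x) (Egj j)).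
Qed.

End fixed_size.
End finite_upper_bound.

(** * Removal of null coordinates and tensorisation of scalar channels *)

Section null_signals.
Context {R : realType} d (S : measurableType d) (mu : probability S R) (a m : nat)
  (io : 'I_a -> 'I_m).
Hypothesis io_inj : injective io.

Let sum_io (g : 'I_a -> R) (F : 'I_m -> R) : (forall i, F (io i) = g i) ->
  (forall k, k \notin codom io -> F k = 0) -> \sum_k F k = \sum_i g i.
Proof.
move=> FE F0; rewrite (bigID (mem (io @: finset.setT)))/= [X in _ + X]big1 ?addr0.
  rewrite big_imset/=; last by move=> i j _ _; exact: io_inj.
  by apply: eq_big => [i|i _]; rewrite ?inE ?FE.
move=> k kio; apply: F0; apply: contra kio => /codomP[i ->].
by rewrite imset_f.
Qed.

(** A coordinate without signal contributes a factor 1 to the weight, so it leaves the density and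
    its noise is integrated out. *)
Lemma info_null_signals (U : 'I_a -> S -> R) (W : 'I_m -> S -> R) : sqint mu U ->
  (forall i, W (io i) = U i) -> (forall k, k \notin codom io -> W k = fun=> 0) ->
  info mu W = info mu U.
Proof.
move=> hU WE W0.
have mid : measurable_fun setT (fun s : S => s) by exact: measurable_id.
have mW := measurable_prod_map mid (@measurable_trestr R _ _ io).
have hW A mA := @law_prod_map _ _ _ _ _ _ _ _ _ mu (iprod (stdn R) m) mu (iprod (stdn R) a)
  _ _ mid (measurable_trestr io) (fun A _ => erefl) (fun A => law_trestr (stdn R) io_inj) A mA.
rewrite /info -(law_Rint mW hW (intg_ln_dens_obs hU hU)); apply: eq_Rint => -[s z] /=.
congr ln; apply: eq_Rint => x; congr expR.
apply: sum_io => [i|k kio]; first by rewrite /obs !tnth_mktuple /= ?tnth_mktuple !WE.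
by rewrite W0// mul0r expr0n/= mul0r subr0.
Qed.

End null_signals.

Section scalar.
Context {R : realType} (P0 : probability R R).
Implicit Types h : R -> R.

Definition dens1 h (y : R) : R := \int[P0]_x expR (h x * y - h x ^+ 2 / 2).

Lemma dens1E h (y : 1.-tuple R) :
  dens P0 (fun _ : 'I_1 => h) y = dens1 h (tnth y ord0).
Proof. by apply: eq_Rint => x; rewrite /wt big_ord1. Qed.

Definition tuple1 (z : R) : 1.-tuple R := [tuple z | _ < 1].

Lemma sqint1 h : measurable_fun setT h -> intg P0 (fun x => h x ^+ 2) ->
  sqint P0 (fun _ : 'I_1 => h).
Proof. by []. Qed.

Lemma intg_dens1 h y : measurable_fun setT h ->
  intg P0 (fun x => expR (h x * y - h x ^+ 2 / 2)).
Proof.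
move=> mh; have := intg_wt P0 (fun _ : 'I_1 => mh) (tuple1 y).
by apply: eq_intg => x; rewrite /wt big_ord1 tnth_mktuple.
Qed.

Lemma dens1_gt0 h y : measurable_fun setT h -> 0 < dens1 h y.
Proof. by move=> mh; have := dens_gt0 P0 (fun _ : 'I_1 => mh) (tuple1 y); rewrite dens1E tnth_mktuple. Qed.

Lemma measurable_tuple1 : measurable_fun setT tuple1.
Proof.
apply/measurable_fun_tnthP => i.
have -> : (@tnth 1 R)^~ i \o tuple1 = (fun z : R => z).
  by apply/funext => y /=; rewrite tnth_mktuple.
exact: measurable_id.
Qed.

Let mid : measurable_fun setT (fun x : R => x). Proof. exact: measurable_id. Qed.

Lemma measurable_pair_tuple1 : measurable_fun setT (fun w : R * R => (w.1, tuple1 w.2)).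
Proof. exact: (measurable_prod_map mid measurable_tuple1). Qed.

Lemma law_pair_tuple1 A : measurable A ->
  (P0 \x stdn R)%E ((fun w : R * R => (w.1, tuple1 w.2)) @^-1` A) =
  (P0 \x iprod (stdn R) 1)%E A.
Proof.
move=> mA; apply: (law_prod_map mid measurable_tuple1 _ _ mA) => // B mB.
apply: law_iprod mB; [exact: measurable_tuple1|move=> C mC]; rewrite big_ord1; congr (_ _).
apply/seteqP; split => y /=.
  by move/(_ ord0); rewrite tnth_mktuple.
by move=> By i; rewrite tnth_mktuple (ord1 i).
Qed.

Lemma intg_ln_dens1 h h' : measurable_fun setT h -> intg P0 (fun x => h x ^+ 2) ->
  measurable_fun setT h' -> intg P0 (fun x => h' x ^+ 2) ->
  intg (P0 \x stdn R)%E (fun w => ln (dens1 h (w.2 + h' w.1))).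
Proof.
move=> mh ih mh' ih'.
have := law_intg measurable_pair_tuple1 law_pair_tuple1 (intg_ln_dens_obs (sqint1 mh ih) (sqint1 mh' ih')).
by apply: eq_intg => w; rewrite dens1E /obs !tnth_mktuple.
Qed.

Lemma info1E h : measurable_fun setT h -> intg P0 (fun x => h x ^+ 2) ->
  info1 P0 h = \int[(P0 \x stdn R)%E]_w ln (dens1 h (w.2 + h w.1)).
Proof.
move=> mh ih; have hU := sqint1 mh ih.
rewrite /info1 /info -(law_Rint measurable_pair_tuple1 law_pair_tuple1 (intg_ln_dens_obs hU hU)).
by apply: eq_Rint => w; rewrite dens1E /obs !tnth_mktuple.
Qed.

(** The density of independent observations is a product, and its logarithm a sum of [n] terms with
    the same law. *)
Lemma info_iprod n h : measurable_fun setT h -> intg P0 (fun x => h x ^+ 2) ->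
  info (iprod P0 n) (fun (i : 'I_n) s => h (tnth s i)) = n%:R * info1 P0 h.
Proof.
move=> mh ih.
have dE (y : n.-tuple R) : dens (iprod P0 n) (fun (i : 'I_n) s => h (tnth s i)) y =
    \prod_(i < n) dens1 h (tnth y i).
  apply: EFin_inj; rewrite dens_EFin; last first.
    by move=> k; exact: (measurableT_comp mh (measurable_tnth k)).
  rewrite -prodEFin.
  transitivity (\prod_(i < n) \int[P0]_x (expR (h x * tnth y i - h x ^+ 2 / 2))%:E)%E.
    rewrite -iprod_prod; last 2 first.
    - by move=> i; apply/measurable_EFinP; exact: (intg_measurable (intg_dens1 _ mh)).
    - by move=> i x; rewrite lee_fin expR_ge0.
    by apply: eq_integral => s _; rewrite prodEFin /wt expR_sum.
  by apply: eq_bigr => i _; rewrite /dens1 Rint_EFin//; exact: intg_dens1.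
pose L w := ln (dens1 h (w.2 + h w.1)).
have iL : intg (P0 \x stdn R)%E L by exact: intg_ln_dens1.
have law2 i A : measurable A -> (iprod P0 n \x iprod (stdn R) n)%E
    ((fun w => (tnth w.1 i, tnth w.2 i)) @^-1` A) = (P0 \x stdn R)%E A.
  move=> mA; apply: (law_prod_map (measurable_tnth i) (measurable_tnth i) _ _ mA).
  - by move=> B mB; exact: law_tnth.
  - by move=> B mB; exact: law_tnth.
have mW (i : 'I_n) := measurable_prod_map (@measurable_tnth _ R n i) (@measurable_tnth _ R n i).
rewrite info1E// -/(Rintegral _ _ L).
rewrite /info (eq_Rint _ (g := fun w => \sum_(i < n) L (tnth w.1 i, tnth w.2 i))); last first.
  move=> w; rewrite dE -[RHS]expRK expR_sum; congr ln; apply: eq_bigr => i _.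
  have p1 : dens1 h (tnth (obs (fun i s => h (tnth s i)) w) i) \is Num.pos.
    by rewrite posrE; exact: dens1_gt0.
  rewrite -[LHS](lnK p1) /L; congr (expR (ln (dens1 h _))).
  by rewrite /obs tnth_mktuple.
rewrite Rint_sum; last by move=> i _; exact: (law_intg (mW i) (@law2 i) iL).
rewrite (eq_bigr (fun=> \int[(P0 \x stdn R)%E]_w L w)); last first.
  by move=> i _; exact: (law_Rint (mW i) (@law2 i) iL).
by rewrite sumr_const card_ord -[_ *+ n]mulr_natl.
Qed.

End scalar.

(** * Lower bound: Guerra's interpolation *)

Section finite_lower_bound.
Context {R : realType} (P0 : probability R R) (T : finType) (kap : R -> T) (sv : T -> R).
Hypothesis mkap : forall t, measurable (kap @^-1` [set t]).
Variables (n : nat) (lam B r : R).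
Hypotheses (n0 : (0 < n)%N) (lam0 : 0 <= lam) (svB : forall t, `|sv t| <= B).
Local Notation ne := #|edge n|.
Local Notation f := (fT kap sv).
Local Notation G := {ffun 'I_n -> T}.
Local Notation mu := (iprod P0 n).
Local Notation Q := (mu \x iprod (stdn R) (ne + n))%E.

Let mf := measurable_fT sv mkap.
Let if2 := intg_fT_sqr P0 sv mkap.

(** Signals of the joint channel at full strength: the edges, then [n] scalar channels of amplitude
    [sqrt lam * r], where [r ^ 2] plays the role of [q]. *)
Let gu (k : 'I_(ne + n)) (s : n.-tuple R) : R :=
  match fintype.split k with
  | inl e => Uedge lam f e s
  | inr i => Num.sqrt lam * r * f (tnth s i)
  end.
Let coef (t : R) (k : 'I_(ne + n)) : R :=
  if isedge k then Num.sqrt t else Num.sqrt (1 - t).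
Let V t k s := coef t k * gu k s.

Let sqint_vertex : sqint mu (fun (i : 'I_n) s => Num.sqrt lam * r * f (tnth s i)).
Proof.
apply: (@sqintZ _ _ _ _ _ (fun=> _)) => i; split.
  exact: (measurableT_comp mf (measurable_tnth i)).
exact: (law_intg (measurable_tnth i) (fun A mA => law_tnth P0 i mA) if2).
Qed.

Let sqint_gu : sqint mu gu.
Proof.
move=> k; rewrite /gu; case: fintype.split => i; last exact: sqint_vertex.
exact: (sqint_Uedge lam mf if2 i).
Qed.

Let info_V1 : info mu (V 1) = info mu (Uedge lam f).
Proof.
apply: (info_null_signals (@lshift_inj ne n)).
- exact: sqint_Uedge.
- by move=> i; apply/funext => s; rewrite /V /coef /isedge /gu split_lshiftE sqrtr1 mul1r.
- move=> k; case: (fintype.split_ordP k) => j ->; first by rewrite codom_f.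
  by move=> _; apply/funext => s; rewrite /V /coef /isedge split_rshiftE subrr sqrtr0 mul0r.
Qed.

Let info_V0 : info mu (V 0) = n%:R * info1 P0 (fun x => Num.sqrt lam * r * f x).
Proof.
rewrite -info_iprod; last 2 first.
- exact: measurable_funM.
- by apply: (eq_intg _ (intgZ ((Num.sqrt lam * r) ^+ 2) if2)) => x; rewrite -exprMn.
apply: (info_null_signals (@rshift_inj ne n)).
- exact: sqint_vertex.
- by move=> i; apply/funext => s; rewrite /V /coef /isedge /gu split_rshiftE subr0 sqrtr1 mul1r.
- move=> k; case: (fintype.split_ordP k) => j ->; last by rewrite codom_f.
  by move=> _; apply/funext => s; rewrite /V /coef /isedge split_lshiftE sqrtr0 mul0r.
Qed.

(** For a finitely supported prior the posterior law is a probability on the finite set of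
    configurations, which makes [edge_vertex_le] available pointwise in [y]. *)
Let gibbs_average t y : exists pi : G -> R, [/\ forall x, 0 <= pi x, \sum_x pi x = 1 &
  forall phi : G -> R, avg mu (V t) (fun s => phi (conf kap s)) y = wav pi phi].
Proof.
have mV : forall k, measurable_fun setT (V t k) := sqintW (sqintZ (coef t) sqint_gu).
have D0 := dens_gt0 mu mV y.
pose g (x : G) : R := expR (\sum_k (coef t k * (match fintype.split k with
  | inl e => Num.sqrt (lam / n%:R) * eu e (sg sv x)
  | inr i => Num.sqrt lam * r * sg sv x i end) * tnth y k - (coef t k * (match fintype.split k with
  | inl e => Num.sqrt (lam / n%:R) * eu e (sg sv x)
  | inr i => Num.sqrt lam * r * sg sv x i end)) ^+ 2 / 2)).
have wE s : wt (V t) s y = g (conf kap s).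
  congr expR; apply: eq_bigr => k _; rewrite /V /gu.
  by case: fintype.split => i; rewrite ?/Uedge ?/uedge sg_conf.
have dE : dens mu (V t) y = \sum_x pn (pT P0 kap) x * g x.
  by rewrite -(Rint_conf P0 mkap); apply: eq_Rint => s; rewrite wE.
exists (fun x => pn (pT P0 kap) x * g x / dens mu (V t) y); split.
- move=> x; rewrite divr_ge0 ?(ltW D0)// mulr_ge0 ?expR_ge0//.
  by apply: pn_ge0; exact: pT_ge0.
- by rewrite -mulr_suml -dE divff// gt_eqF.
- move=> phi; rewrite /avg /wav.
  transitivity ((\sum_x pn (pT P0 kap) x * (phi x * g x)) / dens mu (V t) y).
    congr (_ / _); transitivity (\int[mu]_s (phi (conf kap s) * g (conf kap s))).
      by apply: eq_Rint => s; congr (_ * _); exact: wE.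
    exact: (Rint_conf P0 mkap (fun x => phi x * g x)).
  by rewrite mulr_suml; apply: eq_bigr => x _; ring.
Qed.

Let bracket t y :
  \sum_(k | ~~ isedge k) avg mu (V t) (gu k) y ^+ 2 -
  \sum_(k | isedge k) avg mu (V t) (gu k) y ^+ 2 <=
  lam * n%:R / 2 * r ^+ 4 + lam * B ^+ 4 / 2.
Proof.
have [pi [pi0 pi1 piE]] := gibbs_average t y.
have := edge_vertex_le n0 lam0 svB (fun=> r) pi0 pi1.
rewrite wav_cst// (_ : (r ^+ 2) ^+ 2 = r ^+ 4) -?exprM//.
have -> : \sum_(k | ~~ isedge k) avg mu (V t) (gu k) y ^+ 2 =
    lam * \sum_i wav pi (fun x => r * sg sv x i) ^+ 2.
  rewrite big_split_ord/= [X in X + _]big_pred0 ?add0r; last first.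
    by move=> i; rewrite /isedge split_lshiftE.
  rewrite mulr_sumr; apply: eq_big => [k|i _]; first by rewrite /isedge split_rshiftE.
  have -> : gu (rshift ne i) = fun s => Num.sqrt lam * (r * sg sv (conf kap s) i).
    by apply/funext => s; rewrite /gu split_rshiftE sg_conf mulrA.
  by rewrite (piE (fun x => Num.sqrt lam * (r * sg sv x i))) wavZ exprMn sqr_sqrtr.
have -> // : \sum_(k | isedge k) avg mu (V t) (gu k) y ^+ 2 =
    lam / n%:R * \sum_(k < ne) wav pi (fun x => eu k (sg sv x)) ^+ 2.
rewrite big_split_ord/= [X in _ + X]big_pred0 ?addr0; last first.
  by move=> i; rewrite /isedge split_rshiftE.
rewrite mulr_sumr; apply: eq_big => [k|i _]; first by rewrite /isedge split_lshiftE.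
have -> : gu (lshift n i) = fun s => Num.sqrt (lam / n%:R) * eu i (sg sv (conf kap s)).
  by apply/funext => s; rewrite /gu split_lshiftE sg_conf.
rewrite (piE (fun x => Num.sqrt (lam / n%:R) * eu i (sg sv x))) wavZ exprMn sqr_sqrtr//.
by rewrite divr_ge0.
Qed.

(* Guerra's interpolation between the edge channel at time 1 and [n] scalar
   channels at time 0; the tangent inequality replaces differentiation in time. *)
Lemma info_edge_ge :
  n%:R * (- (lam / 4) * r ^+ 4 + info1 P0 (fun x => Num.sqrt lam * r * f x)) - lam * B ^+ 4 / 4
    <= info mu (Uedge lam f).
Proof.
pose A t k := \int[Q]_w avg mu (V t) (gu k) (obs (V t) w) ^+ 2.
pose E k := \int[mu]_s gu k s ^+ 2.
have mg := sqintW sqint_gu.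
have hV t : sqint mu (V t) by exact: sqintZ.
have iA t k : intg Q (fun w => avg mu (V t) (gu k) (obs (V t) w) ^+ 2).
  by have [_ i2] := sqint_gu k; exact: (intg_avg_sqr_obs (sqintW (hV t)) (mg k) i2).
have AE t k : A t k <= E k.
  by have [_ i2] := sqint_gu k; exact: (Rint_avg_sqr_obs_le (sqintW (hV t)) (mg k) i2).
have A0 t k : 0 <= A t k by apply: Rint_ge0 => w; exact: sqr_ge0.
have E0 k : 0 <= E k := le_trans (A0 0 k) (AE 0 k).
pose c := (lam * n%:R / 2 * r ^+ 4 + lam * B ^+ 4 / 2) / 2.
(* The tangent inequality bounds increments of [info] from below, so [sqrt_path_le] is applied to
   the opposite function. *)
suff : - info mu (V 1) - - info mu (V 0) <= c.
  rewrite info_V1 info_V0 /c; lra.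
apply: (@sqrt_path_le _ (fun t => - info mu (V t)) c ((\sum_k E k) / 2)).
  by rewrite divr_ge0// sumr_ge0.
move=> t t' t0 tt' t1'.
have := info_tangent_coef (coef t) (coef t') sqint_gu; rewrite -/(V t) -/(V t').
set a := Num.sqrt t' - _; set b := Num.sqrt (1 - t') - _.
have s1 : Num.sqrt t ^+ 2 = t by rewrite sqr_sqrtr.
have s2 : Num.sqrt t' ^+ 2 = t' by rewrite sqr_sqrtr// (le_trans t0).
have s3 : Num.sqrt (1 - t) ^+ 2 = 1 - t by rewrite sqr_sqrtr// subr_ge0 (le_trans tt').
have s4 : Num.sqrt (1 - t') ^+ 2 = 1 - t' by rewrite sqr_sqrtr// subr_ge0.
have -> : \sum_k coef t k * (coef t' k - coef t k) *
     \int[Q]_w avg mu (V t) (gu k) (obs (V t) w) ^+ 2 =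
   (t' - t) / 2 * (\sum_(k | isedge k) A t k - \sum_(k | ~~ isedge k) A t k) -
   (a ^+ 2 / 2 * (\sum_(k | isedge k) A t k) + b ^+ 2 / 2 * (\sum_(k | ~~ isedge k) A t k)).
  rewrite (bigID (@isedge n))/=.
  rewrite (eq_bigr (fun k => ((t' - t) / 2 - a ^+ 2 / 2) * A t k)); last first.
    move=> k ek; rewrite /A /coef ek; congr (_ * _).
    by rewrite -[in RHS]s1 -[in RHS]s2 /a; field.
  rewrite [X in _ + X](eq_bigr (fun k => (- (t' - t) / 2 - b ^+ 2 / 2) * A t k)); last first.
    move=> k /negbTE ek; rewrite /A /coef ek; congr (_ * _).
    have -> : t' - t = Num.sqrt (1 - t) ^+ 2 - Num.sqrt (1 - t') ^+ 2 by rewrite s3 s4; ring.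
    by rewrite /b; field.
  by rewrite -!mulr_sumr; field.
have h1 : \sum_(k | ~~ isedge k) A t k - \sum_(k | isedge k) A t k <= 2 * c.
  rewrite /A -!Rint_sum -?RintB//; try by [apply: intg_sum]; try by move=> k _; exact: iA.
  have -> : 2 * c = \int[Q]_w (lam * n%:R / 2 * r ^+ 4 + lam * B ^+ 4 / 2).
    by rewrite Rint_cst /c; field.
  apply: Rint_le => [||w]; last exact: bracket.
  - by apply: intgB; apply: intg_sum => k _; exact: iA.
  - exact: intg_cst.
have hs : \sum_k E k = \sum_(k | isedge k) E k + \sum_(k | ~~ isedge k) E k.
  by rewrite (bigID (@isedge n)).
have h2 : \sum_(k | isedge k) A t k <= \sum_k E k.
  by rewrite hs (le_trans (ler_sum _ (fun k _ => AE t k)))// lerDl sumr_ge0.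
have h3 : \sum_(k | ~~ isedge k) A t k <= \sum_k E k.
  by rewrite hs (le_trans (ler_sum _ (fun k _ => AE t k)))// lerDr sumr_ge0.
have k1 := ler_wpM2l (sqr_ge0 a) h2; have k2 := ler_wpM2l (sqr_ge0 b) h3.
have tt0 : 0 <= t' - t by rewrite subr_ge0.
have k3 := ler_wpM2l tt0 h1.
move: k1 k2 k3; set X := \sum_(k | isedge k) A t k; set Y := \sum_(k | ~~ _) A t k.
set Z := \sum_k E k; move: (a ^+ 2) (b ^+ 2) (info _ _) (info _ _) => a2 b2 i1 i2.
lra.
Qed.

End finite_lower_bound.

(** * Discretisation of the signal and auxiliary estimates *)

Section finite_approximation.
Import HBSimple.
Context {R : realType} (P0 : probability R R).

Lemma finite_rangeP (g : R -> R) : finite_set (range g) -> measurable_fun setT g ->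
  exists (T : finType) (kap : R -> T) (sv : T -> R),
    (forall t, measurable (kap @^-1` [set t])) /\ forall x, g x = sv (kap x).
Proof.
move=> /finite_seqP[r rE] mg.
have inT x : g x \in r.
  have : range g (g x) by exists x.
  by rewrite rE.
pose kap x : seq_sub r := SeqSub (inT x).
exists (seq_sub r : finType), kap, (fun t => ssval t); split => // t.
have -> : kap @^-1` [set t] = g @^-1` [set ssval t].
  by apply/seteqP; split => x /=; [move=> <-|move=> h; exact: val_inj].
by rewrite -[X in measurable X]setTI; exact: mg.
Qed.

(** Simple functions converging to the identity, set to 0 where they exceed [2 * |x|], still
    converge, and their squared error is dominated by [9 * x ^ 2]. *)
Lemma finite_approximation (eta : R) : 0 < eta -> intg P0 (fun x => x ^+ 2) ->
  exists (T : finType) (kap : R -> T) (sv : T -> R),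
    (forall t, measurable (kap @^-1` [set t])) /\
    \int[P0]_x (x - fT kap sv x) ^+ 2 <= eta.
Proof.
move=> eta0 ix2.
have [g gcv] := @approximation_sfun _ R R (EFin : R -> \bar R) setT measurableT
  (EFin_measurable (D := setT)).
pose f n x := if `|g n x| <= 2 * `|x| then g n x else 0.
have mf n : measurable_fun setT (f n).
  apply: measurable_fun_ifT => //.
  apply: measurable_fun_ler; last by apply: measurable_funM => //; exact: measurableT_comp.
  by apply: measurableT_comp => //; exact: measurable_funPT.
have ff n : finite_set (range (f n)).
  apply: (@sub_finite_set _ _ (range (g n) `|` [set 0])); last first.
    by rewrite finite_setU; split; [exact: fimfunP|exact: finite_set1].
  by move=> _ [x _ <-]; rewrite /f; case: ifP => _; [left; exists x|right].
have fle n x : `|f n x| <= 2 * `|x|.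
  by rewrite /f; case: ifP => // _; rewrite normr0 mulr_ge0.
have fcv x : f n x @[n --> \oo] --> x.
  have /fine_cvgP[_ gx] := gcv x Logic.I.
  have [->|x0] := eqVneq x 0.
    have f0 n : f n 0 = 0.
      by apply/eqP; rewrite -normr_eq0 eq_le normr_ge0 andbT; have := fle n 0; rewrite normr0 mulr0.
    by under eq_fun do rewrite f0; exact: cvg_cst.
  apply/cvgrPdist_le => e e0.
  have xp : 0 < `|x| by rewrite normr_gt0.
  near=> n.
  (* Within distance [|x|] of [x] the truncation is inactive. *)
  have h1 : `|x - g n x| <= `|x|.
    by near: n; move/cvgrPdist_le : gx => /(_ _ xp).
  have h2 : `|x - g n x| <= e.
    by near: n; move/cvgrPdist_le : gx => /(_ _ e0).
  rewrite /f ifT//.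
  have := ler_normB x (x - g n x); rewrite opprB addrC subrK; lra.
have [] := @dominated_convergence _ _ _ P0 setT measurableT
  (fun n x => ((x - f n x) ^+ 2)%:E) (fun=> 0%E) (fun x => (9 * x ^+ 2)%:E).
- move=> n; apply/measurable_EFinP; apply: measurable_funX; exact: measurable_funB.
- by [].
- apply: aeW => x _; apply: cvg_EFin; first by near=> n.
  rewrite [X in X @ _ --> _](_ : _ = fun n => (x - f n x) * (x - f n x)); last first.
    by apply/funext => n /=; rewrite expr2.
  rewrite [X in _ --> X](_ : _ = (x - x) * (x - x)); last by rewrite subrr mul0r.
  by apply: cvgM; apply: cvgB => //; exact: cvg_cst.
- exact: (intgZ 9 ix2).
- apply: aeW => x n _; rewrite abse_EFin lee_fin ger0_norm ?sqr_ge0//.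
  have -> : 9 * x ^+ 2 = (3 * `|x|) ^+ 2.
    by rewrite exprMn -normrX ger0_norm ?sqr_ge0//; ring.
  rewrite -[leLHS]ger0_norm ?sqr_ge0// normrX lerXn2r ?nnegrE ?mulr_ge0//.
  by have := ler_normB x (f n x); have := fle n x; lra.
move=> _ _; rewrite integral0 => /fine_cvgP[_ cv].
have [n hn] : exists n, \int[P0]_x (x - f n x) ^+ 2 <= eta.
  have /cvgrPdist_le /(_ _ eta0) [N _ /(_ N (leqnn N))] := cv.
  rewrite sub0r normrN => h; exists N; apply: le_trans h; exact: ler_norm.
have [T [kap [sv [mkap fE]]]] := finite_rangeP (ff n) (mf n).
exists T, kap, sv; split => //; apply: le_trans hn.
by rewrite le_eqVlt; apply/orP; left; apply/eqP; apply: eq_Rint => x; rewrite fE.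
Unshelve. all: by end_near.
Qed.

End finite_approximation.

Section growth.
Context {R : realType}.

Lemma affine_sqrt_growth (C D eps : R) : 0 < eps ->
  \forall n \near \oo, C + Num.sqrt n%:R * D <= n%:R * eps.
Proof.
move=> eps0; pose K := 1 + (`|C| + `|D|) / eps.
have K1 : 1 <= K by rewrite lerDl divr_ge0// ?ltW// addr_ge0.
near=> n.
have hn : K ^+ 2 <= n%:R by near: n; exact: nbhs_infty_ger.
have hq : K <= Num.sqrt n%:R.
  by rewrite -[K]ger0_norm ?(le_trans ler01)// -sqrtr_sqr ler_wsqrtr.
have nE : n%:R = Num.sqrt n%:R ^+ 2 :> R by rewrite sqr_sqrtr.
rewrite [in leRHS]nE; move: hq; set q := Num.sqrt _ => hq.
have q1 : 1 <= q by exact: le_trans hq.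
have h1 : `|C| + `|D| <= q * eps.
  rewrite -ler_pdivrMr//; apply: le_trans hq; rewrite /K lerDr//.
have h2 : q * (`|C| + `|D|) <= q * (q * eps) by rewrite ler_wpM2l// (le_trans _ q1).
rewrite expr2 -mulrA; apply: le_trans h2; rewrite mulrDr; apply: lerD.
  by rewrite (le_trans (ler_norm _))// ler_peMl.
by rewrite ler_wpM2l ?ler_norm// (le_trans _ q1).
Unshelve. all: by end_near. Qed.

(** An equally spaced grid of overlaps [g j], turned into amplitudes by the inverse of the signed
    square. *)
Lemma signed_square_grid (M delta : R) : 0 <= M -> 0 < delta ->
  exists (L : nat) (rr : 'I_L -> R), (0 < L)%N /\
    forall z, `|z| <= M -> exists j, `|rr j * `|rr j| - z| <= delta.
Proof.
move=> M0 d0.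
pose L := (Num.truncn (2 * M / delta)).+1.
pose g j : R := - M + j%:R * delta.
exists L, (fun j : 'I_L => Num.sg (g j) * Num.sqrt `|g j|); split => // z zM.
have zM0 : 0 <= z + M by move: zM; rewrite ler_norml => /andP[]; lra.
have v0 : 0 <= (z + M) / delta by rewrite divr_ge0// ltW.
have hj : (Num.truncn ((z + M) / delta) < L)%N.
  rewrite ltnS; apply: le_truncn; rewrite ler_pM2r ?invr_gt0//.
  by move: zM; rewrite ler_norml => /andP[]; lra.
exists (Ordinal hj) => /=; set k := Num.truncn _.
have -> : Num.sg (g k) * Num.sqrt `|g k| * `|Num.sg (g k) * Num.sqrt `|g k| | = g k.
  rewrite normrM [`|Num.sqrt _|]ger0_norm ?sqrtr_ge0//.
  rewrite mulrACA -expr2 sqr_sqrtr// normr_sg.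
  have [->|gk] := eqVneq (g k) 0; first by rewrite normr0 mulr0.
  by rewrite mulr1 -numEsg.
have /andP[h1 h2] : k%:R <= (z + M) / delta < k.+1%:R by exact: truncn_itv.
rewrite ler_pdivlMr// in h1; rewrite ltr_pdivrMr// -natr1 mulrDl mul1r in h2.
by rewrite /g ler_norml; apply/andP; split; lra.
Qed.

End growth.

Section info_bounds.
Context {R : realType} d (S : measurableType d) (mu : probability S R) (m : nat).
Implicit Types U : 'I_m -> S -> R.
Local Notation Q := (mu \x iprod (stdn R) m)%E.

Lemma sqint0 : sqint mu (fun (_ : 'I_m) => fun=> 0).
Proof. by move=> k; split => //; rewrite expr0n/=; exact: intg_cst. Qed.

Lemma info0 : info mu (fun (_ : 'I_m) => fun=> 0) = 0.
Proof.
rewrite -[RHS](Rint_cst Q 0); apply: eq_Rint => w.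
rewrite (_ : dens _ _ _ = 1) ?ln1// -[RHS](Rint_cst mu 1); apply: eq_Rint => s.
by rewrite /wt big1 ?expR0// => k _; rewrite mul0r expr0n/= mul0r subrr.
Qed.

(** The tangent inequality from [U] to the null signal, whose information is 0; by Nishimori's
    identity its linear term is minus the second moment of the posterior means. *)
Lemma info_le_sqr U : sqint mu U -> info mu U <= \sum_(k < m) \int[mu]_s U k s ^+ 2.
Proof.
move=> hU; have := info_tangent hU sqint0; rewrite info0 -lerBrDr sub0r -sumrN.
move=> h; apply: (le_trans h); apply: ler_sum => k _.
have [mUk iU] := hU k.
apply: le_trans (Rint_avg_sqr_obs_le (sqintW hU) mUk iU).
rewrite le_eqVlt; apply/orP; left; apply/eqP.
have ia := intg_avg_sqr_obs (sqintW hU) mUk iU.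
have mav := measurable_avg (sqintW hU) (sqint_intg k hU).
have -> : \int[Q]_w avg mu U (U k) (obs U w) ^+ 2 =
    \int[Q]_w (avg mu U (U k) (obs U w) * U k w.1).
  rewrite (nishimori (sqintW hU) mav mUk ia iU).
  by apply: eq_Rint => w; rewrite expr2.
rewrite -[LHS]mulN1r -RintZ.
  by apply: eq_Rint => w; ring.
by apply: (eq_intg _ (intg_tangent k hU sqint0)) => w; ring.
Qed.

End info_bounds.

(** * The free energy limit for a square integrable prior *)

Section channel_comparison.
Context {R : realType} (P0 : probability R R).
Variables (g h : R -> R) (K theta : R).
Hypotheses (mg : measurable_fun setT g) (mh : measurable_fun setT h).
Hypotheses (ig : intg P0 (fun x => g x ^+ 2)) (ih : intg P0 (fun x => h x ^+ 2)).
Hypotheses (gK : \int[P0]_x g x ^+ 2 <= K) (hK : \int[P0]_x h x ^+ 2 <= K).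
Hypotheses (theta0 : 0 < theta) (gh : \int[P0]_x (h x - g x) ^+ 2 <= theta ^+ 2).

Let igh : intg P0 (fun x => (h x - g x) ^+ 2).
Proof.
apply: (@intg_dom _ _ _ _ _ (fun x => 2 * h x ^+ 2 + 2 * g x ^+ 2)).
- by apply: measurable_funX; exact: measurable_funB.
- by apply: intgD; exact: intgZ.
- by move=> x; rewrite ger0_norm ?sqr_ge0//; have := sqr_ge0 (h x + g x); nra.
Qed.

Let K0 : 0 <= K.
Proof. by apply: le_trans gK; apply: Rint_ge0 => x; exact: sqr_ge0. Qed.

(** The choice [e = theta] in [info_compare] balances its two error terms. *)
Lemma info1_compare (c : R) :
  info1 P0 (fun x => c * g x) - c ^+ 2 * (theta * (K + 1)) <= info1 P0 (fun x => c * h x).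
Proof.
have hg : sqint P0 (fun (_ : 'I_1) => fun x => c * g x).
  exact: (@sqintZ _ _ _ _ _ (fun=> c) (fun _ : 'I_1 => g)).
have hh : sqint P0 (fun (_ : 'I_1) => fun x => c * h x).
  exact: (@sqintZ _ _ _ _ _ (fun=> c) (fun _ : 'I_1 => h)).
apply: le_trans (info_compare theta0 hg hh); rewrite lerD2l lerN2 !big_ord1.
have -> : \int[P0]_s (c * g s) ^+ 2 = c ^+ 2 * \int[P0]_s g s ^+ 2.
  by rewrite -RintZ//; apply: eq_Rint => x; rewrite exprMn.
have -> : \int[P0]_s (c * h s - c * g s) ^+ 2 = c ^+ 2 * \int[P0]_s (h s - g s) ^+ 2.
  by rewrite -RintZ//; apply: eq_Rint => x; rewrite -mulrBr exprMn.
have h1 : theta * (c ^+ 2 * \int[P0]_s g s ^+ 2) <= theta * (c ^+ 2 * K).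
  by rewrite ler_pM2l// ler_wpM2l ?sqr_ge0.
have h2 : theta^-1 * (c ^+ 2 * \int[P0]_s (h s - g s) ^+ 2) <= theta^-1 * (c ^+ 2 * theta ^+ 2).
  by rewrite ler_pM2l ?invr_gt0// ler_wpM2l ?sqr_ge0.
apply: (le_trans (lerD h1 h2)); rewrite le_eqVlt; apply/orP; left; apply/eqP.
by field; rewrite gt_eqF.
Qed.

Lemma card_edge n : #|edge n|%:R = (n%:R ^+ 2 - n%:R) / 2 :> R.
Proof.
have := @sum_edge R n (fun _ _ => 1) (fun _ _ => erefl).
rewrite !sumr_const !card_ord => ->.
by rewrite -[_ *+ n]mulr_natl expr2.
Qed.

Lemma info_edge_compare n (lam : R) : 0 <= lam -> (0 < n)%N ->
  info (iprod P0 n) (Uedge lam g) - n%:R * (lam / 2 * (K ^+ 2 + 4 * K) * theta) <=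
  info (iprod P0 n) (Uedge lam h).
Proof.
move=> lam0 n0; have np : 0 < n%:R :> R by rewrite ltr0n.
have ln0 : 0 <= lam / n%:R by rewrite divr_ge0.
have hg := sqint_Uedge (n := n) lam mg ig; have hh := sqint_Uedge (n := n) lam mh ih.
apply: le_trans (info_compare theta0 hg hh); rewrite lerD2l lerN2.
have neE : #|edge n|%:R * (lam / n%:R) <= n%:R * lam / 2.
  rewrite card_edge.
  have -> : (n%:R ^+ 2 - n%:R) / 2 * (lam / n%:R) = n%:R * lam / 2 - lam / 2.
    by field; rewrite gt_eqF.
  lra.
have sumle (F : 'I_#|edge n| -> R) M : 0 <= M -> (forall k, F k <= lam / n%:R * M) ->
    \sum_k F k <= n%:R * lam / 2 * M.
  move=> M0 FM; apply: (@le_trans _ _ (\sum_(k < #|edge n|) lam / n%:R * M)); first exact: ler_sum.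
  rewrite sumr_const card_ord -[_ *+ _]mulr_natl mulrA.
  by rewrite ler_wpM2r.
have h1 : \sum_k \int[iprod P0 n]_s Uedge lam g k s ^+ 2 <= n%:R * lam / 2 * K ^+ 2.
  apply: sumle; first exact: sqr_ge0.
  move=> k; have [i1 E1] := Rint_uedge_mul k ig ig.
  have -> : \int[iprod P0 n]_s Uedge lam g k s ^+ 2 =
      lam / n%:R * (\int[P0]_x g x ^+ 2) ^+ 2.
    rewrite [in RHS]expr2 -E1 -RintZ//; apply: eq_Rint => s.
    by rewrite /Uedge /uedge /eu !exprMn sqr_sqrtr.
  rewrite ler_wpM2l// lerXn2r ?nnegrE//.
  by apply: Rint_ge0 => x; exact: sqr_ge0.
have h2 : \sum_k \int[iprod P0 n]_s (Uedge lam h k s - Uedge lam g k s) ^+ 2 <=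
    n%:R * lam / 2 * (4 * K * theta ^+ 2).
  apply: sumle; first by rewrite mulr_ge0 ?sqr_ge0// mulr_ge0.
  move=> k; have [i1 E1] := Rint_uedge_mul k ih igh.
  have [i2 E2] := Rint_uedge_mul k igh ig.
  set k1 := (val (enum_val k)).1 in i1 E1 i2 E2; set k2 := (val (enum_val k)).2 in i1 E1 i2 E2.
  have iU : intg (iprod P0 n) (fun s => (Uedge lam h k s - Uedge lam g k s) ^+ 2).
    have [m1 j1] := hg k; have [m2 j2] := hh k.
    apply: (@intg_dom _ _ _ _ _ (fun s => 2 * Uedge lam h k s ^+ 2 + 2 * Uedge lam g k s ^+ 2)).
    - by apply: measurable_funX; exact: measurable_funB.
    - by apply: intgD; exact: intgZ.
    - move=> s; rewrite ger0_norm ?sqr_ge0//.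
      by have := sqr_ge0 (Uedge lam h k s + Uedge lam g k s); nra.
  apply: (@le_trans _ _ (lam / n%:R * (2 * (\int[P0]_x h x ^+ 2 * \int[P0]_x (h x - g x) ^+ 2) +
      2 * (\int[P0]_x (h x - g x) ^+ 2 * \int[P0]_x g x ^+ 2)))).
    rewrite -E1 -E2 -!RintZ// -RintD; [|exact: intgZ|exact: intgZ].
    rewrite -RintZ; last by apply: intgD; exact: intgZ.
    apply: Rint_le => //; first by apply: intgZ; apply: intgD; exact: intgZ.
    move=> s; rewrite /Uedge /uedge /eu -/k1 -/k2 -mulrBr exprMn sqr_sqrtr// ler_wpM2l//.
    set a := h _; set b := h _; set c := g _; set d := g _.
    (* Here [a * b - c * d = a * (b - d) + (a - c) * d], and the square of a sum is at most twice
       the sum of the squares. *)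
    have := sqr_ge0 (a * (b - d) - (a - c) * d); nra.
  rewrite ler_wpM2l//.
  have Ih : 0 <= \int[P0]_x h x ^+ 2 by apply: Rint_ge0 => x; exact: sqr_ge0.
  have Ig : 0 <= \int[P0]_x g x ^+ 2 by apply: Rint_ge0 => x; exact: sqr_ge0.
  have Id : 0 <= \int[P0]_x (h x - g x) ^+ 2 by apply: Rint_ge0 => x; exact: sqr_ge0.
  have p1 := ler_pM Ih Id hK gh; have p2 := ler_pM Id Ig gh gK.
  lra.
have t1 := ler_wpM2l (ltW theta0) h1.
have ti : 0 <= theta^-1 by rewrite invr_ge0 ltW.
have t2 := ler_wpM2l ti h2.
apply: (le_trans (lerD t1 t2)); rewrite le_eqVlt; apply/orP; left; apply/eqP.
by field; rewrite gt_eqF.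
Qed.

End channel_comparison.

Section information_limit.
Context {R : realType} (P0 : probability R R).
Hypothesis ix2 : intg P0 (fun x => x ^+ 2).
Variable lam : R.
Hypothesis lam0 : 0 < lam.

(** Information of the scalar channel at signal-to-noise ratio [s]; [pot] is [potential] rewritten
    through it. *)
Definition psi (s : R) : R := info1 P0 (fun x => Num.sqrt s * x).
Definition pot (q : R) : R := - (lam / 4) * q ^+ 2 + psi (lam * q).

Local Notation J n := (info (iprod P0 n) (Uedge (n := n) lam (fun x => x))).

Lemma psi0 : psi 0 = 0.
Proof.
rewrite /psi /info1 sqrtr0.
have -> : (fun _ : 'I_1 => fun x : R => 0 * x) = fun _ => fun=> 0.
  by apply/funext => i; apply/funext => x; rewrite mul0r.
exact: info0.
Qed.

Lemma pot0 : pot 0 = 0.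
Proof. by rewrite /pot mulr0 psi0 expr0n/= mulr0 addr0. Qed.

Section finite.
Variables (T : finType) (kap : R -> T) (sv : T -> R).
Hypothesis mkap : forall t, measurable (kap @^-1` [set t]).
Local Notation f := (fT kap sv).

Let mf := measurable_fT sv mkap.
Let if2 := intg_fT_sqr P0 sv mkap.

Lemma info_edge_upper Phi eps : 0 < eps ->
  (forall r, - (lam / 4) * r ^+ 4 + info1 P0 (fun x => Num.sqrt lam * `|r| * f x) <= Phi) ->
  \forall n \near \oo, info (iprod P0 n) (Uedge (n := n) lam f) <= n%:R * (Phi + eps).
Proof.
move=> eps0 hPhi.
pose B := fbnd sv; have svB t : `|sv t| <= B := fbnd_ge sv t.
(* The rounding error [lam * delta ^ 2 / 2] is then [eps / 2]; the other half absorbs [ln L], the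
   diagonal terms and the fluctuations of order [sqrt n]. *)
pose delta := Num.sqrt (eps / lam).
have delta0 : 0 < delta by rewrite sqrtr_gt0 divr_gt0.
have delta2 : lam * delta ^+ 2 = eps.
  by rewrite sqr_sqrtr; [field; rewrite gt_eqF|rewrite divr_ge0// ltW].
have [L [rr [L0 hgrid]]] := signed_square_grid (sqr_ge0 B) delta0.
pose D := \sum_j ((\int[(P0 \x stdn R)%E]_w (szeta P0 kap sv lam (rr j) w -
       \int[(P0 \x stdn R)%E]_u szeta P0 kap sv lam (rr j) u) ^+ 2 + 1) / 2).
have e2 : 0 < eps / 2 by rewrite divr_gt0.
near=> n.
have n0 : (0 < n)%N by near: n; exact: nbhs_infty_gt.
have h : ln L%:R + lam * B ^+ 4 / 4 + Num.sqrt n%:R * D <= n%:R * (eps / 2).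
  by near: n; exact: affine_sqrt_growth.
have := info_edge_le mkap (ltW lam0) n0 L0 (fun j => hPhi (rr j)) svB hgrid.
rewrite -/D (mulrAC lam n%:R) delta2.
move: h; set q := Num.sqrt _ * D; set b4 := lam * B ^+ 4; set I := info _ _; lra.
Unshelve. all: by end_near. Qed.

End finite.

Let rho := \int[P0]_x (x : R) ^+ 2.
(** Bounds the second moments of [x] and of its approximations [f], since
    [f ^ 2 <= 2 * x ^ 2 + 2 * (x - f) ^ 2] and [theta <= 1]. *)
Let K := 2 * rho + 2.
Let rho0 : 0 <= rho. Proof. by apply: Rint_ge0 => x; exact: sqr_ge0. Qed.
Let K0 : 0 <= K. Proof. by rewrite addr_ge0// mulr_ge0. Qed.
Let rK : \int[P0]_x (x : R) ^+ 2 <= K.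
Proof. by rewrite -/rho /K mulr_natl mulr2n -addrA lerDl addr_ge0. Qed.
Let mid : measurable_fun setT (fun x : R => x). Proof. exact: measurable_id. Qed.

Let approx theta : 0 < theta <= 1 -> exists (T : finType) (kap : R -> T) (sv : T -> R),
  [/\ forall t, measurable (kap @^-1` [set t]),
      \int[P0]_x fT kap sv x ^+ 2 <= K &
      \int[P0]_x (x - fT kap sv x) ^+ 2 <= theta ^+ 2].
Proof.
move=> /andP[t0 t1].
have [T [kap [sv [mkap h]]]] := finite_approximation (exprn_gt0 2 t0) ix2.
exists T, kap, sv; split => //.
have if2 := intg_fT_sqr P0 sv mkap; have mf := measurable_fT sv mkap.
have id2 : intg P0 (fun x : R => (x - fT kap sv x) ^+ 2).
  apply: (@intg_dom _ _ _ P0 _ (fun x : R => 2 * x ^+ 2 + 2 * fT kap sv x ^+ 2)).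
  - by apply: measurable_funX; exact: measurable_funB.
  - by apply: intgD; exact: intgZ.
  - by move=> x; rewrite ger0_norm ?sqr_ge0//; have := sqr_ge0 (x + fT kap sv x); nra.
apply: (@le_trans _ _ (\int[P0]_x (2 * (x : R) ^+ 2 + 2 * (x - fT kap sv x) ^+ 2))).
  apply: Rint_le => //; first by apply: intgD; exact: intgZ.
  by move=> x; have := sqr_ge0 (2 * x - fT kap sv x); nra.
rewrite RintD; [|exact: intgZ|exact: intgZ]; rewrite !RintZ// -/rho /K.
have : theta ^+ 2 <= 1 by rewrite expr_le1// ltW.
lra.
Qed.

Let small (M eps : R) : 0 <= M -> 0 < eps -> exists theta, 0 < theta <= 1 /\ M * theta <= eps.
Proof.
move=> M0 e0; have M1 : 0 < M + 1 by lra.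
exists (Num.min 1 (eps / (M + 1))); split.
  by rewrite lt_min ltr01 divr_gt0//= ge_min lexx.
apply: (@le_trans _ _ (M * (eps / (M + 1)))).
  by rewrite ler_wpM2l// ge_min lexx orbT.
by rewrite mulrA ler_pdivrMr// [leRHS]mulrC ler_wpM2r ?ltW// ltrDl.
Qed.

Lemma info_edge_limsup Phi eps : 0 < eps -> (forall q, 0 <= q -> pot q <= Phi) ->
  \forall n \near \oo, J n <= n%:R * (Phi + eps).
Proof.
move=> eps0 hPhi.
have K1 : 0 <= K + 1 by rewrite addr_ge0.
pose M := 4 * lam * K * (K + 1) + lam / 2 * (K ^+ 2 + 4 * K).
have M1 : 0 <= 4 * lam * K * (K + 1).
  by rewrite mulr_ge0// mulr_ge0// mulr_ge0// ltW.
have M2 : 0 <= lam / 2 * (K ^+ 2 + 4 * K).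
  by rewrite mulr_ge0//; [rewrite divr_ge0// ltW|rewrite addr_ge0 ?sqr_ge0// mulr_ge0].
have [theta [t01 tM]] : exists theta, 0 < theta <= 1 /\ M * theta <= eps / 2.
  by apply: small; [exact: addr_ge0|rewrite divr_gt0].
have [t0 t1] := andP t01.
have [T [kap [sv [mkap fK fth]]]] := approx t01.
have if2 := intg_fT_sqr P0 sv mkap; have mf := measurable_fT sv mkap.
have hf r : - (lam / 4) * r ^+ 4 + info1 P0 (fun x => Num.sqrt lam * `|r| * fT kap sv x) <=
    Phi + 4 * lam * K * (K + 1) * theta.
  have Phi0 : 0 <= Phi by rewrite -pot0 hPhi.
  have c2 : (Num.sqrt lam * `|r|) ^+ 2 = lam * r ^+ 2.
    by rewrite exprMn sqr_sqrtr ?ltW// -normrX ger0_norm ?sqr_ge0.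
  have r4 : r ^+ 4 = r ^+ 2 * r ^+ 2 by rewrite -exprD.
  have r20 := sqr_ge0 r.
  (* The comparison error grows with [r ^ 2]. Beyond [4 * K] the crude bound [lam * r ^ 2 * K] on
     the information makes the left side nonpositive, and [Phi] is at least [pot 0 = 0]. *)
  have [r2|r2] := leP (4 * K) (r ^+ 2).
    have h1 : info1 P0 (fun x => Num.sqrt lam * `|r| * fT kap sv x) <= lam * r ^+ 2 * K.
      have hs : sqint P0 (fun (_ : 'I_1) => fun x => Num.sqrt lam * `|r| * fT kap sv x).
        exact: (@sqintZ _ _ _ _ _ (fun=> _) (fun _ : 'I_1 => fT kap sv)).
      apply: (le_trans (info_le_sqr hs)); rewrite big_ord1.
      rewrite (eq_Rint _ (g := fun x => lam * r ^+ 2 * fT kap sv x ^+ 2)).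
        by rewrite RintZ// ler_wpM2l// mulr_ge0// ltW.
      by move=> x; rewrite exprMn c2.
    have h2 : lam * r ^+ 2 * (4 * K) <= lam * r ^+ 2 * r ^+ 2.
      by rewrite ler_wpM2l// mulr_ge0// ltW.
    have h3 : 0 <= 4 * lam * K * (K + 1) * theta by rewrite mulr_ge0// ltW.
    rewrite r4; lra.
  have := info1_compare mf mid if2 ix2 fK t0 fth (Num.sqrt lam * `|r|).
  rewrite c2 => h1.
  have h2 : lam * r ^+ 2 * (theta * (K + 1)) <= 4 * lam * K * (K + 1) * theta.
    have -> : 4 * lam * K * (K + 1) * theta = lam * (4 * K) * (theta * (K + 1)) by ring.
    rewrite ler_wpM2r//; first by rewrite mulr_ge0 // ltW.
    by rewrite ler_wpM2l ?ltW.
  have := hPhi _ r20; rewrite /pot /psi.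
  have -> : Num.sqrt (lam * r ^+ 2) = Num.sqrt lam * `|r| by rewrite sqrtrM ?ltW// sqrtr_sqr.
  have -> : (r ^+ 2) ^+ 2 = r ^+ 4 by rewrite -exprM.
  move: h1 h2; set i1 := info1 _ (fun x => _ * fT kap sv x); set i2 := info1 _ (fun x => _ * x).
  move: (lam * r ^+ 2 * _) (4 * lam * K * _ * _) (r ^+ 4) => a1 a2 a3.
  lra.
have e2 : 0 < eps / 2 by rewrite divr_gt0.
near=> n.
have n0 : (0 < n)%N by near: n; exact: nbhs_infty_gt.
have h1 : info (iprod P0 n) (Uedge (n := n) lam (fT kap sv)) <=
    n%:R * (Phi + 4 * lam * K * (K + 1) * theta + eps / 2).
  by near: n; exact: info_edge_upper.
have fth' : \int[P0]_x (fT kap sv x - x) ^+ 2 <= theta ^+ 2.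
  rewrite (eq_Rint P0 (g := fun x : R => (x - fT kap sv x) ^+ 2))// => x.
  by rewrite -sqrrN opprB.
have h2 := info_edge_compare mid mf ix2 if2 rK fK t0 fth' (ltW lam0) n0.
have h3 : n%:R * (M * theta) <= n%:R * (eps / 2) by rewrite ler_wpM2l.
move: h1 h2 h3; rewrite /M; set I1 := info _ _; set I2 := info _ _.
set m1 := 4 * lam * K * (K + 1); set m2 := lam / 2 * _; lra.
Unshelve. all: by end_near. Qed.

Lemma info_edge_liminf q eps : 0 < eps -> 0 <= q ->
  \forall n \near \oo, n%:R * (pot q - eps) <= J n.
Proof.
move=> eps0 q0.
have K1 : 0 <= K + 1 by rewrite addr_ge0.
pose M := lam * q * (K + 1) + lam / 2 * (K ^+ 2 + 4 * K).
have M1 : 0 <= lam * q * (K + 1).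
  by rewrite mulr_ge0// mulr_ge0// ltW.
have M2 : 0 <= lam / 2 * (K ^+ 2 + 4 * K).
  by rewrite mulr_ge0//; [rewrite divr_ge0// ltW|rewrite addr_ge0 ?sqr_ge0// mulr_ge0].
have [theta [t01 tM]] : exists theta, 0 < theta <= 1 /\ M * theta <= eps / 2.
  by apply: small; [exact: addr_ge0|rewrite divr_gt0].
have [t0 t1] := andP t01.
have [T [kap [sv [mkap fK fth]]]] := approx t01.
have if2 := intg_fT_sqr P0 sv mkap; have mf := measurable_fT sv mkap.
have fth' : \int[P0]_x (fT kap sv x - x) ^+ 2 <= theta ^+ 2.
  rewrite (eq_Rint P0 (g := fun x : R => (x - fT kap sv x) ^+ 2))// => x.
  by rewrite -sqrrN opprB.
pose B := fbnd sv; have svB t : `|sv t| <= B := fbnd_ge sv t.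
have e2 : 0 < eps / 2 by rewrite divr_gt0.
near=> n.
have n0 : (0 < n)%N by near: n; exact: nbhs_infty_gt.
have h0 : lam * B ^+ 4 / 4 + Num.sqrt n%:R * 0 <= n%:R * (eps / 2).
  by near: n; exact: affine_sqrt_growth.
have h1 := info_edge_ge P0 mkap (Num.sqrt q) n0 (ltW lam0) svB.
have h2 := info_edge_compare mf mid if2 ix2 fK rK t0 fth (ltW lam0) n0.
have h3 := info1_compare mid mf ix2 if2 rK t0 fth' (Num.sqrt lam * Num.sqrt q).
have h4 : n%:R * (M * theta) <= n%:R * (eps / 2) by rewrite ler_wpM2l.
have q4 : Num.sqrt q ^+ 4 = q ^+ 2 by rewrite (exprM _ 2 2) sqr_sqrtr.
have c2 : (Num.sqrt lam * Num.sqrt q) ^+ 2 = lam * q by rewrite exprMn !sqr_sqrtr// ltW.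
rewrite /pot /psi (sqrtrM _ (ltW lam0)); rewrite q4 in h1; rewrite c2 in h3.
have h5 := ler_wpM2l (ler0n R n) h3.
move: h0 h1 h2 h4 h5; rewrite mulr0 addr0 /M; set I1 := info _ _; set I2 := info _ _.
set P1 := info1 _ _; set P2 := info1 _ _; set b := lam * B ^+ 4 / 4.
set m1 := lam * q * (K + 1); set m2 := lam / 2 * _.
have -> : lam * q * (theta * (K + 1)) = m1 * theta by rewrite /m1; ring.
by clearbody I1 I2 P1 P2 b m1 m2; clear -n0; lra.
Unshelve. all: by end_near. Qed.

End information_limit.

(** * The scalar channel *)

Section scalar_channel.
Context {R : realType} (P0 : probability R R).
Hypothesis ix2 : intg P0 (fun x => x ^+ 2).
Local Notation rho := (\int[P0]_x ((x : R) ^+ 2)).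
Local Notation Q1 := (P0 \x iprod (stdn R) 1)%E.

Definition usig (s : R) : 'I_1 -> R -> R := fun _ x => Num.sqrt s * x.

(* The second moment of the posterior mean at signal-to-noise ratio [s]. *)
Definition postm2 (s : R) : R :=
  \int[Q1]_w avg P0 (usig s) (fun x => x) (obs (usig s) w) ^+ 2.

Let mid : measurable_fun setT (fun x : R => x). Proof. exact: measurable_id. Qed.

Lemma sqint_id : sqint P0 (fun _ : 'I_1 => (fun x : R => x)).
Proof. by []. Qed.

Lemma sqint_usig s : sqint P0 (usig s).
Proof. exact: (sqintZ (fun=> Num.sqrt s) sqint_id). Qed.

Lemma postm2_ge0 s : 0 <= postm2 s.
Proof. by apply: Rint_ge0 => w; exact: sqr_ge0. Qed.

Lemma postm2_le s : postm2 s <= rho.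
Proof. exact: (Rint_avg_sqr_obs_le (sqintW (sqint_usig s)) mid ix2). Qed.

Lemma psi_tangent s s' : psi P0 s + Num.sqrt s * (Num.sqrt s' - Num.sqrt s) * postm2 s <= psi P0 s'.
Proof.
have := info_tangent_coef (fun=> Num.sqrt s) (fun=> Num.sqrt s') sqint_id.
by rewrite big_ord1.
Qed.

Lemma psi_le s : 0 <= s -> psi P0 s <= s * rho.
Proof.
move=> s0; apply: (le_trans (info_le_sqr (sqint_usig s))); rewrite big_ord1.
rewrite -[X in X * _](sqr_sqrtr s0) -RintZ//; apply: Rint_le => //.
- by case: (sqint_usig s ord0).
- exact: intgZ.
- by move=> x; rewrite /usig exprMn.
Qed.

Definition post (s y : R) : R := avg P0 (usig s) (fun x => x) (tuple1 y).

Lemma measurable_post s : measurable_fun setT (post s).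
Proof.
have ii : intg P0 (fun x : R => x) by exact: intg_sqr_intg.
exact: (measurableT_comp (measurable_avg (sqintW (sqint_usig s)) ii) (@measurable_tuple1 R)).
Qed.

Let measurable_sqdist (theta : R -> R) s : measurable_fun setT theta ->
  measurable_fun setT (fun w : R * R => ((w.1 - theta (Num.sqrt s * w.1 + w.2)) ^+ 2)%:E).
Proof.
move=> mt; apply/measurable_EFinP; apply: measurable_funX; apply: measurable_funB => //.
apply: (measurableT_comp mt); apply: measurable_funD => //.
exact: measurable_funM.
Qed.

Let tuple1_obs s (x z : R) : obs (usig s) (x, tuple1 z) = tuple1 (Num.sqrt s * x + z).
Proof. by apply: eq_from_tnth => i; rewrite !tnth_mktuple addrC. Qed.

Lemma scalar_mse_ge (theta : R -> R) s : measurable_fun setT theta ->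
  ((rho - postm2 s)%:E <=
    \int[(P0 \x stdn R)%E]_w ((w.1 - theta (Num.sqrt s * w.1 + w.2)) ^+ 2)%:E)%E.
Proof.
move=> mt.
have mtt : measurable_fun setT (fun y : 1.-tuple R => theta (tnth y ord0)).
  exact: (measurableT_comp mt (measurable_tnth ord0)).
apply: le_trans (ge0_integral_mse_ge (sqint_usig s) mid ix2 mtt) _.
rewrite -(law_ge0_integral (@measurable_pair_tuple1 R) (law_pair_tuple1 P0)).
- rewrite le_eqVlt; apply/orP; left; apply/eqP; apply: eq_integral => -[x z] _ /=.
  by rewrite tuple1_obs tnth_mktuple.
- apply/measurable_EFinP; apply: measurable_funX; apply: measurable_funB => //.
  exact: (measurableT_comp mtt (measurable_obs (sqintW (sqint_usig s)))).
- by move=> w; rewrite lee_fin sqr_ge0.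
Qed.

Lemma scalar_mse_post s :
  (\int[(P0 \x stdn R)%E]_w ((w.1 - post s (Num.sqrt s * w.1 + w.2)) ^+ 2)%:E =
    (rho - postm2 s)%:E)%E.
Proof.
rewrite -(integral_mse_avg (sqint_usig s) mid ix2).
rewrite -[RHS](law_ge0_integral (@measurable_pair_tuple1 R) (law_pair_tuple1 P0)).
- by apply: eq_integral => -[x z] _ /=; rewrite /post tuple1_obs.
- apply/measurable_EFinP; apply: measurable_funX; apply: measurable_funB => //.
  have ii : intg P0 (fun x : R => x) by exact: intg_sqr_intg.
  have mav := measurable_avg (sqintW (sqint_usig s)) ii.
  exact: (measurableT_comp mav (measurable_obs (sqintW (sqint_usig s)))).
- by move=> w; rewrite lee_fin sqr_ge0.
Qed.

Opaque postm2 psi.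

(* An observation at ratio [s'] can be degraded into one at ratio [s] by adding
   independent noise. *)
Lemma postm2_nondecreasing s s' : 0 < s -> s <= s' -> postm2 s <= postm2 s'.
Proof.
move=> s0 ss'; have s'0 : 0 < s' := lt_le_trans s0 ss'.
(* If [y] is an observation at ratio [s'] and [g] is fresh noise, then [a * y + b * g] is an
   observation at ratio [s]. *)
pose a := Num.sqrt (s / s'); pose b := Num.sqrt (1 - s / s').
have a0 : 0 < a by rewrite sqrtr_gt0 divr_gt0.
have ab : a ^+ 2 + b ^+ 2 = 1.
  rewrite !sqr_sqrtr ?subr_ge0 ?ler_pdivrMr ?mul1r//; first by rewrite addrC subrK.
  by rewrite divr_ge0// ltW.
have aE : a * Num.sqrt s' = Num.sqrt s.
  by rewrite -sqrtrM ?divr_ge0 ?ltW// divfK// gt_eqF.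
pose f x v := (((x - post s (Num.sqrt s * x + v)) ^+ 2)%:E : \bar R).
have mf : measurable_fun setT (fun w : R * R => f w.1 w.2).
  exact: (measurable_sqdist s (measurable_post s)).
have f0 x v : (0 <= f x v)%E by rewrite lee_fin sqr_ge0.
have mp3 : measurable_fun setT (fun w : (R * R) * R => f w.1.2 (a * w.2 + b * w.1.1)).
  have mw : measurable_fun setT (fun w : (R * R) * R => (w.1.2, a * w.2 + b * w.1.1)).
    apply: measurable_fun_pair; first exact: (measurableT_comp measurable_snd).
    apply: measurable_funD; apply: measurable_funM => //.
    exact: (measurableT_comp measurable_fst).
  exact: (measurableT_comp mf mw).
pose H (w : R * R) := (\int[stdn R]_z f w.2 (a * z + b * w.1)%R)%E.
have mH : measurable_fun setT H.
  by refine (@measurable_fun_fubini_tonelli_F _ _ _ _ _ (stdn R) _ mp3 _) => w.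
have H0 w : (0 <= H w)%E by apply: integral_ge0 => z _.
(* For each frozen value [g'] of the added noise, the degraded estimator is an estimator at ratio
   [s']. *)
have h1 g' : ((rho - postm2 s')%:E <= \int[P0]_x H (g', x))%E.
  have mt : measurable_fun setT (fun y => post s (a * y + b * g')).
    apply: (measurableT_comp (measurable_post s)).
    by apply: measurable_funD; [exact: measurable_funM|exact: measurable_cst].
  apply: (le_trans (scalar_mse_ge s' mt)).
  rewrite fubini_tonelli1; last 2 first.
  - exact: (measurable_sqdist s' mt).
  - by move=> w; rewrite lee_fin sqr_ge0.
  rewrite le_eqVlt; apply/orP; left; apply/eqP; apply: eq_integral => x _.
  rewrite /fubini_F; apply: eq_integral => z _; rewrite /f /=.
  by rewrite -aE; congr (((_ - post s _) ^+ 2)%:E); ring.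
have h2 : (\int[stdn R]_g \int[P0]_x H (g, x) = (rho - postm2 s)%:E)%E.
  rewrite (fubini_tonelli H mH H0) -scalar_mse_post.
  rewrite fubini_tonelli1; last 2 first.
  - exact: (measurable_sqdist s (measurable_post s)).
  - by move=> w; rewrite lee_fin sqr_ge0.
  apply: eq_integral => x _; rewrite /H /fubini_F.
  exact: (@ge0_integral_stdn_rotation _ _ _ (f x) a0 ab (measurableT_comp mf (pair1_measurable x)) (f0 x)).
suff : ((rho - postm2 s')%:E <= (rho - postm2 s)%:E)%E by rewrite lee_fin lerD2l lerN2.
rewrite -[X in (_ <= X)%E]h2.
have cst c : (c%:E = \int[stdn R]_g c%:E)%E.
  by rewrite -(Rint_EFin (intg_cst (stdn R) c)) Rint_cst.
rewrite [X in (X <= _)%E]cst.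
apply: ge0_le_integral.
- exact: measurableT.
- by move=> g _; rewrite lee_fin subr_ge0 postm2_le.
- exact: measurable_cst.
- by refine (@measurable_fun_fubini_tonelli_F _ _ _ _ _ P0 _ mH _).
- by move=> g _; exact: h1.
Qed.

(** Over [N] equal steps the losses add up to [c * (b - a) ^ 2 / N], which is below any drop
    [k a - k b] once [N] is large. *)
Lemma quadratic_monotone (k : R -> R) (a b c : R) : a <= b ->
  (forall r r', a <= r -> r <= r' -> r' <= b -> k r - c * (r' - r) ^+ 2 <= k r') -> k a <= k b.
Proof.
move=> ab hk; rewrite leNgt; apply/negP => kk.
pose D := c * (b - a) ^+ 2.
have [N hN] : exists N : nat, `|D| / (k a - k b) < N.+1%:R.
  exists (Num.truncn (`|D| / (k a - k b))).
  have /andP[] // : (Num.truncn (`|D| / (k a - k b)))%:R <= `|D| / (k a - k b) <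
    (Num.truncn (`|D| / (k a - k b))).+1%:R.
  by apply: truncn_itv; rewrite divr_ge0// subr_ge0 ltW.
have N0 : 0 < N.+1%:R :> R by [].
pose h := (b - a) / N.+1%:R.
have h0 : 0 <= h by rewrite divr_ge0// subr_ge0.
have hNE : N.+1%:R * h = b - a by rewrite /h mulrCA divff ?mulr1// gt_eqF.
have step i : (i <= N.+1)%N -> k a - i%:R * (c * h ^+ 2) <= k (a + i%:R * h).
  elim: i => [_|i ih iN]; first by rewrite !mul0r subr0 addr0.
  have := hk (a + i%:R * h) (a + i.+1%:R * h).
  have e : a + i.+1%:R * h - (a + i%:R * h) = h by rewrite -natr1; ring.
  rewrite e => H; have {H} := H _ _ _; rewrite lerDl mulr_ge0//= => H.
  have h1 : a + i%:R * h <= a + i.+1%:R * h by rewrite lerD2l ler_wpM2r// ler_nat.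
  have h2 : a + i.+1%:R * h <= b.
    have -> : b = a + N.+1%:R * h by rewrite hNE addrC subrK.
    by rewrite lerD2l ler_wpM2r// ler_nat.
  have := H isT h1 h2; have := ih (ltnW iN); rewrite -[i.+1%:R]natr1 => h3 h4.
  by apply: le_trans h4; rewrite mulrDl mul1r opprD addrA lerD2r.
have := step _ (leqnn _); rewrite hNE (addrC a) subrK.
have -> : N.+1%:R * (c * h ^+ 2) = D / N.+1%:R by rewrite /h /D; field; rewrite gt_eqF.
have : D / N.+1%:R < k a - k b.
  rewrite ltr_pdivrMr//; apply: le_lt_trans (ler_norm _) _.
  by move: hN; rewrite ltr_pdivrMr ?subr_gt0// mulrC.
move: (D / _) (k a) (k b) => x ka kb; clear; move=> h1 h2.
suff : ka - kb < ka - kb by rewrite ltxx.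
lra.
Qed.

(** In the amplitude [r = sqrt s] the tangent inequality has slope [r * postm2 (r ^ 2)]. As [postm2]
    is nondecreasing, [psi (r ^ 2) - M / 2 * r ^ 2] satisfies [quadratic_monotone] to the right of
    [sqrt s], and its reflection does to the left. *)
Lemma psi_subgradient s s' : 0 < s -> 0 < s' ->
  psi P0 s + postm2 s / 2 * (s' - s) <= psi P0 s'.
Proof.
move=> s0 s'0; set M := postm2 s.
have M0 : 0 <= M := postm2_ge0 s.
have sq r : 0 <= r -> Num.sqrt (r ^+ 2) = r by move=> r0; rewrite sqrtr_sqr ger0_norm.
pose k r := psi P0 (r ^+ 2) - M / 2 * r ^+ 2.
have kE t : 0 < t -> k (Num.sqrt t) = psi P0 t - M / 2 * t.
  by move=> t0; rewrite /k sqr_sqrtr// ltW.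
suff : k (Num.sqrt s) <= k (Num.sqrt s') by rewrite (kE s s0) (kE s' s'0); move: (psi P0 s) (psi P0 s') => p1 p2; clearbody M; lra.
have r0 : 0 < Num.sqrt s by rewrite sqrtr_gt0.
have r'0 : 0 < Num.sqrt s' by rewrite sqrtr_gt0.
have [ss'|/ltW ss'] := leP s s'.
  apply: (@quadratic_monotone k _ _ (M / 2)); first by rewrite ler_sqrt// ltW.
  move=> r r' hr rr' _; have rp : 0 < r := lt_le_trans r0 hr.
  have := psi_tangent (r ^+ 2) (r' ^+ 2); rewrite !sq ?(ltW rp) ?(le_trans (ltW rp))//.
  have Mr : M <= postm2 (r ^+ 2).
    apply: postm2_nondecreasing => //; rewrite -(sqr_sqrtr (ltW s0)).
    by rewrite lerXn2r ?nnegrE ?(ltW r0) ?(ltW rp).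
  have : r * (r' - r) * M <= r * (r' - r) * postm2 (r ^+ 2).
    by rewrite ler_wpM2l// mulr_ge0 ?subr_ge0// ltW.
  rewrite /k; move: (psi P0 (r ^+ 2)) (psi P0 (r' ^+ 2)) (postm2 (r ^+ 2)) => p1 p2 p3.
  nra.
(* The case [s' <= s] is traversed backwards, by reflecting the interval. *)
pose kk r := k (Num.sqrt s + Num.sqrt s' - r).
have : kk (Num.sqrt s') <= kk (Num.sqrt s).
  apply: (@quadratic_monotone kk _ _ (M / 2)); first by rewrite ler_sqrt// ltW.
  move=> t t' ht tt' ht'; rewrite /kk.
  set r := _ - t; set r' := _ - t'.
  have hr : r <= Num.sqrt s by rewrite /r; lra.
  have rr' : r' <= r by rewrite /r /r'; lra.
  have r'p : 0 < r' by rewrite /r'; lra.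
  have rp : 0 < r := lt_le_trans r'p rr'.
  have -> : t' - t = r - r' by rewrite /r /r'; ring.
  clearbody r r'.
  have := psi_tangent (r ^+ 2) (r' ^+ 2); rewrite !sq ?(ltW rp) ?(ltW r'p)//.
  have Mr : postm2 (r ^+ 2) <= M.
    apply: postm2_nondecreasing; first by rewrite exprn_gt0.
    by rewrite -(sqr_sqrtr (ltW s0)) lerXn2r ?nnegrE ?(ltW r0) ?(ltW rp).
  have : r * (r - r') * postm2 (r ^+ 2) <= r * (r - r') * M.
    by rewrite ler_wpM2l// mulr_ge0 ?subr_ge0// ltW.
  rewrite /k; move: (psi P0 (r ^+ 2)) (psi P0 (r' ^+ 2)) (postm2 (r ^+ 2)) => p1 p2 p3.
  nra.
by rewrite /kk addrK [_ + _ - _]addrC addKr.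
Qed.

End scalar_channel.

Section maximizers.
Context {R : realType} (P0 : probability R R).
Hypothesis ix2 : intg P0 (fun x => x ^+ 2).
Local Notation rho := (\int[P0]_x ((x : R) ^+ 2)).

Let rho0 : 0 <= rho. Proof. by apply: Rint_ge0 => x; exact: sqr_ge0. Qed.

Transparent psi.

(** With [h x = sqrt (lam * q) * x], the inner integral of [potential] is the density of the scalar
    channel at the observation [Z + h X]; [borel_id] transports the Gaussian to [stdn]. *)
Lemma potentialE lam q : 0 <= lam -> 0 <= q -> potential P0 lam q = pot P0 lam q.
Proof.
move=> lam0 q0; congr (_ + _).
have lq0 : 0 <= lam * q by exact: mulr_ge0.
pose h (x : R) := Num.sqrt (lam * q) * x.
have mh : measurable_fun setT h by exact: measurable_funM.
have ih : intg P0 (fun x => h x ^+ 2).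
  by apply: (eq_intg _ (intgZ (Num.sqrt (lam * q) ^+ 2) ix2)) => x; rewrite /h exprMn.
have -> : psi P0 (lam * q) = \int[(P0 \x stdn R)%E]_w ln (dens1 P0 h (w.2 + h w.1)) := info1E mh ih.
have mid : measurable_fun setT (fun x : R => x) by exact: measurable_id.
have hW A (mA : measurable A) := @law_prod_map R _ _ _ _ _ _ _ _ P0 (normal_prob (0 : R) 1)
  P0 (stdn R) (fun x => x) (@borel_id R) mid (@measurable_borel_id R) (fun A _ => erefl)
  (fun A _ => erefl) A mA.
have mW := measurable_prod_map mid (@measurable_borel_id R).
rewrite -(law_Rint mW hW (intg_ln_dens1 mh ih mh ih)).
apply: eq_Rint => w; congr ln; apply: eq_Rint => x; congr expR.
rewrite /h /borel_id /=; have := sqr_sqrtr lq0; set s := Num.sqrt _ => hs.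
have -> : lam / 2 * q * x ^+ 2 = lam * q * x ^+ 2 / 2 by field.
by rewrite -hs; field.
Qed.

Opaque psi.

(** In the variable [r] with [s = c * r ^ 2], the tangent inequality gives a locally Lipschitz bound
    that includes [r = 0]. *)
Lemma psi_sqr_lipschitz (c r r' : R) : 0 <= c ->
  psi P0 (c * r ^+ 2) - c * rho * `|r| * `|r' - r| <= psi P0 (c * r' ^+ 2).
Proof.
move=> c0; apply: le_trans (psi_tangent ix2 (c * r ^+ 2) (c * r' ^+ 2)).
rewrite lerD2l !(sqrtrM _ c0) !sqrtr_sqr.
have -> : Num.sqrt c * `|r| * (Num.sqrt c * `|r'| - Num.sqrt c * `|r|) =
    c * (`|r| * (`|r'| - `|r|)).
  by rewrite -[in RHS](sqr_sqrtr c0); ring.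
set m := postm2 _ _.
have m0 : 0 <= m := postm2_ge0 _ _.
have mr : m <= rho := postm2_le ix2 _.
have h : - `|r' - r| <= `|r'| - `|r|.
  have := ler_distD 0 r r'; rewrite !subr0 sub0r normrN distrC; have := lerB_dist r r'; rewrite distrC; lra.
have h1 : `|r| * - `|r' - r| <= `|r| * (`|r'| - `|r|) by rewrite ler_wpM2l.
have h2 := ler_wpM2r m0 (ler_wpM2l c0 h1).
apply: le_trans h2.
have h3 : (c * (`|r| * `|r' - r|)) * m <= (c * (`|r| * `|r' - r|)) * rho.
  by rewrite ler_wpM2l// mulr_ge0// mulr_ge0.
set rr := \int[_]_x _ in h3 *; clearbody m rr; clear -h3; lra.
Qed.

Lemma continuous_psi_sqr (c : R) : 0 <= c -> continuous (fun r : R => psi P0 (c * r ^+ 2)).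
Proof.
move=> c0 r; apply/cvgrPdist_le => e e0.
pose L := c * rho * (`|r| + 1).
have cr0 : 0 <= c * rho by exact: mulr_ge0.
have L0 : 0 <= L by rewrite mulr_ge0// addr_ge0.
have d0 : 0 < Num.min 1 (e / (L + 1)).
  by rewrite lt_min ltr01 divr_gt0// ltr_wpDl.
near=> r'.
have : `|r - r'| < Num.min 1 (e / (L + 1)).
  by near: r'; apply/nbhs_ballP; exists (Num.min 1 (e / (L + 1))).
rewrite lt_min => /andP[d1 d2].
have rr1 : `|r'| <= `|r| + 1.
  by have := lerB_dist r' r; rewrite distrC; lra.
have hL : L * `|r - r'| <= e.
  have : (L + 1) * `|r - r'| <= e by rewrite mulrC -ler_pdivlMr ?ltW// ltr_wpDl.
  by have := normr_ge0 (r - r'); lra.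
have k1 : c * rho * `|r| * `|r - r'| <= L * `|r - r'|.
  by rewrite ler_wpM2r// /L ler_wpM2l// lerDl.
have k2 : c * rho * `|r'| * `|r - r'| <= L * `|r - r'|.
  by rewrite ler_wpM2r// /L ler_wpM2l.
have h1 := psi_sqr_lipschitz r r' c0; have h2 := psi_sqr_lipschitz r' r c0.
rewrite (distrC r') in h1.
by rewrite ler_norml; apply/andP; split; move: h1 h2 k1 k2 hL;
  move: (psi _ _) (psi _ _) (L * _) (c * rho * `|r| * _) (c * rho * `|r'| * _); clear; move=> *; lra.
Unshelve. all: by end_near. Qed.

(** For [q > 4 * rho] the bound [psi s <= s * rho] makes the potential nonpositive, hence at most
    its value at 0; a compact interval remains. *)
Lemma maximizer_exists lam : 0 < lam ->
  exists2 q, 0 <= q & forall q', 0 <= q' -> pot P0 lam q' <= pot P0 lam q.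
Proof.
move=> lam0; have lam0' := ltW lam0.
pose f r := pot P0 lam (r ^+ 2); pose C := Num.sqrt (4 * rho).
have C0 : 0 <= C := sqrtr_ge0 _.
have cf : {within `[0, C], continuous f}.
  apply: continuous_subspaceT => r; apply: cvgD; last exact: continuous_psi_sqr.
  apply: cvgM; first exact: cvg_cst.
  exact: (continuous_comp (@exprn_continuous R 2 r) (@exprn_continuous R 2 _)).
have [r rI hr] := EVT_max C0 cf.
exists (r ^+ 2); first exact: sqr_ge0.
move=> q q0; have [qC|qC] := leP q (4 * rho).
  have := hr (Num.sqrt q); rewrite /f (sqr_sqrtr q0); apply.
  by rewrite in_itv/= sqrtr_ge0/= ler_wsqrtr.
have h0 : 0 <= pot P0 lam (r ^+ 2).
  have := hr 0; rewrite /f expr0n pot0; apply.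
  by rewrite in_itv/= lexx.
apply: le_trans h0; rewrite /pot.
have h1 : psi P0 (lam * q) <= lam * q * rho by apply: psi_le => //; exact: mulr_ge0.
have h2 : lam * q * (4 * rho) <= lam * q * q by rewrite ler_wpM2l ?mulr_ge0// ltW.
have -> : q ^+ 2 = q * q by rewrite expr2.
by move: h1 h2; move: (psi _ _); set rr := \int[_]_x _; clearbody rr => p; clear; move=> *; lra.
Qed.

End maximizers.

(** * The variational formula as a function of the signal-to-noise ratio *)

Section first_order.
Context {R : realType}.

(** Differentiability at [x] with derivative [u], as the first-order estimate with which tangent
    inequalities are compared. *)
Definition has_slope (f : R -> R) (x u : R) := forall eps, 0 < eps ->
  exists2 delta, 0 < delta & forall t, `|t| < delta -> `|f (x + t) - f x - u * t| <= eps * `|t|.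

Lemma derivable_has_slope (f : R -> R) (x : R) : derivable (f : R^o -> R^o) x 1 ->
  exists u, has_slope f x u.
Proof.
move=> /cvg_ex[u fu]; exists u => eps eps0.
move/cvgrPdist_le : fu => /(_ _ eps0)/nbhs_ballP[d /= d0 hd].
exists d => // t td; have [->|t0] := eqVneq t 0.
  by rewrite addr0 subrr mulr0 subrr normr0 mulr0.
have := hd t; rewrite /ball/= sub0r normrN => /(_ td t0).
rewrite /= [t *: 1]mulr1 (addrC t x) -[_ *: _]/(t^-1 * (f (x + t) - f x)) => h.
have -> : f (x + t) - f x - u * t = - (u - t^-1 * (f (x + t) - f x)) * t by field.
by rewrite normrM normrN ler_wpM2r.
Qed.

Lemma has_slope_derivable (f : R -> R) (x u : R) : has_slope f x u ->
  derivable (f : R^o -> R^o) x 1.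
Proof.
move=> hf; apply/cvg_ex; exists u; apply/cvgrPdist_le => eps eps0.
have [d d0 hd] := hf _ eps0.
apply/nbhs_ballP; exists d => //= t; rewrite /ball/= sub0r normrN => td t0.
rewrite /= [t *: 1]mulr1 (addrC t x) -[_ *: _]/(t^-1 * (f (x + t) - f x)).
have -> : u - t^-1 * (f (x + t) - f x) = - (f (x + t) - f x - u * t) / t by field.
by rewrite normrM normrN normfV ler_pdivrMr ?normr_gt0// hd.
Qed.

Lemma has_slope_affine_sub (c : R) (f : R -> R) (x u : R) : has_slope f x u ->
  has_slope (fun y => c * y - f y) x (c - u).
Proof.
move=> hf eps eps0; have [d d0 hd] := hf _ eps0; exists d => // t td.
have -> : c * (x + t) - f (x + t) - (c * x - f x) - (c - u) * t =
  - (f (x + t) - f x - u * t) by ring.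
by rewrite normrN hd.
Qed.

Lemma ler_addsmall (x y K : R) : 0 <= K ->
  (forall e, 0 < e <= 1 -> x <= y + K * e) -> x <= y.
Proof.
move=> K0 h; apply/ler_addgt0Pr => e e0.
have K1 : 0 < K + 1 by lra.
pose e' := Num.min 1 (e / (K + 1)).
have e'0 : 0 < e' <= 1 by rewrite lt_min ltr01 divr_gt0//= ge_min lexx.
apply: (le_trans (h _ e'0)); rewrite lerD2l.
apply: (@le_trans _ _ (K * (e / (K + 1)))).
  by rewrite ler_wpM2l// ge_min lexx orbT.
by rewrite mulrA ler_pdivrMr// [leRHS]mulrC ler_wpM2r ?ltW// ltrDl.
Qed.

(** Each jump contains a rational, and the value of [w] at a point between two jumps separates their
    rationals. *)
Lemma monotone_jumps_countable (w : R -> R) (A : set R) :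
  (forall x y, A x -> A y -> x <= y -> w x <= w y) ->
  (forall x y z, A x -> A z -> x <= y -> y <= z -> A y) ->
  countable [set x | exists e, [/\ 0 < e, exists y, A y /\ y < x, exists z, A z /\ x < z &
    forall y z, A y -> A z -> y < x -> x < z -> w y + e <= w z]].
Proof.
move=> wA Aconv; set S := [set x | _].
have hS x : S x -> exists s : rat,
    (forall y, A y -> y < x -> w y < ratr s) /\ (forall z, A z -> x < z -> ratr s < w z).
  move=> [e [e0 [y0 [Ay0 y0x]] [z0 [Az0 xz0]] he]].
  pose E := [set w y | y in [set y | A y /\ y < x]].
  have E0 : E !=set0 by exists (w y0), y0.
  have ubE : ubound E (w z0).
    by move=> _ [y [Ay yx] <-]; apply: wA => //; apply: ltW; exact: lt_trans xz0.
  have supE : has_sup E by split => //; exists (w z0).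
  have [s /andP[s1 s2]] : exists s : rat, sup E < ratr s < sup E + e.
    have [s /itvP h] : exists s : rat, ratr s \in `](sup E), (sup E + e)[%R.
      by apply: rat_in_itvoo; rewrite ltrDl.
    by exists s; rewrite !h.
  exists s; split.
    move=> y Ay yx; apply: le_lt_trans s1; apply: ub_le_sup; first by exists (w z0).
    by exists y.
  move=> z Az xz; apply: (lt_le_trans s2); rewrite -lerBrDr.
  by apply: ge_sup => // _ [y [Ay yx] <-]; rewrite lerBrDr; exact: he.
pose r x : rat := if pselect (S x) is left h then projT1 (cid (hS x h)) else 0.
have hr x : S x -> (forall y, A y -> y < x -> w y < ratr (r x)) /\
    (forall z, A z -> x < z -> ratr (r x) < w z).
  by move=> Sx; rewrite /r; case: pselect => // h; case: cid.
have lt_inj x y : S x -> S y -> x < y -> r x != r y.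
  move=> Sx Sy xy; pose m := (x + y) / 2.
  have xm : x < m by rewrite /m; lra.
  have my : m < y by rewrite /m; lra.
  have Am : A m.
    have [_ [_ [y0 [Ay0 y0x]] _ _]] := Sx; have [_ [_ _ [z0 [Az0 yz0]] _]] := Sy.
    apply: (Aconv y0 m z0) => //; apply: ltW; first exact: lt_trans xm.
    exact: lt_trans yz0.
  have h1 := (hr x Sx).2 m Am xm; have h2 := (hr y Sy).1 m Am my.
  by apply: contraTneq (lt_trans h1 h2) => ->; rewrite ltxx.
apply/countable_injP; exists (fun x => pickle (r x)) => x y.
rewrite !inE => Sx Sy /(pcan_inj pickleK) rxy.
case: (ltgtP x y) => // xy.
  by have := lt_inj _ _ Sx Sy xy; rewrite rxy eqxx.
by have := lt_inj _ _ Sy Sx xy; rewrite rxy eqxx.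
Qed.

End first_order.

Section legendre.
Context {R : realType} (psi phi : R -> R).
Let F lam q := - (lam / 4) * q ^+ 2 + psi (lam * q).
Hypothesis psi0 : psi 0 = 0.
Hypothesis psi_sub : forall s, 0 < s -> exists m, forall s', 0 < s' ->
  psi s + m * (s' - s) <= psi s'.

Definition argmax lam q := 0 <= q /\ forall q', 0 <= q' -> F lam q' <= F lam q.

Hypothesis argmax_ex : forall lam, 0 < lam -> exists q, argmax lam q.
Hypothesis phiE : forall lam q, 0 < lam -> argmax lam q -> phi lam = F lam q.

Lemma phi_ge lam q : 0 < lam -> 0 <= q -> F lam q <= phi lam.
Proof.
move=> lam0 q0; have [qm hq] := argmax_ex lam0; rewrite (phiE lam0 hq).
by case: hq => _; exact.
Qed.

(* Testing [phi lam'] at the [q'] with [lam' * q' = lam * q]: a tangent line in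
   the variable [lam^-1]. *)
Lemma phi_tangent lam lam' q : 0 < lam -> 0 < lam' -> argmax lam q ->
  phi lam + (lam * q) ^+ 2 / 4 * (lam^-1 - lam'^-1) <= phi lam'.
Proof.
move=> lam0 lam'0 hq; have [q0 _] := hq.
have q'0 : 0 <= lam * q / lam' by rewrite divr_ge0 ?(ltW lam'0)// mulr_ge0// ltW.
apply: le_trans (phi_ge lam'0 q'0).
rewrite (phiE lam0 hq) /F.
have -> : lam' * (lam * q / lam') = lam * q by field; rewrite gt_eqF.
rewrite le_eqVlt; apply/orP; left; apply/eqP; field.
by rewrite !gt_eqF.
Qed.

Lemma psi_convex s s' t : 0 < s -> 0 < s' -> 0 <= t <= 1 ->
  psi (t * s + (1 - t) * s') <= t * psi s + (1 - t) * psi s'.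
Proof.
move=> s0 s'0 /andP[t0 t1]; set m := _ + _.
have m0 : 0 < m.
  rewrite /m; have [->|tn] := eqVneq t 0; first by rewrite mul0r add0r subr0 mul1r.
  by rewrite ltr_pwDl ?mulr_gt0 ?mulr_ge0 ?subr_ge0// ?ltW// lt0r tn.
have [a ha] := psi_sub m0.
have t1' : 0 <= 1 - t by rewrite subr_ge0.
have h1 := ler_wpM2l t0 (ha _ s0); have h2 := ler_wpM2l t1' (ha _ s'0).
apply: le_trans (lerD h1 h2); rewrite le_eqVlt; apply/orP; left; apply/eqP.
by rewrite /m; ring.
Qed.

(** At fixed [q], [F lam q] is the sum of a linear and a convex function of [lam], and [phi] is a
    supremum over [q]. *)
Lemma phi_convex lam lam' t : 0 < lam -> 0 < lam' -> 0 <= t <= 1 ->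
  phi (t * lam + (1 - t) * lam') <= t * phi lam + (1 - t) * phi lam'.
Proof.
move=> lam0 lam'0 t01; have /andP[t0 t1] := t01; set m := t * lam + _.
have t1' : 0 <= 1 - t by rewrite subr_ge0.
have m0 : 0 < m.
  rewrite /m; have [->|tn] := eqVneq t 0; first by rewrite mul0r add0r subr0 mul1r.
  by rewrite ltr_pwDl ?mulr_gt0 ?mulr_ge0 ?subr_ge0// ?ltW// lt0r tn.
have [q hq] := argmax_ex m0; rewrite (phiE m0 hq); have [q0 _] := hq.
have h1 := ler_wpM2l t0 (phi_ge lam0 q0); have h2 := ler_wpM2l t1' (phi_ge lam'0 q0).
apply: le_trans (lerD h1 h2).
suff : psi (m * q) <= t * psi (lam * q) + (1 - t) * psi (lam' * q).
  by rewrite /F /m; move: (psi _) (psi _) (psi _) => a b c; clear; move=> h; nra.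
(* Supporting lines of [psi] are given at positive points, so [q = 0] is treated apart. *)
have [->|qn] := eqVneq q 0; first by rewrite !mulr0 psi0 !mulr0 addr0.
have qp : 0 < q by rewrite lt0r qn.
have -> : m * q = t * (lam * q) + (1 - t) * (lam' * q) by rewrite /m; ring.
by apply: psi_convex => //; exact: mulr_gt0.
Qed.

(** By [phi_tangent] a smooth curve of slope [w / lam ^ 2] touches [phi] from below at [lam]; a
    function with a slope there must share it. Small increments of both signs give the two
    inequalities. *)
Lemma argmax_slope lam q u : 0 < lam -> argmax lam q -> has_slope phi lam u -> q ^+ 2 / 4 = u.
Proof.
move=> lam0 hq hu; set w := (lam * q) ^+ 2 / 4.
have w0 : 0 <= w by rewrite divr_ge0// sqr_ge0.
suff : w = u * lam ^+ 2.
  move=> wE; apply: (@mulIf _ (lam ^+ 2)); first by rewrite expf_neq0// gt_eqF.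
  by rewrite -wE /w; ring.
have key e : 0 < e <= 1 -> exists2 d, 0 < d <= Num.min e (lam / 2) & forall t, `|t| <= d -> t != 0 ->
    w * t / (lam * (lam + t)) <= u * t + e * `|t|.
  move=> /andP[e0 e1]; have [d d0 hd] := hu _ e0.
  exists (Num.min (Num.min e (lam / 2)) (d / 2)).
    by rewrite !lt_min e0 !divr_gt0//= ge_min lexx.
  move=> t; rewrite !le_min -andbA => /and3P[te tl td] tn.
  have lt0 : 0 < lam + t by move: tl; rewrite ler_norml => /andP[]; lra.
  have td' : `|t| < d by lra.
  have h1 := phi_tangent lam0 lt0 hq.
  have := hd t td'; rewrite ler_norml => /andP[_ h2].
  have -> : w * t / (lam * (lam + t)) = w * (lam^-1 - (lam + t)^-1).
    by field; rewrite !gt_eqF.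
  by rewrite /w; move: h1 h2; move: (phi _) (phi _) (_ * (_ - _)) => a b c; lra.
apply: le_anti; apply/andP; split.
  apply: (@ler_addsmall _ _ _ (lam ^+ 2 + (`|u| + 1) * lam)).
    by rewrite addr_ge0 ?sqr_ge0// mulr_ge0 ?ltW// addr_ge0.
  move=> e e01; have /andP[e0 e1] := e01; have [d /andP[d0]] := key _ e01.
  rewrite le_min => /andP[de dl] /(_ d).
  rewrite (gtr0_norm d0) lexx gt_eqF// => /(_ isT isT) h.
  have ld : 0 < lam * (lam + d) by rewrite mulr_gt0// addr_gt0.
  rewrite ler_pdivrMr// in h.
  have h' : w <= (u + e) * (lam * (lam + d)).
    by rewrite -(ler_pM2r d0); apply: (le_trans h); rewrite -mulrDl mulrAC.
  have h2 : (u + e) * (lam * d) <= (`|u| + 1) * (lam * e).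
    apply: (@le_trans _ _ ((`|u| + 1) * (lam * d))).
      by rewrite ler_wpM2r ?lerD ?ler_norm// mulr_ge0 ?ltW.
    by rewrite ler_wpM2l ?addr_ge0// ler_wpM2l// ltW.
  have -> : u * lam ^+ 2 + (lam ^+ 2 + (`|u| + 1) * lam) * e =
    (u + e) * lam ^+ 2 + (`|u| + 1) * (lam * e) by ring.
  apply: (le_trans h'); rewrite mulrDr mulrDr -expr2; lra.
apply: (@ler_addsmall _ _ _ (lam ^+ 2 + `|u| * lam)).
  by rewrite addr_ge0 ?sqr_ge0// mulr_ge0 ?(ltW lam0).
move=> e e01; have /andP[e0 e1] := e01; have [d /andP[d0]] := key _ e01.
rewrite le_min => /andP[de dl] /(_ (- d)).
rewrite normrN (gtr0_norm d0) lexx oppr_eq0 gt_eqF// => /(_ isT isT) h.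
have ld : 0 < lam * (lam - d) by rewrite mulr_gt0//; lra.
rewrite ler_pdivrMr// in h.
have h' : (u - e) * (lam * (lam - d)) <= w.
  rewrite -(ler_pM2r d0); move: h.
  have -> : (u * - d + e * d) * (lam * (lam - d)) = - ((u - e) * (lam * (lam - d)) * d) by ring.
  by rewrite mulrN lerN2.
have h2 : u * (lam * d) <= `|u| * (lam * e).
  apply: (@le_trans _ _ (`|u| * (lam * d))).
    by rewrite ler_wpM2r ?ler_norm// mulr_ge0 ?ltW.
  by rewrite ler_wpM2l// ler_wpM2l// ltW.
have h3 : 0 <= e * (lam * d) by rewrite !mulr_ge0// ltW.
have E : (u - e) * (lam * (lam - d)) =
  u * lam ^+ 2 - e * lam ^+ 2 - u * (lam * d) + e * (lam * d) by ring.
rewrite E in h'; have -> : (lam ^+ 2 + `|u| * lam) * e = e * lam ^+ 2 + `|u| * (lam * e) by ring.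
lra.
Qed.

(** The tangent inequalities at two points enclose the increment of [phi] between values of [w],
    which makes [w] monotone. Where [w] is continuous [phi] has slope [w / lam ^ 2]; elsewhere [w]
    jumps. *)
Lemma phi_nonsmooth_countable :
  countable [set lam | 0 < lam /\ ~ exists u, has_slope phi lam u].
Proof.
(* A selection of maximizers; the value 0 outside [lam > 0] is a default. *)
pose q lam := if pselect (0 < lam) is left h then projT1 (cid (argmax_ex h)) else 0.
have hq lam : 0 < lam -> argmax lam (q lam).
  by move=> lam0; rewrite /q; case: pselect => // h; case: cid.
pose w lam := (lam * q lam) ^+ 2 / 4.
have w0 lam : 0 <= w lam by rewrite divr_ge0// sqr_ge0.
have sl lam lam' : 0 < lam -> 0 < lam' ->
    w lam * (lam^-1 - lam'^-1) <= phi lam' - phi lam <= w lam' * (lam^-1 - lam'^-1).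
  move=> l0 l'0; have h1 := phi_tangent l0 l'0 (hq _ l0).
  have h2 := phi_tangent l'0 l0 (hq _ l'0).
  rewrite -/(w _) in h1; rewrite -/(w _) in h2.
  apply/andP; split; first by rewrite lerBrDl.
  rewrite lerBlDr -lerBlDl; apply: le_trans h2; rewrite lerD2l.
  by rewrite -mulrN opprB.
have wmono x y : 0 < x -> 0 < y -> x <= y -> w x <= w y.
  move=> x0 y0; rewrite le_eqVlt => /predU1P[->//|xy].
  have /andP[h1 h2] := sl _ _ x0 y0; have := le_trans h1 h2.
  by rewrite ler_pM2r// subr_gt0 ltf_pV2.
clearbody w; have cj := @monotone_jumps_countable R w [set x | 0 < x]
  (fun x y x0 y0 xy => wmono x y x0 y0 xy) (fun x y z x0 _ xy _ => lt_le_trans x0 xy).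
apply: sub_countable cj; apply: subset_card_le => lam [l0 hn].
apply: contrapT => hS; apply: hn; exists (w lam / lam ^+ 2) => eps eps0.
(* If some [y < lam < z] have values of [w] closer than [e], monotonicity controls [w] between them;
   otherwise [w] jumps by at least [e] at [lam]. *)
have cont e : 0 < e -> exists d, [/\ 0 < d, d <= lam / 2 & forall t, `|t| < d -> `|w (lam + t) - w lam| <= e].
  move=> e0; apply: contrapT => hd; apply: hS; exists e; split => //.
  - by exists (lam / 2); split; rewrite /= ?divr_gt0//; lra.
  - by exists (lam + 1); split => /=; lra.
  - move=> y z /= y0 z0 yl lz; rewrite leNgt; apply/negP => hw; apply: hd.
    exists (Num.min (Num.min (lam - y) (z - lam)) (lam / 2)); split.
    + by rewrite !lt_min !subr_gt0 yl lz divr_gt0.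
    + by rewrite ge_min lexx orbT.
    + move=> t; rewrite !lt_min => /andP[/andP[ty tz] tl].
      move: ty tz tl; rewrite !ltr_norml => /andP[t1 t2] /andP[t3 t4] /andP[t5 t6].
      have lt0 : 0 < lam + t by lra.
      have k1 : w y <= w (lam + t) by apply: wmono => //; lra.
      have k2 : w (lam + t) <= w z by apply: wmono => //; lra.
      have k3 : w y <= w lam by apply: wmono => //; lra.
      have k4 : w lam <= w z by apply: wmono => //; lra.
      by rewrite ler_norml; move: k1 k2 k3 k4 hw; move: (w y) (w z) (w lam) (w _); clear; move=> *; apply/andP; split; lra.
pose e := eps * lam ^+ 2 / 4.
have e0 : 0 < e by rewrite divr_gt0// mulr_gt0// exprn_gt0.
have [d [d0 dl hd]] := cont _ e0.
(* The second bound is for replacing [lam * (lam + t)] by [lam ^ 2]: the error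
   [w lam * a * (t / lam)] is then at most [eps / 2 * |t|]. *)
pose d' := Num.min d (eps * lam ^+ 3 / (4 * (w lam + 1))).
have w1 : 0 < w lam + 1 by rewrite ltr_wpDl.
exists d'; first by rewrite lt_min d0 divr_gt0// mulr_gt0// exprn_gt0.
move=> t; rewrite lt_min => /andP[td td2].
have tl : `|t| < lam / 2 by exact: lt_le_trans dl.
have lt0 : lam / 2 < lam + t by move: tl; rewrite ltr_norml => /andP[]; lra.
have lt1 : 0 < lam + t by lra.
have tE : lam^-1 - (lam + t)^-1 = t / (lam * (lam + t)) by field; rewrite !gt_eqF.
have /andP[h1 h2] := sl _ _ l0 lt1; rewrite tE in h1 h2.
set p := phi (lam + t) - phi lam in h1 h2 *; set a := t / (lam * (lam + t)) in h1 h2.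
have na : `|a| <= `|t| * (2 / lam ^+ 2).
  rewrite /a normrM normfV ler_wpM2l// [`|lam * _|]gtr0_norm ?mulr_gt0//.
  have -> : 2 / lam ^+ 2 = (lam * (lam / 2))^-1 by field; rewrite gt_eqF.
  by rewrite lef_pV2 ?posrE ?mulr_gt0 ?divr_gt0// ler_pM2l// ltW.
have s1 : `|p - w lam * a| <= e * `|a|.
  have wd : `|(w (lam + t) - w lam) * a| <= e * `|a|.
    by rewrite normrM ler_wpM2r// hd.
  have h3 : 0 <= p - w lam * a by rewrite subr_ge0.
  have h4 : p - w lam * a <= (w (lam + t) - w lam) * a by rewrite mulrBl lerD2r.
  by rewrite (ger0_norm h3) (le_trans h4)// (le_trans (ler_norm _)).
have s2 : `|w lam * a - w lam / lam ^+ 2 * t| <= eps / 2 * `|t|.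
  have -> : w lam * a - w lam / lam ^+ 2 * t = - (w lam * a * (t / lam)).
    by rewrite /a; field; rewrite !gt_eqF.
  clearbody a p; rewrite normrN !normrM (ger0_norm (w0 _)) normfV (gtr0_norm l0).
  apply: (@le_trans _ _ (w lam * (`|t| * (2 / lam ^+ 2)) * (`|t| / lam))).
    apply: ler_wpM2r; first by rewrite divr_ge0// ltW.
    exact: ler_wpM2l.
  have -> : w lam * (`|t| * (2 / lam ^+ 2)) * (`|t| / lam) = 2 / lam ^+ 3 * (w lam * `|t|) * `|t|.
    by field; rewrite gt_eqF.
  rewrite ler_wpM2r//.
  have h : w lam * `|t| <= eps * lam ^+ 3 / 4.
    apply: (@le_trans _ _ ((w lam + 1) * `|t|)); first by rewrite ler_wpM2r// lerDl.
    have := ltW td2; rewrite ler_pdivlMr ?mulr_gt0//; lra.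
  have l3 : 0 < 2 / lam ^+ 3 by rewrite divr_gt0// exprn_gt0.
  apply: (@le_trans _ _ (2 / lam ^+ 3 * (eps * lam ^+ 3 / 4))); first by rewrite ler_pM2l.
  by rewrite le_eqVlt; apply/orP; left; apply/eqP; field; rewrite gt_eqF.
have s3 : e * `|a| <= eps / 2 * `|t|.
  apply: (@le_trans _ _ (e * (`|t| * (2 / lam ^+ 2)))); first by rewrite ler_pM2l.
  by rewrite le_eqVlt; apply/orP; left; apply/eqP; rewrite /e; field; rewrite gt_eqF.
have -> : p - w lam / lam ^+ 2 * t = (p - w lam * a) + (w lam * a - w lam / lam ^+ 2 * t) by ring.
apply: (le_trans (ler_normD _ _)); lra.
Qed.

(* Moving from [lam] to [lam * (1 + h) ^+ 2] makes the tangent inequality for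
   [J n], which is affine in [sqrt lam], linear in [h]. *)
Lemma slope_limit (J : nat -> R -> R) (A : nat -> R) lam u : 0 < lam -> has_slope phi lam u ->
  (forall l eps, 0 < l -> 0 < eps -> \forall n \near \oo, `|J n l - n%:R * phi l| <= n%:R * eps) ->
  (forall n h, -1 < h -> J n lam + lam * h * (n%:R * A n) <= J n (lam * (1 + h) ^+ 2)) ->
  A n @[n --> \oo] --> 2 * u.
Proof.
move=> lam0 hu hJ hA; apply/cvgrPdist_le => eps eps0.
(* The errors collected below amount to at most [(|u| + 4) * e]. *)
pose M := `|u| + 6; have M0 : 0 < M by rewrite ltr_wpDl.
pose e := eps / M; have e0 : 0 < e by rewrite divr_gt0.
have [d d0 hd] := hu _ e0.
pose h := Num.min (Num.min e (d / (4 * lam))) (1 / 2).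
have h0 : 0 < h by rewrite !lt_min e0 !divr_gt0// mulr_gt0.
have he : h <= e by rewrite !ge_min lexx.
have hd' : h <= d / (4 * lam) by rewrite !ge_min lexx orbT.
have h12 : h <= 1 / 2 by rewrite !ge_min lexx orbT.
have hlam : h * lam <= d / 4.
  by move: hd'; rewrite ler_pdivlMr ?mulr_gt0//; lra.
have ME : M * e = eps by rewrite /e mulrCA divff ?mulr1// gt_eqF.
clearbody h e.
have e2 : 0 < lam * h * e / 2 by rewrite divr_gt0// !mulr_gt0.
have lp : 0 < lam * (1 + h) ^+ 2 by rewrite mulr_gt0// exprn_gt0//; lra.
have lm : 0 < lam * (1 - h) ^+ 2 by rewrite mulr_gt0// exprn_gt0//; lra.
have hu0 : `|u| * h <= `|u| * e by rewrite ler_wpM2l.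
(* The increment [h] is fixed before [n] grows, so the error on [J n] is small compared with
   [n * h]. *)
near=> n.
have np : 0 < n%:R :> R by rewrite ltr0n; near: n; exact: nbhs_infty_gt.
have J1 : `|J n lam - n%:R * phi lam| <= n%:R * (lam * h * e / 2) by near: n; exact: hJ.
have J2 : `|J n (lam * (1 + h) ^+ 2) - n%:R * phi (lam * (1 + h) ^+ 2)| <= n%:R * (lam * h * e / 2).
  by near: n; exact: hJ.
have J3 : `|J n (lam * (1 - h) ^+ 2) - n%:R * phi (lam * (1 - h) ^+ 2)| <= n%:R * (lam * h * e / 2).
  by near: n; exact: hJ.
have lh0 : 0 < lam * h by exact: mulr_gt0.
have up : A n <= 2 * u + eps.
  (* The increment of [lam]; divided by [lam * h] it is [2 + h], the origin of the limit [2 * u]. *)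
  pose t := lam * (2 * h + h ^+ 2).
  have tE : lam * (1 + h) ^+ 2 = lam + t by rewrite /t; ring.
  have t0 : 0 < t by rewrite mulr_gt0// ltr_pwDl ?mulr_gt0 ?exprn_ge0 ?ltW.
  have td : `|t| < d.
    rewrite gtr0_norm// /t; have : h ^+ 2 <= h / 2 by rewrite expr2; nra.
    by move=> hh; have := ler_wpM2l (ltW lam0) hh; lra.
  have := hd t td; rewrite -tE (gtr0_norm t0) ler_norml => /andP[_ p1].
  have a1 := hA n h; have {}a1 := a1 ltac:(lra).
  move: J1 J2; rewrite !ler_norml => /andP[j1 _] /andP[_ j2].
  have k1 : lam * h * A n <= u * t + e * t + lam * h * e.
    rewrite -(ler_pM2l np); have q := ler_wpM2l (ltW np) p1.
    move: a1 j1 j2 q; move: (J n lam) (J n _) (phi lam) (phi _); clear => x y z v; lra.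
  have k2 : A n <= (u + e) * (2 + h) + e.
    rewrite -(ler_pM2l lh0); apply: (le_trans k1); rewrite le_eqVlt; apply/orP; left; apply/eqP.
    by rewrite /t; ring.
  apply: (le_trans k2).
  have : u * h <= `|u| * e.
    by apply: le_trans hu0; rewrite ler_wpM2r ?ler_norm// ltW.
  have : e * h <= e by rewrite ler_piMr ?ltW//; lra.
  rewrite -ME /M; lra.
have lo : 2 * u - eps <= A n.
  pose t := lam * (2 * h - h ^+ 2).
  have tE : lam * (1 - h) ^+ 2 = lam + - t by rewrite /t; ring.
  have hh : h ^+ 2 <= h / 2 by rewrite expr2; nra.
  have t0 : 0 < t by rewrite mulr_gt0//; lra.
  have h20 : 0 <= h ^+ 2 by exact: sqr_ge0.
  have td : `|- t| < d.
    by rewrite normrN gtr0_norm// /t; have := mulr_ge0 (ltW lam0) h20; lra.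
  have := hd (- t) td; rewrite -tE normrN (gtr0_norm t0) ler_norml => /andP[_ p1].
  have a1 := hA n (- h); have {}a1 := a1 ltac:(lra).
  move: J1 J3; rewrite !ler_norml => /andP[j1 _] /andP[_ j2].
  have k1 : - (lam * h * A n) <= - (u * t) + e * t + lam * h * e.
    rewrite -(ler_pM2l np); have q := ler_wpM2l (ltW np) p1.
    move: a1 j1 j2 q; move: (J n lam) (J n _) (phi lam) (phi _); clear => x y z v; lra.
  have k2 : (u - e) * (2 - h) - e <= A n.
    rewrite -(ler_pM2l lh0) -[leRHS]opprK lerNr; apply: (le_trans k1).
    by rewrite le_eqVlt; apply/orP; left; apply/eqP; rewrite /t; ring.
  apply: le_trans k2.
  have : u * h <= `|u| * e.
    by apply: le_trans hu0; rewrite ler_wpM2r ?ler_norm// ltW.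
  have : 0 <= e * h by rewrite mulr_ge0// ltW.
  rewrite -ME /M; lra.
by rewrite ler_norml; apply/andP; split; lra.
Unshelve. all: by end_near. Qed.

End legendre.

(** * Mutual information and mean square errors *)

Section law_integral.
Context d d' (T : measurableType d) (T' : measurableType d') (R : realType).
Variables (P : probability T R) (m : probability T' R) (W : T -> T').
Hypotheses (mW : measurable_fun setT W)
  (hW : forall A, measurable A -> P (W @^-1` A) = m A).

Lemma law_integral (f : T' -> R) : measurable_fun setT f ->
  (\int[P]_x (f (W x))%:E = \int[m]_y (f y)%:E)%E.
Proof.
move=> mf; have mfE : measurable_fun setT (EFin \o f) by exact/measurable_EFinP.
rewrite integralE [RHS]integralE; congr (_ - _)%E.
- rewrite -(law_ge0_integral mW hW (measurable_funepos mfE) (funepos_ge0 _)).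
  by apply: eq_integral => x _; rewrite !funeposE.
- rewrite -(law_ge0_integral mW hW (measurable_funeneg mfE) (funeneg_ge0 _)).
  by apply: eq_integral => x _; rewrite !funenegE.
Qed.

End law_integral.

Section divergence.
Context {R : realType} d (T : measurableType d) (J N : probability T R) (r : T -> R).
Hypotheses (mr : measurable_fun setT r) (r0 : forall x, 0 <= r x).
Hypothesis JE : forall A, measurable A -> J A = (\int[N]_(x in A) (r x)%:E)%E.

(** The density [r] is a version of the Radon-Nikodym derivative [N]-almost everywhere, hence
    [J]-almost everywhere since [N] dominates [J]. *)
Lemma kl_divergence_density : kl_divergence J N = (\int[J]_x (ln (r x))%:E)%E.
Proof.
have JN : J `<< N.
  apply/null_content_dominatesP => A mA NA0; rewrite JE//.
  by apply: null_set_integral => //; exact/measurable_EFinP/measurable_funTS.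
rewrite /kl_divergence; case: pselect => // h.
set nu := charge_of_finite_measure J.
have nuN : nu `<< N by [].
have irn := Radon_Nikodym_integrable nuN.
have mrn := measurable_int _ irn.
have mrE : measurable_fun setT (EFin \o r) by exact/measurable_EFinP.
have aeN : ae_eq N setT (Radon_Nikodym nu N) (EFin \o r).
  apply: integral_ae_eq => // A _ mA.
  by rewrite -(Radon_Nikodym_integral nuN mA) -JE.
have aeJ := null_dominates_ae_eq measurableT JN aeN.
apply: ae_eq_integral => //.
- apply/measurable_EFinP; apply: (measurableT_comp (@measurable_ln R)).
  exact: (measurableT_comp _ mrn).
- by apply/measurable_EFinP; apply: measurableT_comp.
- by apply: filterS aeJ => x h1 _; rewrite /= h1.
Qed.

End divergence.

Section gaussian_information.
Context {R : realType} d (S : measurableType d) (mu : probability S R) (m : nat)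
  (U : 'I_m -> S -> R).
Hypothesis hU : sqint mu U.
Local Notation gam := (iprod (stdn R) m).
Local Notation Y := (m.-tuple R).
Local Notation Q := (mu \x gam)%E.

Let mU := sqintW hU.

(** Gaussian integration by parts for a one-point Gibbs measure, whose covariances vanish. *)
Lemma Rint_tnth0 (k : 'I_m) : \int[gam]_y tnth y k = 0.
Proof.
have c1 : \sum_(x : unit) (1 : R) = 1 by rewrite big_const card_unit /= addr0.
have := gaussian_integration_by_parts (fun=> ler01) c1 (fun (_ : 'I_m) (_ : unit) => 0 : R)
  (fun=> 0) (fun=> 1) k.
have gc := gav_cst (fun=> ler01) c1 (fun (_ : 'I_m) (_ : unit) => 0 : R) (fun=> 0).
have -> : \int[gam]_y (tnth y k * gav (fun=> 1) (fun (_ : 'I_m) (_ : unit) => 0) (fun=> 0) (fun=> 1) y) =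
    \int[gam]_y tnth y k by apply: eq_Rint => y; rewrite gc mulr1.
move=> ->; rewrite -[RHS](Rint_cst gam 0); apply: eq_Rint => y.
by rewrite (eq_gav _ _ _ _ (g := fun=> 0)) ?gc ?mulr0 ?subrr// => x; rewrite mulr0.
Qed.

(** Density of the joint law of signal and observation with respect to the product of its
    marginals. *)
Let rnd (w : S * Y) : R := wt U w.1 w.2 / dens mu U w.2.

Lemma intg_sig_noise k : intg Q (fun w => U k w.1 * tnth w.2 k).
Proof.
have it : intg gam (fun y => tnth y k).
  exact: (intg_sqr_intg (measurable_tnth k) (intg_tnth_sqr (R := R) k)).
exact: (intg_mul (sqint_intg k hU) it).
Qed.

(** At [obs U] the exponent of [wt] is the sum of the [U k * z k + U k ^ 2 / 2], where the terms
    [U k * z k] are centred. *)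
Lemma Rint_ln_ratio :
  (\int[Q]_w (ln (wt U w.1 (obs U w) / dens mu U (obs U w)))%:E =
   ((\sum_k \int[mu]_s U k s ^+ 2) / 2 - info mu U)%:E)%E.
Proof.
have iU2 k : intg Q (fun w => U k w.1 ^+ 2 / 2).
  by have [_ i2] := hU k; apply: intgZr; exact: (intg_fst gam i2).
have iS : intg Q (fun w => \sum_k (U k w.1 * tnth w.2 k + U k w.1 ^+ 2 / 2)).
  by apply: intg_sum => k _; apply: intgD => //; exact: intg_sig_noise.
have iL := intg_ln_dens_obs hU hU.
pose g w := \sum_k (U k w.1 * tnth w.2 k + U k w.1 ^+ 2 / 2) - ln (dens mu U (obs U w)).
have ig : intg Q g by exact: intgB.
transitivity (\int[Q]_w (g w)%:E)%E.
  apply: eq_integral => w _; congr (_%:E).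
  rewrite ln_div ?posrE ?wt_gt0 ?dens_gt0// /wt expRK /g; congr (_ - _).
  by apply: eq_bigr => k _; rewrite tnth_mktuple; field.
rewrite -Rint_EFin//; congr (_%:E).
rewrite RintB//; congr (_ - _); rewrite Rint_sum; last first.
  by move=> k _; apply: intgD => //; exact: intg_sig_noise.
rewrite mulr_suml; apply: eq_bigr => k _.
rewrite RintD//; last exact: intg_sig_noise.
have [_ i2] := hU k.
rewrite RintZr; last exact: (intg_fst gam i2).
rewrite (Rint_fst gam i2) -[RHS]add0r; congr (_ + _).
have it : intg gam (fun y => tnth y k) := intg_sqr_intg (measurable_tnth k) (intg_tnth_sqr (R := R) k).
by rewrite (Rint_mul (sqint_intg k hU) it) Rint_tnth0 mulr0.
Qed.

Section joint_law.
Context dO (Om : measurableType dO) (P : probability Om R).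
Variables (X : {RV P >-> S}) (V : {RV P >-> Y}) (Z : Om -> Y).
Hypotheses (mZ : measurable_fun setT Z) (VE : forall w, V w = obs U (X w, Z w)).
Hypothesis hXZ : forall A, measurable A -> P ((fun w => (X w, Z w)) @^-1` A) = Q A.

Let mXZ : measurable_fun setT (fun w => (X w, Z w)).
Proof. by apply: measurable_fun_pair => //; exact: measurable_funPT. Qed.

Let mobs : measurable_fun setT (fun w => (w.1, obs U w)).
Proof. exact: (measurable_obs_pair mU). Qed.

Let mrnd : measurable_fun setT rnd.
Proof.
rewrite (_ : rnd = fun w => wt U w.1 w.2 * expR (- ln (dens mu U w.2))).
  apply: measurable_funM; first exact: measurable_wt.
  apply: measurableT_comp => //; apply: measurableT_comp => //.
  exact: (measurableT_comp (measurable_ln_dens mu mU) measurable_snd).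
by apply/funext => w; rewrite expRN lnK ?posrE ?dens_gt0.
Qed.

Let rnd0 w : 0 <= rnd w.
Proof. by rewrite divr_ge0 ?wt_ge0 ?dens_ge0. Qed.

Let joint_integral (f : S * Y -> \bar R) : measurable_fun setT f -> (forall w, 0 <= f w)%E ->
  (\int[P]_w f (X w, V w) = \int[Q]_w (f w * (wt U w.1 w.2)%:E))%E.
Proof.
move=> mf f0; rewrite -(ge0_integral_obs_pair mu mU mf f0).
rewrite -(law_ge0_integral mXZ hXZ (measurableT_comp mf mobs) (fun w => f0 _)).
by apply: eq_integral => w _; rewrite VE.
Qed.

Let product_integral (f : S * Y -> \bar R) : measurable_fun setT f -> (forall w, 0 <= f w)%E ->
  (\int[(distribution P X \x distribution P V)%E]_w f w =
   \int[Q]_w (f w * (dens mu U w.2)%:E))%E.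
Proof.
move=> mf f0.
have md : measurable_fun setT (fun y : Y => (dens mu U y)%:E).
  by apply/measurable_EFinP; exact: (measurable_dens mu mU).
have mfd : measurable_fun setT (fun w : S * Y => (f w * (dens mu U w.2)%:E)%E).
  by apply: emeasurable_funM => //; exact: (measurableT_comp md measurable_snd).
have fd0 w : (0 <= f w * (dens mu U w.2)%:E)%E by rewrite mule_ge0// lee_fin dens_ge0.
have inner s : (\int[distribution P V]_y f (s, y) = \int[gam]_y (f (s, y) * (dens mu U y)%:E))%E.
  have mfs : measurable_fun setT (fun y => f (s, y)) := measurableT_comp mf (pair1_measurable s).
  rewrite ge0_integral_distribution//.
  rewrite -(ge0_integral_obs mu mU mfs (fun y => f0 _)).
  have mo := measurableT_comp mfs (measurable_obs mU).
  rewrite -(law_ge0_integral mXZ hXZ mo (fun w => f0 _)).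
  by apply: eq_integral => w _ /=; rewrite VE.
rewrite fubini_tonelli1// [RHS]fubini_tonelli1//.
have mF : measurable_fun setT (fun s => \int[gam]_y (f (s, y) * (dens mu U y)%:E))%E.
  by refine (@measurable_fun_fubini_tonelli_F _ _ _ _ _ gam _ mfd _).
have F0 s : (0 <= \int[gam]_y (f (s, y) * (dens mu U y)%:E))%E.
  by apply: integral_ge0 => y _; exact: fd0.
rewrite /fubini_F; under eq_integral do rewrite inner.
rewrite ge0_integral_distribution//.
have hX A (mA : measurable A) : P (X @^-1` A) = mu A.
  rewrite -(law_fst mu gam mA) -hXZ//.
  by rewrite -[X in measurable X]setTI; exact: measurable_fst.
by rewrite -(law_ge0_integral (measurable_funPT X) hX mF F0).
Qed.

(** Against [mu \x gam] the joint law has density [wt] and the product of the marginals has density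
    [dens]; the divergence is the mean logarithm of their quotient. *)
Lemma mutual_information_obs :
  mutual_information P X V = ((\sum_k \int[mu]_s U k s ^+ 2) / 2 - info mu U)%:E.
Proof.
rewrite /mutual_information (@kl_divergence_density _ _ _ _ _ rnd)//; last first.
  move=> A mA.
  have mA1 : measurable_fun setT (fun w : S * Y => (\1_A w)%:E : \bar R).
    by apply/measurable_EFinP; exact: measurable_indic.
  have A0 w : (0 <= (\1_A w)%:E :> \bar R)%E by rewrite lee_fin.
  rewrite integral_mkcond.
  rewrite (_ : (_ \_ A) = fun w => ((\1_A w)%:E * (rnd w)%:E)%E); last first.
    by apply/funext => w; rewrite patchE indicE; case: (w \in A); rewrite ?mul1e ?mul0e.
  rewrite product_integral; last 2 first.
  - by apply: emeasurable_funM => //; exact/measurable_EFinP.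
  - by move=> w; rewrite mule_ge0// lee_fin.
  transitivity (\int[Q]_w ((\1_A w)%:E * (wt U w.1 w.2)%:E))%E; last first.
    apply: eq_integral => w _; rewrite -!EFinM /rnd -mulrA divfK//.
    by rewrite gt_eqF// dens_gt0.
  rewrite -joint_integral//.
  have mJ : measurable_fun setT (fun w => (X w, V w)).
    by apply: measurable_fun_pair; exact: measurable_funPT.
  have mB : measurable ((fun w => (X w, V w)) @^-1` A).
    by rewrite -[X in measurable X]setTI; exact: mJ.
  rewrite -[LHS]/(P ((fun w => (X w, V w)) @^-1` A)).
  rewrite -[in LHS](setIT (_ @^-1` _)) -integral_indic//.
rewrite -Rint_ln_ratio.
have mln : measurable_fun setT (fun w => ln (rnd w)) by exact: measurableT_comp.
have mJ : measurable_fun setT (fun w => (X w, V w)).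
  by apply: measurable_fun_pair; exact: measurable_funPT.
rewrite -(law_integral (m := distribution P (joint_rv X V)) mJ (fun A _ => erefl) mln).
rewrite -(law_integral mXZ hXZ (measurableT_comp mln mobs)).
by apply: eq_integral => w _; rewrite /= VE.
Qed.

End joint_law.
End gaussian_information.

Section spiked_wigner_channel.
Context {R : realType} d (Om : measurableType d) (P : probability Om R) (n : nat).
Variables (X : 'I_n -> {RV P >-> R}) (Z : edge n -> {RV P >-> R}) (P0 : probability R R).
Hypothesis hXZ : spiked_wigner P X Z P0.
Hypothesis ix2 : intg P0 (fun x => x ^+ 2).
Variable lam : R.
Hypotheses (lam0 : 0 <= lam) (n0 : (0 < n)%N).
Local Notation ne := #|edge n|.
Local Notation mu := (iprod P0 n).
Local Notation gam := (iprod (stdn R) ne).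
Local Notation Q := (mu \x gam)%E.
Local Notation U := (Uedge (n := n) lam (fun x => x)).
Local Notation u := (uedge (n := n) (fun x : R => x)).
Local Notation rho := (\int[P0]_x ((x : R) ^+ 2)).

Let mid : measurable_fun setT (fun x : R => x). Proof. exact: measurable_id. Qed.
Let hU : sqint mu U. Proof. exact: sqint_Uedge. Qed.
Let hu : sqint mu u. Proof. exact: sqint_uedge. Qed.

Definition noise (w : Om) : ne.-tuple R := [tuple Z (enum_val k) w | k < ne].

Lemma measurable_noise : measurable_fun setT noise.
Proof.
apply/measurable_fun_tnthP => k.
rewrite (_ : _ \o _ = Z (enum_val k)); first exact: measurable_funPT.
by apply/funext => w /=; rewrite tnth_mktuple.
Qed.

(** Mutual independence is tested on boxes, the edges being reindexed by [enum_val]. *)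
Lemma law_signal_noise A : measurable A ->
  P ((fun w => (signal X w, noise w)) @^-1` A) = Q A.
Proof.
have [hX hZ hI] := hXZ.
move=> mA; apply: (law_iprod2 (measurable_funPT (signal X)) measurable_noise _ mA) => B C mB mC.
pose D (s : 'I_n + edge n) := match s with inl i => B i | inr e => C (enum_rank e) end.
have mD s : measurable (D s) by case: s => [i|e]; [exact: mB|exact: mC].
have := hI D mD; rewrite big_sumType/=.
rewrite [X in P X = _ -> _](_ : _ = signal X @^-1` box B `&` noise @^-1` box C); last first.
  apply/seteqP; split => w /=.
    move=> h; split => k; rewrite tnth_mktuple; first exact: (h (inl k)).
    by have := h (inr (enum_val k)); rewrite /= enum_valK; apply.
  move=> [h1 h2] [i|e] _ /=; first by have := h1 i; rewrite tnth_mktuple.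
  by have := h2 (enum_rank e); rewrite tnth_mktuple enum_rankK.
move=> ->; congr (_ * _)%E; first by apply: eq_bigr => i _; exact: hX.
rewrite (reindex (enum_val : 'I_ne -> edge n)); last exact/onW_bij/enum_val_bij.
by apply: eq_bigr => k _; rewrite enum_valK; exact: hZ.
Qed.

Let obsE w : observation X Z lam w = obs U (signal X w, noise w).
Proof.
apply: eq_from_tnth => k; rewrite !tnth_mktuple addrC; congr (_ + _).
by rewrite /Uedge /uedge /eu /= !tnth_mktuple.
Qed.

Lemma mutual_information_spiked_wigner :
  mutual_information P (signal X) (observation X Z lam) =
  (lam / 4 * (n%:R - 1) * rho ^+ 2 - info mu U)%:E.
Proof.
rewrite (mutual_information_obs hU measurable_noise obsE law_signal_noise).
congr ((_ - _)%:E).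
have np : n%:R != 0 :> R by rewrite gt_eqF// ltr0n.
have E k : \int[mu]_s U k s ^+ 2 = lam / n%:R * rho ^+ 2.
  have [i1 E1] := Rint_uedge_mul k ix2 ix2.
  rewrite [in RHS]expr2 -E1 -RintZ//; apply: eq_Rint => s.
  by rewrite /Uedge /uedge /eu !exprMn sqr_sqrtr// divr_ge0.
rewrite (eq_bigr (fun=> lam / n%:R * rho ^+ 2)); last by move=> k _; exact: E.
rewrite sumr_const card_ord -[_ *+ _]mulr_natl card_edge; set r := rho.
by clearbody r; field.
Qed.

(** Once the auxiliary sample is frozen, a randomised estimator is a function of the observation, so
    posterior means remain optimal among all of them. *)
Lemma mmse_spiked_wigner :
  mmse P X Z lam = (2 / (n%:R * (n%:R - 1)) *
    \sum_(k < ne) (rho ^+ 2 - \int[Q]_w avg mu U (u k) (obs U w) ^+ 2))%:E.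
Proof.
set c := 2 / _; pose M k := \int[Q]_w avg mu U (u k) (obs U w) ^+ 2.
have c0 : 0 <= c.
  by rewrite divr_ge0// mulr_ge0// subr_ge0 ler1n.
have Eu k : \int[mu]_s u k s ^+ 2 = rho ^+ 2.
  have [i1 E1] := Rint_uedge_mul k ix2 ix2.
  by rewrite [in RHS]expr2 -E1; apply: eq_Rint => s; rewrite exprMn.
have mu_ k : measurable_fun setT (u k) by case: (hu k).
have iu2 k : intg mu (fun s => u k s ^+ 2) by case: (hu k).
have spE k w : spike X (enum_val k) w = u k (signal X w).
  by rewrite /spike /uedge /eu !tnth_mktuple.
have mXN : measurable_fun setT (fun w => (signal X w, noise w)).
  by apply: measurable_fun_pair; [exact: measurable_funPT|exact: measurable_noise].
have lawE k (th : ne.-tuple R -> R) : measurable_fun setT th ->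
    (\int[P]_w ((spike X (enum_val k) w - th (observation X Z lam w)) ^+ 2)%:E =
     \int[Q]_w ((u k w.1 - th (obs U w)) ^+ 2)%:E)%E.
  move=> mth.
  rewrite -(law_ge0_integral mXN law_signal_noise).
  - by apply: eq_integral => w _; rewrite spE obsE.
  - apply/measurable_EFinP; apply: measurable_funX; apply: measurable_funB.
      exact: (measurableT_comp (mu_ k)).
    exact: (measurableT_comp mth (measurable_obs (sqintW hU))).
  - by move=> w; rewrite lee_fin sqr_ge0.
have mspike e : measurable_fun setT (spike X e).
  by apply: measurable_funM; exact: measurable_funPT.
apply/le_anti/andP; split.
  apply: ereal_inf_lbound.
  (* The estimator ignores its auxiliary sample; [R] under [P0] is an arbitrary choice of auxiliary
     space. *)
  exists _, R, P0, (fun e (w : ne.-tuple R * R) => avg mu U (u (enum_rank e)) w.1); split.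
    move=> e; apply: (measurableT_comp _ measurable_fst).
    exact: (measurable_avg (sqintW hU) (sqint_intg _ hu)).
  rewrite /mse EFinM; congr (_ * _)%E.
  rewrite -sumEFin (reindex (enum_val : 'I_ne -> edge n)); last exact/onW_bij/enum_val_bij.
  apply: eq_bigr => k _; rewrite enum_valK.
  have mav := measurable_avg (sqintW hU) (sqint_intg k hu).
  rewrite -(Eu k) -(integral_mse_avg hU (mu_ k) (iu2 k)) -(lawE k _ mav).
  rewrite -(law_ge0_integral (@measurable_fst _ _ Om R) (law_fst P P0))//; last first.
    by move=> w; rewrite lee_fin sqr_ge0.
  apply/measurable_EFinP; apply: measurable_funX; apply: measurable_funB => //.
  exact: (measurableT_comp mav (measurable_funPT (observation X Z lam))).
rewrite /mmse; apply: le_ereal_inf_tmp => _ [dS [S [Q' [th [mth ->]]]]].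
rewrite /mse EFinM; apply: lee_wpmul2l; first by rewrite lee_fin.
rewrite -sumEFin (reindex (enum_val : 'I_ne -> edge n)); last exact/onW_bij/enum_val_bij.
apply: lee_sum => k _.
set F := fun w : Om * S => _.
have mF : measurable_fun setT F.
  apply/measurable_EFinP; apply: measurable_funX; apply: measurable_funB.
    exact: (measurableT_comp (mspike _) measurable_fst).
  apply: (measurableT_comp (mth _)); apply: measurable_fun_pair => //.
  exact: (measurableT_comp (measurable_funPT (observation X Z lam)) measurable_fst).
have F0 w : (0 <= F w)%E by rewrite lee_fin sqr_ge0.
rewrite (fubini_tonelli2 F mF F0).
have inner s : ((rho ^+ 2 - M k)%:E <= \int[P]_w F (w, s))%E.
  have mths : measurable_fun setT (fun y => th (enum_val k) (y, s)).
    exact: (measurableT_comp (mth _) (pair2_measurable s)).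
  rewrite -(Eu k); apply: le_trans (ge0_integral_mse_ge hU (mu_ k) (iu2 k) mths) _.
  by rewrite -(lawE k _ mths).
have cst r : (r%:E = \int[Q']_g r%:E)%E.
  by rewrite -(Rint_EFin (intg_cst Q' r)) Rint_cst.
rewrite [X in (X <= _)%E]cst; apply: ge0_le_integral.
- exact: measurableT.
- move=> s _; rewrite lee_fin subr_ge0 -(Eu k).
  exact: (Rint_avg_sqr_obs_le (sqintW hU) (mu_ k) (iu2 k)).
- exact: measurable_cst.
- by refine (@measurable_fun_fubini_tonelli_G _ _ _ _ _ P _ mF _).
- by move=> s _; exact: inner.
Qed.

End spiked_wigner_channel.

(** * Limits in [n] and conclusion *)

Section limits.
Context {R : realType}.

Lemma cvg_EFin_near (f : nat -> \bar R) (g : nat -> R) (l : R) :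
  (\forall n \near \oo, f n = (g n)%:E) -> g n @[n --> \oo] --> l ->
  f n @[n --> \oo] --> l%:E.
Proof.
move=> fg gl; apply: cvg_trans (cvg_EFin (F := \oo) (f := fun n => (g n)%:E) _ gl); last first.
  by near=> n.
by apply: near_eq_cvg; near=> n; apply/esym; near: n.
Unshelve. all: by end_near. Qed.

Lemma sup_attained (S : set R) (x : R) : S x -> ubound S x -> sup S = x.
Proof.
move=> Sx ux; apply/le_anti/andP; split; first by apply: ge_sup => //; exists x.
by apply: ub_le_sup => //; exists x.
Qed.

Lemma natV_cvg0 (C : R) : (fun n => C / n%:R) @ \oo --> (0 : R).
Proof.
apply/cvgrPdist_le => e e0; near=> n.
have np : 0 < n%:R :> R by rewrite ltr0n; near: n; exact: nbhs_infty_gt.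
have : `|C| + Num.sqrt n%:R * 0 <= n%:R * e by near: n; exact: affine_sqrt_growth.
rewrite mulr0 addr0 sub0r normrN normrM normfV (gtr0_norm np) ler_pdivrMr//.
by rewrite mulrC.
Unshelve. all: by end_near. Qed.

End limits.

Opaque psi info.

Section replica_symmetric_formula.
Context {R : realType} (P0 : probability R R).
Hypothesis ix2 : intg P0 (fun x => x ^+ 2).

Definition rs_sup (lam : R) : R := sup [set potential P0 lam q | q in [set q | 0 <= q]].

Lemma argmax_psi_ex lam : 0 < lam -> exists q, argmax (psi P0) lam q.
Proof. by move=> lam0; have [q q0 hq] := maximizer_exists ix2 lam0; exists q. Qed.

Lemma is_maximizerP lam q : 0 < lam -> is_maximizer P0 lam q <-> argmax (psi P0) lam q.
Proof.
move=> lam0; have pE := fun q => @potentialE R P0 ix2 lam q (ltW lam0).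
split=> -[q0 hq]; split; [exact: q0|move=> q' q'0|exact: q0|move=> q' q'0].
  by have := hq _ q'0; rewrite (pE q q0) (pE q' q'0).
by rewrite (pE q q0) (pE q' q'0); exact: hq.
Qed.

Lemma rs_supE lam q : 0 < lam -> argmax (psi P0) lam q -> rs_sup lam = pot P0 lam q.
Proof.
move=> lam0 [q0 hq]; have pE := fun q => @potentialE R P0 ix2 lam q (ltW lam0).
apply: sup_attained; first by exists q => //; exact: pE.
by move=> _ [q' q'0 <-]; rewrite (pE q' q'0); exact: hq.
Qed.

Lemma psi_subgradient_ex s : 0 < s -> exists m, forall s', 0 < s' ->
  psi P0 s + m * (s' - s) <= psi P0 s'.
Proof. by move=> s0; exists (postm2 P0 s / 2) => s' s'0; exact: psi_subgradient. Qed.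

Lemma limit_informationE lam :
  limit_information P0 lam = second_moment P0 ^+ 2 / 4 * lam - rs_sup lam.
Proof. by rewrite /limit_information -/(rs_sup lam); congr (_ - _); ring. Qed.

Local Notation J n lam := (info (iprod P0 n) (Uedge (n := n) lam (fun x => x))).

Lemma info_edge_limit lam eps : 0 < lam -> 0 < eps ->
  \forall n \near \oo, `|J n lam - n%:R * rs_sup lam| <= n%:R * eps.
Proof.
move=> lam0 eps0; have [q hq] := argmax_psi_ex lam0; have [q0 hq'] := hq.
have phiE := rs_supE lam0 hq.
have h1 := info_edge_limsup ix2 lam0 eps0 hq'.
have h2 := info_edge_liminf ix2 lam0 eps0 q0.
near=> n; rewrite phiE.
have k1 : J n lam <= n%:R * (pot P0 lam q + eps) by near: n; exact: h1.
have k2 : n%:R * (pot P0 lam q - eps) <= J n lam by near: n; exact: h2.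
move: k1 k2; move: (info _ _) (pot _ _ _) => a b; clear => k1 k2.
by rewrite ler_norml; apply/andP; split; lra.
Unshelve. all: by end_near. Qed.

Let mid : measurable_fun setT (fun x : R => x). Proof. exact: measurable_id. Qed.

(** A sum over about [n ^ 2 / 2] edges divided by [n ^ 2]: at points of differentiability its limit
    is [q ^ 2 / 2]. *)
Definition overlap lam n : R := (\sum_(k < #|edge n|)
  \int[(iprod P0 n \x iprod (stdn R) #|edge n|)%E]_w
    avg (iprod P0 n) (Uedge (n := n) lam (fun x => x)) (uedge (fun x => x) k)
      (obs (Uedge lam (fun x => x)) w) ^+ 2) / n%:R ^+ 2.

Lemma info_edge_tangent lam n h : 0 < lam -> -1 < h ->
  J n lam + lam * h * (n%:R * overlap lam n) <= J n (lam * (1 + h) ^+ 2).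
Proof.
move=> lam0 h1.
have hu := @sqint_uedge R n P0 (fun x => x) mid ix2.
apply: le_trans (info_tangent_coef (fun=> Num.sqrt (lam / n%:R))
  (fun=> Num.sqrt (lam * (1 + h) ^+ 2 / n%:R)) hu).
rewrite lerD2l -mulr_sumr /overlap; set S := \sum_(k < _) _; clearbody S.
have ln0 : 0 <= lam / n%:R by rewrite divr_ge0// ltW.
have -> : lam * (1 + h) ^+ 2 / n%:R = lam / n%:R * (1 + h) ^+ 2 by ring.
rewrite (sqrtrM _ ln0) sqrtr_sqr ger0_norm; last by lra.
have -> : Num.sqrt (lam / n%:R) * (Num.sqrt (lam / n%:R) * (1 + h) - Num.sqrt (lam / n%:R)) =
    lam / n%:R * h by rewrite -[in RHS](sqr_sqrtr ln0); ring.
(* For [n = 0] the convention [0^-1 = 0] annihilates both terms. *)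
have [->|n0] := eqVneq (n%:R : R) 0; first by rewrite !(mul0r, invr0, mulr0).
by rewrite le_eqVlt; apply/orP; left; apply/eqP; field.
Qed.

End replica_symmetric_formula.

Theorem theorem1 (R : realType) (P0 : probability R R)
  (hP0 : P0.-integrable [set: R] (fun x : R => (x ^+ 2)%:E))
  (d : nat -> measure_display) (Om : forall n, measurableType (d n))
  (P : forall n, probability (Om n) R)
  (X : forall n, 'I_n -> {RV (P n) >-> R})
  (Z : forall n, edge n -> {RV (P n) >-> R})
  (hXZ : forall n, (0 < n)%N -> spiked_wigner (P n) (X n) (Z n) P0) :
  [/\ (forall lambda : R, 0 < lambda ->
         (fun n => ((n%:R : R)^-1)%:E *
            mutual_information (P n)
              (signal (X n)) (observation (X n) (Z n) lambda))%E
           @ \oo --> (limit_information P0 lambda)%:E),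
      convex_function [set lambda : R^o | 0 < lambda]
        (fun lambda : R^o => - limit_information P0 lambda),
      countable ([set lambda : R | 0 < lambda] `\` differentiability_points P0) &
      forall lambda : R, differentiability_points P0 lambda ->
        exists2 q : R, unique (is_maximizer P0 lambda) q &
          (fun n => mmse (P n) (X n) (Z n) lambda) @ \oo
            --> (second_moment P0 ^+ 2 - q ^+ 2)%:E].
Proof.
pose phi := rs_sup P0; pose rho := second_moment P0.
have phiE lam q : 0 < lam -> argmax (psi P0) lam q -> phi lam = - (lam / 4) * q ^+ 2 + psi P0 (lam * q).
  exact: rs_supE.
have aex lam : 0 < lam -> exists q, argmax (psi P0) lam q by exact: argmax_psi_ex.
have LE : limit_information P0 = fun lam => rho ^+ 2 / 4 * lam - phi lam.
  by apply/funext => lam; exact: limit_informationE.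
split.
- move=> lam lam0.
  apply: (@cvg_EFin_near _ _ (fun n => rho ^+ 2 / 4 * lam - rho ^+ 2 / 4 * lam / n%:R -
      info (iprod P0 n) (Uedge (n := n) lam (fun x => x)) / n%:R)).
    near=> n; have n0 : (0 < n)%N by near: n; exact: nbhs_infty_gt.
    rewrite (mutual_information_spiked_wigner (hXZ n n0) hP0 (ltW lam0) n0) -EFinM; congr EFin.
    rewrite -/(second_moment P0) -/rho; move: (info _ _) => I.
    by field; rewrite gt_eqF// ltr0n.
  rewrite LE; apply: cvgB.
    rewrite -[X in _ --> X]subr0; apply: cvgB; first exact: cvg_cst.
    exact: natV_cvg0.
  apply/cvgrPdist_le => e e0; have h := info_edge_limit hP0 lam0 e0.
  near=> n; have np : 0 < n%:R :> R by rewrite ltr0n; near: n; exact: nbhs_infty_gt.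
  have : `|info (iprod P0 n) (Uedge (n := n) lam (fun x => x)) - n%:R * phi lam| <= n%:R * e.
    by near: n; exact: h.
  move: (info _ _) => I hI.
  have -> : phi lam - I / n%:R = - (I - n%:R * phi lam) / n%:R by field; rewrite gt_eqF.
  by rewrite normrM normrN normfV (gtr0_norm np) ler_pdivrMr// [e * _]mulrC.
- move=> t x y; rewrite !inE => /= x0 y0; rewrite LE.
  have t01 : 0 <= t%:num <= 1 by rewrite ge0 le1.
  have := phi_convex (@psi0 R P0) (psi_subgradient_ex hP0) aex phiE x0 y0 t01.
  rewrite [in X in _ -> X]convRE -![conv t x y]/(t%:num * x + (1 - t%:num) * y).
  move: (phi _) (phi x) (phi y) => a b c; rewrite /= /unstable.onem => h.
  lra.
- apply: sub_countable (phi_nonsmooth_countable aex phiE).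
  apply: subset_card_le => lam [lam0 hn]; split; first exact: lam0.
  move=> [u hu]; apply: hn.
  split; first exact: lam0.
  rewrite LE.
  exact: (has_slope_derivable (has_slope_affine_sub (rho ^+ 2 / 4) hu)).
- move=> lam [lam0 /derivable_has_slope[v hv]].
  pose u := rho ^+ 2 / 4 - v.
  have hu : has_slope phi lam u.
    have := has_slope_affine_sub (rho ^+ 2 / 4) hv; rewrite LE.
    by congr has_slope; apply/funext => y; ring.
  have [q hq] := aex _ lam0; have [q0 _] := hq.
  have qu := argmax_slope aex phiE lam0 hq hu.
  exists q.
    split; first exact/(is_maximizerP hP0 q lam0).
    move=> q' /(is_maximizerP hP0 q' lam0) hq'; have [q'0 _] := hq'.
    have q'u := argmax_slope aex phiE lam0 hq' hu.
    (* Both squares equal [4 * u], and maximizers are nonnegative. *)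
    have : q ^+ 2 = q' ^+ 2 by lra.
    by move/eqP; rewrite eqrXn2// => /eqP.
  have cA := slope_limit lam0 hu (fun l eps l0 e0 => info_edge_limit hP0 l0 e0)
    (fun n h h1 => info_edge_tangent hP0 n lam0 h1).
  (* The normalisation [2 / (n * (n - 1))] of the error, against [n ^ 2] in [overlap], leaves the
     factor [2 * (1 + 1 / (n - 1))]. *)
  apply: (@cvg_EFin_near _ _ (fun n => rho ^+ 2 - 2 * (1 + 1 / n.-1%:R) * overlap P0 lam n)).
    near=> n; have n1 : (1 < n)%N by near: n; exact: nbhs_infty_gt.
    have n0 : (0 < n)%N by exact: ltnW.
    rewrite (mmse_spiked_wigner (hXZ n n0) hP0 lam n0); congr EFin.
    rewrite /overlap sumrB sumr_const card_ord -[(_ ^+ 2) *+ _]mulr_natl card_edge.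
    rewrite -/(second_moment P0) -/rho; set S := \sum_(k < _) _; clearbody S.
    have nn : n%:R != 0 :> R by rewrite gt_eqF// ltr0n.
    have -> : n%:R = n.-1%:R + 1 :> R by rewrite natr1 prednK.
    have n'0 : n.-1%:R != 0 :> R by rewrite gt_eqF// ltr0n -subn1 subn_gt0.
    have n'1 : n.-1%:R + 1 != 0 :> R by rewrite natr1 prednK.
    by field; rewrite n'0 n'1.
  (* The limit of [overlap] is [2 * u], where [u = q ^ 2 / 4]. *)
  rewrite (_ : second_moment P0 ^+ 2 - q ^+ 2 = rho ^+ 2 - 2 * (1 + 0) * (2 * u)); last first.
    by rewrite -qu /rho; field.
  apply: cvgB; first exact: cvg_cst.
  apply: cvgM => //; apply: cvgM; first exact: cvg_cst.
  apply: cvgD; first exact: cvg_cst.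
  have h := @natV_cvg0 R 1.
  rewrite -(cvg_shiftS) /=.
  exact: h.
Unshelve. all: by end_near. Qed.
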